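(* Let $n$ and $k$ be integers with $1\le k\le \lfloor \frac{n-1}{2}\rfloor$, and let $T$ be a hypertree on $n$ vertices of rank at most three having exactly $k$ edges of size three. Then $\rho(T)\le \rho\bigl(T(n,\lfloor\frac{k}{2}\rfloor,\lceil\frac{k}{2}\rceil)\bigr)$, with equality if and only if $T\cong T(n,\lfloor\frac{k}{2}\rfloor,\lceil\frac{k}{2}\rceil)$.
   Context: A (simple) hypergraph $G$ has a vertex set $V(G)$ and an edge set $E(G)$ of subsets of $V(G)$ each of size at least two; its rank is the maximum size of an edge. A loose path from $v_0$ to $v_p$ of length $p$ is an alternating sequence $(v_0,e_1,v_1,\dots,e_p,v_p)$ of distinct vertices and distinct edges with $v_{i-1},v_i\in e_i$ and $e_i\cap e_j=\emptyset$ whenever $j>i+1$. A loose cycle of length $p$ is $(v_0,e_1,v_1,\dots,v_{p-1},e_p,v_0)$ with distinct vertices $v_0,\dots,v_{p-1}$, distinct edges, $v_{i-1},v_i\in e_i$ ($v_p=v_0$), and $e_i\cap e_j=\emptyset$ whenever $|i-j|>1$ and $\{i,j\}\ne\{1,p\}$. $G$ is connected if any two vertices are joined by a loose path; a hypertree is a connected hypergraph with no loose cycle. For a connected hypergraph, $d_G(u,v)$ is the length of a shortest loose path from $u$ to $v$, the distance matrix is $D(G)=(d_G(u,v))_{u,v\in V(G)}$, and $\rho(G)$ (the distance spectral radius) is the largest eigenvalue of $D(G)$. For integers $n,a,b$ with $0\le a\le b$ and $a+b\le\lfloor\frac{n-1}{2}\rfloor$, put $\ell=n-a-b$ and $I=\{1,\dots,a\}\cup\{\ell-b,\dots,\ell-1\}$;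 $T(n,a,b)$ is the hypertree with vertex set $\{v_1,\dots,v_\ell\}\cup\{w_i:i\in I\}$ and edges $\{v_i,w_i,v_{i+1}\}$ for $i\in I$ and $\{v_i,v_{i+1}\}$ for $i\in\{1,\dots,\ell-1\}\setminus I$ (i.e. it is obtained from the path $v_1v_2\cdots v_\ell$ by inserting a new degree-one vertex $w_i$ into the edge $\{v_i,v_{i+1}\}$ for each $i\in I$). *)

(* Defs.v *)
From HB Require Import structures.
From mathcomp Require Import all_boot all_order all_algebra.
From mathcomp Require Import reals.
Set Implicit Arguments. Unset Strict Implicit. Unset Printing Implicit Defensive.
Import Order.TTheory GRing.Theory Num.Theory.

(* A hypergraph on the vertex set 'I_n is given by its edge set
   E : {set {set 'I_n}}.  Vertices and paths are 0-indexed below. *)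

Definition hypergraph (n : nat) (E : {set {set 'I_n}}) : Prop :=
  forall e, e \in E -> 2 <= #|e|.

Definition rank_le3 (n : nat) (E : {set {set 'I_n}}) : Prop :=
  forall e, e \in E -> #|e| <= 3.

Definition num_3edges (n : nat) (E : {set {set 'I_n}}) : nat :=
  #|[set e in E | #|e| == 3]|.

(* (v_0,e_1,v_1,...,e_p,v_p) written 0-based as vs = v_0..v_p, es = e_1..e_p:
   es_i contains vs_i and vs_{i+1}; es_i, es_j disjoint when j > i+1. *)
Definition is_loose_path (n p : nat) (E : {set {set 'I_n}}) (u v : 'I_n)
    (vs : (p.+1).-tuple 'I_n) (es : p.-tuple {set 'I_n}) : bool :=
  [&& tnth vs ord0 == u, tnth vs ord_max == v, uniq vs, uniq es,
      all (fun e => e \in E) es,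
      [forall i : 'I_p, (tnth vs (widen_ord (leqnSn p) i) \in tnth es i)
                        && (tnth vs (lift ord0 i) \in tnth es i)] &
      [forall i : 'I_p, forall j : 'I_p,
         (i.+1 < j) ==> [disjoint tnth es i & tnth es j]]].

Definition has_loose_path (n : nat) (E : {set {set 'I_n}}) (u v : 'I_n)
    (p : nat) : bool :=
  [exists vs : (p.+1).-tuple 'I_n, exists es : p.-tuple {set 'I_n},
     is_loose_path E u v vs es].

(* (v_0,e_1,...,v_{p-1},e_p,v_0), 0-based: es_i contains vs_i and
   vs_{(i+1) mod p}; es_i, es_j (i<j) disjoint when j > i+1 and
   {i,j} <> {0,p-1}.  Length p >= 2. *)
Definition is_loose_cycle (n p : nat) (E : {set {set 'I_n}})
    (vs : p.-tuple 'I_n) (es : p.-tuple {set 'I_n}) : bool :=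
  [&& 2 <= p, uniq vs, uniq es, all (fun e => e \in E) es,
      [forall i : 'I_p, (tnth vs i \in tnth es i)
         && [exists j : 'I_p, (val j == (i.+1 %% p)) && (tnth vs j \in tnth es i)]] &
      [forall i : 'I_p, forall j : 'I_p,
         ((i.+1 < j) && ~~ ((val i == 0) && (val j == p.-1)))
           ==> [disjoint tnth es i & tnth es j]]].

Definition has_loose_cycle (n : nat) (E : {set {set 'I_n}}) : Prop :=
  exists p (vs : p.-tuple 'I_n) (es : p.-tuple {set 'I_n}), is_loose_cycle E vs es.

Definition connected (n : nat) (E : {set {set 'I_n}}) : Prop :=
  forall u v : 'I_n, exists p, has_loose_path E u v p.

Definition hypertree (n : nat) (E : {set {set 'I_n}}) : Prop :=
  hypergraph E /\ connected E /\ ~ has_loose_cycle E.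

(* d_G(u,v): the least p with a loose path of length p from u to v
   (any loose path has length < n since its vertices are distinct). *)
Definition dist (n : nat) (E : {set {set 'I_n}}) (u v : 'I_n) : nat :=
  find (has_loose_path E u v) (iota 0 n).

Definition dist_matrix (R : realType) (n : nat) (E : {set {set 'I_n}}) : 'M[R]_n :=
  \matrix_(u < n, v < n) ((dist E u v)%:R)%R.

Definition largest_eigenvalue (R : realType) (n : nat) (A : 'M[R]_n) (r : R) : Prop :=
  eigenvalue A r /\ forall s, eigenvalue A s -> (s <= r)%R.

Definition isomorphic (n : nat) (E F : {set {set 'I_n}}) : Prop :=
  exists f : 'I_n -> 'I_n, bijective f /\ F = [set f @: (e : {set 'I_n}) | e in E].

(* T(n,a,b) on 'I_n: with l = n-a-b, path vertices v_1..v_l are 0..l-1;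
   the edge {v_{j+1},v_{j+2}} (j = 0..l-2) receives an extra vertex w when
   j+1 \in I: for j < a the vertex w = l + j, for j >= l-b-1 the vertex
   w = l + a + (j - (l-b-1)). *)
Definition Tedge (n a b j : nat) : {set 'I_n} :=
  let l := n - a - b in
  [set x : 'I_n | [|| val x == j, val x == j.+1,
                      (j < a) && (val x == l + j) |
                      (l - b - 1 <= j) && (val x == l + a + (j - (l - b - 1)))]].

Definition Tnab (n a b : nat) : {set {set 'I_n}} :=
  [set Tedge n a b (val j) | j : 'I_n & val j < n - a - b - 1].

(* Main.v *)
(* Let x be the Perron vector of D(T).  Root T at a vertex minimising the
   x-weighted distance sum.  Then x^T D(T) x is twice a sum over the edges of
   the x-weight of the pairs they separate.  Exchanging branches straightens
   the branches at the root into chains, and merging the chains yields a path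
   with third vertices inserted into some edges; the form increases strictly
   unless T already had this shape.

   It remains to compare the possible sets P of positions of the third
   vertices.  Let P have maximal spectral radius.  On positions 0, ..., 2 L
   the distance is (|s - t| + o_s + o_t) / 2 off the diagonal, where o is the
   parity.  The potential of the Perron vector is convex, and moving a third
   vertex to a free edge cannot increase the form, so the free edges are
   consecutive.  If the two end segments of triangles differ in length by at
   least two, symmetrise the vector about the centre of the path while moving
   the unpaired triangles outwards: since the metric is of negative type, the
   form would become larger.  So P is balanced. *)

(* The choice of the root makes the straightening work: minimality bounds the weight below every
   edge at the root, and these inequalities make each exchange gain. Inside a branch they follow
   from its weight being less than half of the total. All exchanges are tested on one fixed vector
   [x], so only the form has to grow.

   For the positions, two shapes are never compared directly. All sets [P] share one index type of
   [2 L + 1] positions, and the best [P] is tested against all competitors at once. Adding the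
   parity to the diagonal of the distance removes the exception there; in return the eigenvalue [M]
   becomes [M + 1] at odd positions, a weight that both the reflection and the moves of third
   vertices respect.

   The obstacle in symmetrising is the part of the vector whose support is already symmetric: its
   odd component is lost as well. Optimality, applied once more to the absolute value of that
   component, pays for it; the parallelogram identity then costs a factor 2 in the final inequality.
   An odd number of triangles to be moved leaves one without a partner, hence the distinction of
   cases at the end. *)
Require Import Defs.
From HB Require Import structures.
From mathcomp Require Import all_boot all_order all_algebra.
From mathcomp Require Import reals.
From mathcomp Require mathcomp_extra boolp classical_sets functions topology normedtype derive.
From mathcomp Require Import zify ring lra.
Set Implicit Arguments. Unset Strict Implicit. Unset Printing Implicit Defensive.
Import Order.TTheory GRing.Theory Num.Theory.

(** * Loose paths and distance certificates *)

Section LoosePaths.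
Variable n : nat.
Implicit Types (E : {set {set 'I_n}}) (g : 'I_n -> nat).

Definition adj E (u v : 'I_n) : bool := [exists e in E, (u \in e) && (v \in e)].

Definition walk E (u v : 'I_n) (p : nat) : Prop :=
  exists s, [/\ path (adj E) u s, last u s = v & size s = p].

Lemma adjP E u v : reflect (exists e, [/\ e \in E, u \in e & v \in e]) (adj E u v).
Proof.
apply: (iffP exists_inP) => [[e eE /andP[ue ve]]|[e [eE ue ve]]]; exists e => //.
by rewrite ue.
Qed.

Lemma adj_sym E : symmetric (adj E).
Proof. by move=> u v; apply/adjP/adjP => -[e [eE ue ve]]; exists e. Qed.

Lemma walk0 E u : walk E u u 0.
Proof. by exists [::]. Qed.

Lemma walk_edge E e u v : e \in E -> u \in e -> v \in e -> walk E u v 1.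
Proof. by move=> eE ue ve; exists [:: v]; split => //=; rewrite andbT; apply/adjP; exists e. Qed.

Lemma walk_cat E u v w p q : walk E u v p -> walk E v w q -> walk E u w (p + q).
Proof.
move=> [s [su sv sp]] [t [tv tw tq]]; exists (s ++ t); split.
- by rewrite cat_path su sv.
- by rewrite last_cat sv.
- by rewrite size_cat sp tq.
Qed.

Lemma walk_sym E u v p : walk E u v p -> walk E v u p.
Proof.
move=> [s [su sv sp]]; exists (rev (belast u s)); split.
- rewrite -sv; have := rev_path (adj E) u s; rewrite (eq_path (e' := adj E)) ?su//.
  by move=> x y; rewrite adj_sym.
- by case: s su sv sp => [|y s] //= _ <- _; rewrite rev_cons last_rcons.
- by rewrite size_rev size_belast.
Qed.

(** Here [g] stands for the distance to the end of the path. For Lipschitz [g], the drop by one at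
    each step already forces the distinctness and disjointness that looseness asks for. *)
Definition geodesic E g (p : nat) (f : nat -> 'I_n) (h : nat -> {set 'I_n}) : Prop :=
  (forall i, i <= p -> g (f i) = p - i) /\
  (forall i, i < p -> [/\ h i \in E, f i \in h i & f i.+1 \in h i]).

Definition lipschitz E g : Prop :=
  forall e u v, e \in E -> u \in e -> v \in e -> g u <= (g v).+1.

Lemma walk_geodesic E g u v : lipschitz E g -> g v = 0 -> walk E u v (g u) ->
  exists f h, [/\ f 0 = u, f (g u) = v & geodesic E g (g u) f h].
Proof.
move=> gE gv [s [su sv sp]].
pose f i := nth u (u :: s) i.
pose h i := odflt set0 [pick e in E | (f i \in e) && (f i.+1 \in e)].
have hP i : i < g u -> [/\ h i \in E, f i \in h i & f i.+1 \in h i].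
  rewrite -sp => ilt; have /(pathP u)/(_ _ ilt)/adjP[e [eE ue ve]] := su.
  rewrite /h; case: pickP => [e' /and3P[e1 e2 e3]|/(_ e)]; first by split.
  have [ue' ve'] : f i \in e /\ f i.+1 \in e by [].
  by rewrite eE ue' ve'.
have fp : f (g u) = v by rewrite /f -sp nth_last last_cons.
(* [low] and [up] squeeze [g (f i)]: it loses at most one per step from the start, and it is at most
   the number of steps left. *)
have low i : i <= g u -> g u <= g (f i) + i.
  elim: i => [|i IH] ilt; first by rewrite addn0.
  have [e1 e2 e3] := hP i ilt; have := gE _ _ _ e1 e2 e3; have := IH (ltnW ilt); lia.
have up j : j <= g u -> g (f (g u - j)) <= j.
  elim: j => [|j IH] jlt; first by rewrite subn0 fp gv.
  have ilt : g u - j.+1 < g u by lia.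
  have [e1 e2 e3] := hP _ ilt; have := gE _ _ _ e1 e2 e3; have := IH (ltnW jlt).
  have -> : (g u - j.+1).+1 = g u - j by lia.
  lia.
exists f, h; split => //; split => // i ilt.
have := low i ilt; have := up (g u - i) (leq_subr _ _); rewrite subKn//; lia.
Qed.

Lemma geodesic_inj E g p f h i j : geodesic E g p f h -> i <= p -> j <= p ->
  f i = f j -> i = j.
Proof. by move=> [gf _] ip jp fij; have := gf _ ip; have := gf _ jp; rewrite fij; lia. Qed.

Lemma geodesic_edge_inj E g p f h i j : lipschitz E g -> geodesic E g p f h ->
  i < p -> j < p -> h i = h j -> i = j.
Proof.
move=> gE [gf hE]; wlog ij : i j / i <= j.
  by move=> W ip jp hij; have [/W|/ltnW/W] := leqP i j; [apply|move/(_ jp ip (esym hij))].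
move=> ip jp hij; have [hi fi _] := hE _ ip; have [hj _ fj] := hE _ jp.
have := gE _ _ _ hj _ fj; rewrite -hij => /(_ _ fi); rewrite !gf//; [lia..|exact: ltnW].
Qed.

(** A common vertex [z] would be a shortcut: [p - i <= g z + 1] and [g z <= p - j.+1 + 1], against
    [i.+1 < j]. *)
Lemma geodesic_disjoint E g p f h i j : lipschitz E g -> geodesic E g p f h ->
  i.+1 < j -> j < p -> [disjoint h i & h j].
Proof.
move=> gE [gf hE] ij jp; have ip : i < p by lia.
apply/pred0P => z /=; apply/negP => /andP[zi zj].
have [hi fi _] := hE _ ip; have [hj _ fj] := hE _ jp.
have := gE _ _ _ hi fi zi; have := gE _ _ _ hj zj fj.
by rewrite !gf//; lia.
Qed.

Lemma geodesic_loose_path E g p f h : lipschitz E g -> geodesic E g p f h ->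
  has_loose_path E (f 0) (f p) p.
Proof.
move=> gE geo; apply/existsP; exists [tuple f i | i < p.+1].
apply/existsP; exists [tuple h i | i < p]; apply/and5P; split.
- by rewrite tnth_mktuple.
- by rewrite tnth_mktuple.
- rewrite map_inj_in_uniq ?enum_uniq// => i j _ _ fij.
  by apply/val_inj/(geodesic_inj geo (leq_ord i) (leq_ord j)).
- rewrite map_inj_in_uniq ?enum_uniq// => i j _ _ hij.
  exact/val_inj/(geodesic_edge_inj gE geo (ltn_ord i) (ltn_ord j)).
apply/and3P; split.
- by apply/allP => e /mapP[i _ ->]; have [_ /(_ i)[]] := geo.
- apply/forallP => i; rewrite !tnth_mktuple lift0.
  by have [_ /(_ i (ltn_ord i))[_ e1 e2]] := geo; rewrite e1 e2.
- apply/forallP => i; apply/forallP => j; apply/implyP => ij.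
  by rewrite !tnth_mktuple; exact: (geodesic_disjoint gE geo).
Qed.

Lemma loose_path_lipschitz E g u v p : lipschitz E g -> has_loose_path E u v p ->
  g u <= g v + p.
Proof.
move=> gE /existsP[vs /existsP[es /and5P[/eqP v0 /eqP vp _ _ /and3P[/allP esE /forallP H _]]]].
have step i : i <= p -> g u <= g (tnth vs (inord i)) + i.
  elim: i => [|i IH] ip.
    by rewrite addn0 -v0; have -> : inord 0 = ord0 :> 'I_p.+1 by apply/val_inj; rewrite /= inordK.
  have := IH (ltnW ip); have /andP[] := H (Ordinal ip).
  have -> : widen_ord (leqnSn p) (Ordinal ip) = inord i.
    by apply/val_inj; rewrite /= inordK// ltnW.
  have -> : lift ord0 (Ordinal ip) = inord i.+1.
    by apply/val_inj; rewrite /= inordK.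
  move=> e1 e2 IHi; have := gE _ _ _ (esE _ (mem_tnth _ _)) e1 e2.
  by move=> lip; rewrite addnS -addSn; apply: leq_trans IHi _; rewrite leq_add2r.
have := step p (leqnn p); rewrite -vp; congr (_ <= g (tnth vs _) + _).
by apply/val_inj; rewrite /= inordK.
Qed.

(** A certificate for distances. The Lipschitz condition bounds every loose path from below, and a
    plain walk of length [d u v] is automatically a geodesic, hence loose. Later constructions
    therefore only need walks. *)
Lemma distE E (d : 'I_n -> 'I_n -> nat) :
  (forall v, d v v = 0) -> (forall v, lipschitz E (d^~ v)) ->
  (forall u v, walk E u v (d u v)) -> forall u v, dist E u v = d u v.
Proof.
move=> d0 dE dW u v.
have [f [h [fu fv geo]]] := walk_geodesic (dE v) (d0 v) (dW u v).
have Hd : has_loose_path E u v (d u v).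
  by have := geodesic_loose_path (dE v) geo; rewrite fu fv.
have Hn : d u v < n.
  have inj : injective (fun i : 'I_(d u v).+1 => f i).
    by move=> i j /(geodesic_inj geo) ij; apply/val_inj/ij; exact: leq_ord.
  by have := leq_card _ inj; rewrite !card_ord.
rewrite /dist; set P := has_loose_path E u v.
have hasP : has P (iota 0 n) by apply/hasP; exists (d u v); rewrite ?mem_iota.
apply/eqP; rewrite eqn_leq; apply/andP; split.
  rewrite leqNgt; apply/negP => lt.
  by have := before_find 0 lt; rewrite nth_iota// add0n /P Hd.
have := nth_find 0 hasP; rewrite nth_iota; last by have := hasP; rewrite has_find size_iota.
by move=> /(loose_path_lipschitz (dE v)); rewrite d0 add0n.
Qed.

Lemma dist_gt0 E u v : connected E -> u != v ->
  (0 < dist E u v).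
Proof.
move=> connE uv; rewrite lt0n; apply/negP => /eqP d0.
have n0 : (0 < n) by apply: leq_ltn_trans (ltn_ord u).
have : has_loose_path E u v 0.
  have [|hasN] := boolP (has (has_loose_path E u v) (iota 0 n)).
    by move=> /(nth_find 0); rewrite -/(dist E u v) d0 nth_iota.
  (* When no length fits, [find] returns the size [n] of the list, which is positive. *)
  by move: (hasNfind hasN); rewrite -/(dist E u v) d0 size_iota => e; rewrite -e in n0.
move=> /existsP[vs /existsP[es /and3P[/eqP eu /eqP ev _]]].
by move: uv; rewrite -eu -ev (ord1 ord_max) eqxx.
Qed.

End LoosePaths.

(* [forest] lists the edges hanging below a vertex [c] that is kept outside
   the type: [Br2 y s f] is the edge {c,y} with [s] hanging at [y], and
   [Br3 y s z t f] is the edge {c,y,z} with [s] at [y] and [t] at [z]. *)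
Inductive forest (V : Type) : Type :=
| Leaf
| Br2 of V & forest V & forest V
| Br3 of V & forest V & V & forest V & forest V.
Arguments Leaf {V}.

(** * Distances in rooted forests *)

Section Forest.
Variable n : nat.
Local Notation V := 'I_n.
Implicit Types (f s t : forest V) (c u v y z : V).

Fixpoint labels f : seq V := match f with
  | Leaf => [::]
  | Br2 y s r => y :: labels s ++ labels r
  | Br3 y s z t r => (y :: labels s) ++ (z :: labels t) ++ labels r
  end.

Fixpoint edges c f : seq {set V} := match f with
  | Leaf => [::]
  | Br2 y s r => [set c; y] :: edges y s ++ edges c r
  | Br3 y s z t r => [set c; y; z] :: edges y s ++ edges z t ++ edges c r
  end.

Fixpoint triangles f : nat := match f with
  | Leaf => 0
  | Br2 _ s r => triangles s + triangles r
  | Br3 _ s _ t r => (triangles s + triangles t + triangles r).+1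
  end.

(** [P] and [Q] are the parts below an edge, with [Q] empty for an edge of size two; deleting the
    edge leaves [P], [Q] and the rest. *)
Definition separates (P Q : seq V) u v : bool :=
  ((u \in P) != (v \in P)) || ((u \in Q) != (v \in Q)).

(** In a hypertree the distance is the number of separating edges. Written as a sum over edges, it
    splits the quadratic form edge by edge. *)
Fixpoint fdist f u v : nat := match f with
  | Leaf => 0
  | Br2 y s r => separates (y :: labels s) [::] u v + fdist s u v + fdist r u v
  | Br3 y s z t r => separates (y :: labels s) (z :: labels t) u v
      + fdist s u v + fdist t u v + fdist r u v
  end.

Lemma fdistC f u v : fdist f u v = fdist f v u.
Proof.
elim: f => //= [y s IHs r IHr|y s IHs z t IHt r IHr];
  by rewrite ?IHs ?IHt ?IHr /separates ![(v \in _) == _]eq_sym.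
Qed.

Lemma fdistxx f u : fdist f u u = 0.
Proof.
by elim: f => //= [y s -> r ->|y s -> z t -> r ->]; rewrite /separates !eqxx.
Qed.

Lemma fdist_triangle f u v w : fdist f u w <= fdist f u v + fdist f v w.
Proof.
have sep P Q : separates P Q u w <= separates P Q u v + separates P Q v w.
  rewrite /separates; case: (u \in P); case: (v \in P); case: (w \in P);
  by case: (u \in Q); case: (v \in Q); case: (w \in Q).
elim: f => //= [y s IHs r IHr|y s IHs z t IHt r IHr].
  have := sep (y :: labels s) [::]; lia.
have := sep (y :: labels s) (z :: labels t); lia.
Qed.

(** Vertices outside [f] lie on the root side of each of its edges, so [fdist f] cannot tell them
    apart. *)
Lemma fdist_out f u u' v : u \notin labels f -> u' \notin labels f ->
  fdist f u v = fdist f u' v.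
Proof.
elim: f => //= [y s IHs r IHr|y s IHs z t IHt r IHr];
rewrite /separates !(mem_cat, inE) !negb_or.
  move=> /and3P[/negPf u1 us ur] /and3P[/negPf v1 vs vr].
  by rewrite (IHs us vs) (IHr ur vr) u1 v1 (negPf us) (negPf vs).
move=> /and5P[/negPf u1 us /negPf u2 ut ur] /and5P[/negPf v1 vs /negPf v2 vt vr].
rewrite (IHs us vs) (IHt ut vt) (IHr ur vr) u1 v1 u2 v2.
by rewrite (negPf us) (negPf vs) (negPf ut) (negPf vt).
Qed.

Lemma fdist_outr f u v v' : v \notin labels f -> v' \notin labels f ->
  fdist f u v = fdist f u v'.
Proof. by move=> vf vf'; rewrite fdistC (fdist_out _ vf vf') fdistC. Qed.

Lemma fdist_out0 f u v : u \notin labels f -> v \notin labels f -> fdist f u v = 0.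
Proof. by move=> uf vf; rewrite (fdist_out v uf vf) fdistxx. Qed.

Lemma edges_labels c f e u : e \in edges c f -> u \in e -> u \in c :: labels f.
Proof.
elim: f c => //= [y s IHs r IHr|y s IHs z t IHt r IHr] c; rewrite !(mem_cat, inE).
  case/or3P => [/eqP ->|es|er].
  - by rewrite !inE => /orP[] ->; rewrite ?orbT.
  - by move/(IHs _ es); rewrite inE => /orP[] ->; rewrite ?orbT.
  - by move/(IHr _ er); rewrite inE => /orP[] ->; rewrite ?orbT.
case/or4P => [/eqP ->|es|et|er].
- by rewrite !inE => /orP[/orP[]|] ->; rewrite ?orbT.
- by move/(IHs _ es); rewrite inE => /orP[] ->; rewrite ?orbT.
- by move/(IHt _ et); rewrite inE => /orP[] ->; rewrite ?orbT.
- by move/(IHr _ er); rewrite inE => /orP[] ->; rewrite ?orbT.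
Qed.

Lemma uniq_br2 c y s r : uniq (c :: labels (Br2 y s r)) ->
  [/\ uniq (y :: labels s), uniq (c :: labels r) &
      forall u, u \in y :: labels s -> u \notin c :: labels r].
Proof.
rewrite -[c :: _]/([:: c] ++ (y :: labels s) ++ labels r) uniq_catCA cat_uniq.
move=> /and3P[-> /hasPn H ->].
by split => // u us; apply/negP => /H; rewrite us.
Qed.

Lemma uniq_br3 c y s z t r : uniq (c :: labels (Br3 y s z t r)) ->
  [/\ uniq (y :: labels s), uniq (z :: labels t) & uniq (c :: labels r)] /\
  [/\ forall u, u \in y :: labels s -> u \notin c :: labels r,
      forall u, u \in z :: labels t -> u \notin c :: labels r &
      forall u, u \in y :: labels s -> u \notin z :: labels t].
Proof.
rewrite -[c :: _]/([:: c] ++ (y :: labels s) ++ (z :: labels t) ++ labels r).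
rewrite uniq_catCA cat_uniq => /and3P[-> /hasPn H1].
rewrite uniq_catCA cat_uniq => /and3P[-> /hasPn H2 ->].
have H1' u : u \in y :: labels s -> u \notin c :: (z :: labels t) ++ labels r.
  by move=> us; apply/negP => /H1; rewrite us.
split => //; split => u us.
- have := H1' u us; rewrite !(inE, mem_cat) !negb_or => /and4P[h1 _ _ h4].
  by rewrite h1 h4.
- by apply/negP => ur; have /= := H2 u ur; rewrite us.
- have := H1' u us; rewrite !(inE, mem_cat) !negb_or => /and4P[_ h2 h3 _].
  by rewrite h2 h3.
Qed.

Lemma notin_cons u c f : u \notin c :: labels f -> u \notin labels f.
Proof. by rewrite inE negb_or => /andP[]. Qed.

(** Only [e] itself can separate two of its vertices; they lie on the same side of every other
    edge. *)
Lemma fdist_edge c f e u v : uniq (c :: labels f) -> e \in edges c f ->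
  u \in e -> v \in e -> fdist f u v <= 1.
Proof.
elim: f c => //= [y s IHs r IHr|y s IHs z t IHt r IHr] c.
  move=> /uniq_br2[us ur sr]; rewrite !(inE, mem_cat) => /or3P[/eqP ->|es|er] ue ve.
  - have cs : c \notin labels s.
      by apply/negP => cs; have := sr c; rewrite !inE cs eqxx orbT => /(_ isT).
    have ys : y \notin labels s by case/andP: us.
    have yr : y \notin labels r by apply: notin_cons (sr y (mem_head _ _)).
    have cr : c \notin labels r by case/andP: ur.
    have H x : x \in [set c; y] -> (x \notin labels s) && (x \notin labels r).
      by rewrite !inE => /orP[]/eqP ->; rewrite ?cs ?cr ?ys ?yr.
    have /andP[us' ur'] := H _ ue; have /andP[vs' vr'] := H _ ve.
    by rewrite (fdist_out0 us' vs') (fdist_out0 ur' vr') !addn0 leq_b1.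
  - have ul := edges_labels es ue; have vl := edges_labels es ve.
    rewrite (fdist_out0 (notin_cons (sr _ ul)) (notin_cons (sr _ vl))) /separates ul vl.
    by rewrite add0n addn0 (IHs _ us es).
  - have ul := edges_labels er ue; have vl := edges_labels er ve.
    have N x : x \in c :: labels r -> x \notin y :: labels s.
      by move=> xr; apply/negP => /sr; rewrite xr.
    rewrite (fdist_out0 (notin_cons (N _ ul)) (notin_cons (N _ vl))) /separates.
    by rewrite (negPf (N _ ul)) (negPf (N _ vl)) add0n (IHr _ ur er).
move=> /uniq_br3[[us ut ur] [sr tr st]].
have rs x : x \in c :: labels r -> x \notin y :: labels s.
  by move=> xr; apply/negP => /sr; rewrite xr.
have rt x : x \in c :: labels r -> x \notin z :: labels t.
  by move=> xr; apply/negP => /tr; rewrite xr.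
have ts x : x \in z :: labels t -> x \notin y :: labels s.
  by move=> xt; apply/negP => /st; rewrite xt.
rewrite !(inE, mem_cat) => /or4P[/eqP ->|es|et|er] ue ve.
- have H x : x \in [set c; y; z] ->
      [&& x \notin labels s, x \notin labels t & x \notin labels r].
    rewrite !inE => /orP[/orP[]|]/eqP ->; apply/and3P; split;
    by [case/andP: us|case/andP: ut|case/andP: ur|
        apply: notin_cons (rs _ (mem_head _ _))|apply: notin_cons (rt _ (mem_head _ _))|
        apply: notin_cons (sr _ (mem_head _ _))|apply: notin_cons (tr _ (mem_head _ _))|
        apply: notin_cons (st _ (mem_head _ _))|apply: notin_cons (ts _ (mem_head _ _))].
  have /and3P[u1 u2 u3] := H _ ue; have /and3P[v1 v2 v3] := H _ ve.
  by rewrite (fdist_out0 u1 v1) (fdist_out0 u2 v2) (fdist_out0 u3 v3) !addn0 leq_b1.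
- have ul := edges_labels es ue; have vl := edges_labels es ve.
  rewrite (fdist_out0 (notin_cons (sr _ ul)) (notin_cons (sr _ vl))).
  rewrite (fdist_out0 (notin_cons (st _ ul)) (notin_cons (st _ vl))) /separates ul vl.
  by rewrite (negPf (st _ ul)) (negPf (st _ vl)) add0n !addn0 (IHs _ us es).
- have ul := edges_labels et ue; have vl := edges_labels et ve.
  rewrite (fdist_out0 (notin_cons (tr _ ul)) (notin_cons (tr _ vl))).
  rewrite (fdist_out0 (notin_cons (ts _ ul)) (notin_cons (ts _ vl))) /separates ul vl.
  by rewrite (negPf (ts _ ul)) (negPf (ts _ vl)) add0n !addn0 (IHt _ ut et).
- have ul := edges_labels er ue; have vl := edges_labels er ve.
  rewrite (fdist_out0 (notin_cons (rs _ ul)) (notin_cons (rs _ vl))).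
  rewrite (fdist_out0 (notin_cons (rt _ ul)) (notin_cons (rt _ vl))) /separates.
  rewrite (negPf (rs _ ul)) (negPf (rs _ vl)) (negPf (rt _ ul)) (negPf (rt _ vl)).
  by rewrite !add0n (IHr _ ur er).
Qed.

Lemma fdist_lipschitz (E : {set {set V}}) c f v : uniq (c :: labels f) ->
  {subset E <= edges c f} -> lipschitz E (fun u => fdist f u v).
Proof.
move=> uf Ef e u u' eE ue ue'; apply: leq_trans (fdist_triangle f u u' v) _.
by rewrite -add1n leq_add2r (fdist_edge uf (Ef _ eE) ue ue').
Qed.

(** Inside one branch the walk comes by induction; between two branches it passes through the edge
    at [c], which accounts for the one unit of [separates]. *)
Lemma fdist_walk (E : {set {set V}}) c f u v : uniq (c :: labels f) ->
  {subset edges c f <= E} -> u \in c :: labels f -> v \in c :: labels f ->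
  walk E u v (fdist f u v).
Proof.
elim: f c u v => /= [|y s IHs r IHr|y s IHs z t IHt r IHr] c u v.
- by rewrite !inE => _ _ /eqP -> /eqP ->; exact: walk0.
- move=> /uniq_br2[us ur sr] Ef.
  have rs x : x \in c :: labels r -> x \notin y :: labels s.
    by move=> xr; apply/negP => /sr; rewrite xr.
  have Es : {subset edges y s <= E} by move=> e es; apply: Ef; rewrite !(inE, mem_cat) es orbT.
  have Er : {subset edges c r <= E} by move=> e er; apply: Ef; rewrite !(inE, mem_cat) er !orbT.
  have yc : walk E y c 1.
    by apply: (@walk_edge _ _ [set c; y]); rewrite ?Ef ?inE ?eqxx ?orbT.
  have part x : x \in [:: c, y & labels s ++ labels r] ->
      (x \in y :: labels s) \/ (x \in c :: labels r).
    by rewrite !(inE, mem_cat) => /or4P[] ->; rewrite ?orbT; auto.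
  have cross a b : a \in y :: labels s -> b \in c :: labels r ->
      walk E a b (separates (y :: labels s) [::] a b + fdist s a b + fdist r a b).
    move=> aP bR; rewrite /separates aP (negPf (rs _ bR)) /=.
    rewrite (fdist_outr _ (notin_cons (rs _ bR)) (_ : y \notin labels s)); last by case/andP: us.
    rewrite (fdist_out _ (notin_cons (sr _ aP)) (_ : c \notin labels r)); last by case/andP: ur.
    rewrite (addnC 1); apply: walk_cat; last by apply: (IHr c); rewrite ?mem_head.
    by apply: walk_cat yc; apply: (IHs y); rewrite ?mem_head.
  move=> /part[uP|uR] /part[vP|vR].
  - rewrite (fdist_out0 (notin_cons (sr _ uP)) (notin_cons (sr _ vP))) /separates uP vP.
    by rewrite add0n addn0; apply: (IHs y).
  - exact: cross.
  - by apply: walk_sym; have := cross _ _ vP uR; rewrite fdistC (fdistC r) /separates eq_sym.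
  - rewrite (fdist_out0 (notin_cons (rs _ uR)) (notin_cons (rs _ vR))) /separates.
    by rewrite (negPf (rs _ uR)) (negPf (rs _ vR)) add0n; apply: (IHr c).
move=> /uniq_br3[[us ut ur] [sr tr st]] Ef.
have rs x : x \in c :: labels r -> x \notin y :: labels s.
  by move=> xr; apply/negP => /sr; rewrite xr.
have rt x : x \in c :: labels r -> x \notin z :: labels t.
  by move=> xr; apply/negP => /tr; rewrite xr.
have ts x : x \in z :: labels t -> x \notin y :: labels s.
  by move=> xt; apply/negP => /st; rewrite xt.
have Es : {subset edges y s <= E} by move=> e es; apply: Ef; rewrite !(inE, mem_cat) es orbT.
have Et : {subset edges z t <= E} by move=> e et; apply: Ef; rewrite !(inE, mem_cat) et !orbT.
have Er : {subset edges c r <= E} by move=> e er; apply: Ef; rewrite !(inE, mem_cat) er !orbT.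
have blk a b : a \in [set c; y; z] -> b \in [set c; y; z] -> walk E a b 1.
  by move=> ae be; apply: (walk_edge _ ae be); apply: Ef; rewrite mem_head.
have yc : walk E y c 1 by apply: blk; rewrite !inE eqxx ?orbT.
have zc : walk E z c 1 by apply: blk; rewrite !inE eqxx ?orbT.
have yz : walk E y z 1 by apply: blk; rewrite !inE eqxx ?orbT.
have part x : x \in [:: c, y & labels s ++ z :: labels t ++ labels r] ->
    [\/ x \in y :: labels s, x \in z :: labels t | x \in c :: labels r].
  rewrite !(inE, mem_cat) => /or4P[h|h|h|/or3P[h|h|h]]; rewrite h ?orbT.
  - exact: Or33.
  - exact: Or31.
  - exact: Or31.
  - exact: Or32.
  - exact: Or32.
  - exact: Or33.
have yns : y \notin labels s by case/andP: us.
have znt : z \notin labels t by case/andP: ut.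
have cnr : c \notin labels r by case/andP: ur.
pose d a b := separates (y :: labels s) (z :: labels t) a b + fdist s a b
  + fdist t a b + fdist r a b.
have dC a b : d a b = d b a.
  by rewrite /d fdistC (fdistC t) (fdistC r) /separates ![(b \in _) == _]eq_sym.
have PR a b : a \in y :: labels s -> b \in c :: labels r -> walk E a b (d a b).
  move=> aP bR; rewrite /d /separates aP (negPf (rs _ bR)) /=.
  rewrite (fdist_outr _ (notin_cons (rs _ bR)) yns).
  rewrite (fdist_out0 (notin_cons (st _ aP)) (notin_cons (rt _ bR))) addn0.
  rewrite (fdist_out _ (notin_cons (sr _ aP)) cnr).
  rewrite (addnC 1); apply: walk_cat; last by apply: (IHr c); rewrite ?mem_head.
  by apply: walk_cat yc; apply: (IHs y); rewrite ?mem_head.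
have QR a b : a \in z :: labels t -> b \in c :: labels r -> walk E a b (d a b).
  move=> aQ bR; rewrite /d /separates aQ (negPf (rt _ bR)) /= orbT.
  rewrite (fdist_out0 (notin_cons (ts _ aQ)) (notin_cons (rs _ bR))) addn0.
  rewrite (fdist_outr _ (notin_cons (rt _ bR)) znt).
  rewrite (fdist_out _ (notin_cons (tr _ aQ)) cnr).
  rewrite (addnC true); apply: walk_cat; last by apply: (IHr c); rewrite ?mem_head.
  by apply: walk_cat zc; apply: (IHt z); rewrite ?mem_head.
have PQ a b : a \in y :: labels s -> b \in z :: labels t -> walk E a b (d a b).
  move=> aP bQ; rewrite /d /separates aP (negPf (ts _ bQ)) /=.
  rewrite (fdist_outr _ (notin_cons (ts _ bQ)) yns).
  rewrite (fdist_out _ (notin_cons (st _ aP)) znt).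
  rewrite (fdist_out0 (notin_cons (sr _ aP)) (notin_cons (tr _ bQ))) addn0.
  rewrite (addnC 1); apply: walk_cat; last by apply: (IHt z); rewrite ?mem_head.
  by apply: walk_cat yz; apply: (IHs y); rewrite ?mem_head.
have sym a b : walk E b a (d b a) -> walk E a b (d a b) by rewrite dC; exact: walk_sym.
rewrite -/(d u v) => /part[uP|uQ|uR] /part[vP|vQ|vR]; do ?by [apply: PR|apply: QR|apply: PQ|
  apply: sym; apply: PR|apply: sym; apply: QR|apply: sym; apply: PQ].
- rewrite /d (fdist_out0 (notin_cons (sr _ uP)) (notin_cons (sr _ vP))).
  rewrite (fdist_out0 (notin_cons (st _ uP)) (notin_cons (st _ vP))) /separates uP vP.
  by rewrite (negPf (st _ uP)) (negPf (st _ vP)) add0n !addn0; apply: (IHs y).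
- rewrite /d (fdist_out0 (notin_cons (tr _ uQ)) (notin_cons (tr _ vQ))).
  rewrite (fdist_out0 (notin_cons (ts _ uQ)) (notin_cons (ts _ vQ))) /separates uQ vQ.
  by rewrite (negPf (ts _ uQ)) (negPf (ts _ vQ)) add0n !addn0; apply: (IHt z).
- rewrite /d (fdist_out0 (notin_cons (rs _ uR)) (notin_cons (rs _ vR))).
  rewrite (fdist_out0 (notin_cons (rt _ uR)) (notin_cons (rt _ vR))) /separates.
  rewrite (negPf (rs _ uR)) (negPf (rs _ vR)) (negPf (rt _ uR)) (negPf (rt _ vR)).
  by rewrite !add0n; apply: (IHr c).
Qed.

Lemma dist_forest (E : {set {set V}}) c f : uniq (c :: labels f) ->
  (forall v, v \in c :: labels f) -> E = [set e in edges c f] ->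
  forall u v, dist E u v = fdist f u v.
Proof.
move=> uf allf EE; apply: distE => [v|v|u v]; first exact: fdistxx.
  by apply: fdist_lipschitz uf _ => e; rewrite EE inE.
by apply: (fdist_walk uf) => // e ef; rewrite EE inE.
Qed.

End Forest.

(** * Counting the edges of size three *)

Section TriangleCount.
Variable n : nat.
Implicit Types (f : forest 'I_n) (c : 'I_n).

Lemma edges_nonempty c f e : e \in edges c f -> exists u, u \in e.
Proof.
elim: f c => //= [y s IHs r IHr|y s IHs z t IHt r IHr] c; rewrite !(mem_cat, inE).
  case/or3P => [/eqP ->|/IHs|/IHr] //.
  by exists c; rewrite !inE eqxx.
case/or4P => [/eqP ->|/IHs|/IHt|/IHr] //.
by exists c; rewrite !inE eqxx.
Qed.

Lemma edges_disjoint c f c' f' e : (forall u, u \in c :: labels f -> u \notin c' :: labels f') ->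
  e \in edges c f -> e \notin edges c' f'.
Proof.
move=> H ef; apply/negP => ef'; have [u ue] := edges_nonempty ef.
by have := H u (edges_labels ef ue); rewrite (edges_labels ef' ue).
Qed.

Lemma uniq_edges c f : uniq (c :: labels f) -> uniq (edges c f) /\
  count (fun e : {set 'I_n} => #|e| == 3) (edges c f) = triangles f.
Proof.
elim: f c => //= [y s IHs r IHr|y s IHs z t IHt r IHr] c.
  move=> /uniq_br2[us ur sr]; have [us' cs] := IHs _ us; have [ur' cr] := IHr _ ur.
  have cy : c != y by apply: contraTneq (sr y (mem_head _ _)) => ->; rewrite mem_head.
  rewrite count_cat cs cr cards2 cy add0n; split => //.
  rewrite mem_cat negb_or cat_uniq us' ur' andbT; apply/andP; split.
    apply/andP; split; apply/negP => /edges_labels H.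
      by have := sr c (H c _); rewrite !inE eqxx; move=> /(_ isT).
    by have := sr y (mem_head _ _); rewrite (H y) // !inE eqxx orbT.
  by apply/hasPn => e er; apply: contraL er; apply: edges_disjoint.
move=> /uniq_br3[[us ut ur] [sr tr st]].
have [us' cs] := IHs _ us; have [ut' ct] := IHt _ ut; have [ur' cr] := IHr _ ur.
have cy : c != y by apply: contraTneq (sr y (mem_head _ _)) => ->; rewrite mem_head.
have cz : c != z by apply: contraTneq (tr z (mem_head _ _)) => ->; rewrite mem_head.
have yz : y != z by apply: contraTneq (st y (mem_head _ _)) => ->; rewrite mem_head.
have c3 : #|[set c; y; z]| = 3.
  by rewrite setUC cardsU1 cards2 !inE cy eq_sym (negPf cz) eq_sym (negPf yz).
rewrite !count_cat cs ct cr c3 eqxx add1n addnA; split => //.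
rewrite !mem_cat !negb_or !cat_uniq us' ut' ur' !andTb !andbT.
have inc u : u \in [:: c; y; z] -> u \in [set c; y; z] by rewrite !inE orbA.
apply/andP; split; last first.
  apply/andP; split; apply/hasPn => e; rewrite ?mem_cat.
    case/orP => [et|er]; [apply: contraL et|apply: contraL er]; exact: edges_disjoint.
  by move=> er; apply: contraL er; apply: edges_disjoint.
apply/and3P; split; apply/negP => /edges_labels H.
- by have := sr c (H c (inc c (mem_head _ _))); rewrite mem_head.
- by have := tr c (H c (inc c (mem_head _ _))); rewrite mem_head.
- by have := sr y (mem_head _ _); rewrite (H y)// inc// !inE eqxx orbT.
Qed.

Lemma num_3edges_triangles (E : {set {set 'I_n}}) c f : uniq (c :: labels f) ->
  E = [set e in edges c f] -> num_3edges E = triangles f.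
Proof.
move=> /uniq_edges[ue <-] ->; rewrite /num_3edges -size_filter -(card_uniqP _); last first.
  exact: filter_uniq.
by rewrite -cardsE; apply: eq_card => e; rewrite !inE mem_filter andbC.
Qed.

End TriangleCount.

(** * Every hypertree is a rooted forest *)

Section HypertreeForest.
Variable n : nat.
Local Notation V := 'I_n.
Implicit Types (f g s t : forest V) (a c u v y z : V).

Fixpoint fcat f g := match f with
  | Leaf => g
  | Br2 y s r => Br2 y s (fcat r g)
  | Br3 y s z t r => Br3 y s z t (fcat r g)
  end.

Fixpoint graft a g f := match f with
  | Leaf => Leaf
  | Br2 y s r => Br2 y (if y == a then fcat g s else graft a g s) (graft a g r)
  | Br3 y s z t r => Br3 y (if y == a then fcat g s else graft a g s)
      z (if z == a then fcat g t else graft a g t) (graft a g r)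
  end.

Definition attach r a g f := if a == r then fcat g f else graft a g f.

Lemma labels_fcat f g : labels (fcat f g) = labels f ++ labels g.
Proof. by elim: f => //= [y s _ r ->|y s _ z t _ r ->]; rewrite -?catA ?cat_cons -?catA. Qed.

Lemma edges_fcat c f g : edges c (fcat f g) = edges c f ++ edges c g.
Proof. by elim: f => //= [y s _ r ->|y s _ z t _ r ->]; rewrite -!catA. Qed.

Lemma triangles_fcat f g : triangles (fcat f g) = triangles f + triangles g.
Proof. by elim: f => //= [y s _ r ->|y s _ z t _ r ->]; lia. Qed.

Lemma graft_id a g f : a \notin labels f -> graft a g f = f.
Proof.
elim: f => //= [y s IHs r IHr|y s IHs z t IHt r IHr];
rewrite !(mem_cat, inE) !negb_or [a == y]eq_sym.
  by move=> /and3P[/negPf -> /IHs -> /IHr ->].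
by rewrite [a == z]eq_sym => /and5P[/negPf -> /IHs -> /negPf -> /IHt -> /IHr ->].
Qed.

(** With multiplicities both permutations become linear arithmetic; uniqueness of the labels ensures
    that [g] is inserted only once. *)
Lemma count_graft a g f : uniq (labels f) -> a \in labels f ->
  (forall p, count p (labels (graft a g f)) = count p (labels g) + count p (labels f)) /\
  (forall c p, count p (edges c (graft a g f)) = count p (edges a g) + count p (edges c f)).
Proof.
elim: f => //= [y s IHs r IHr|y s IHs z t IHt r IHr] uf.
  have [us ur] : uniq (labels s) /\ uniq (labels r).
    by move: uf => /andP[_]; rewrite cat_uniq => /and3P[].
  rewrite inE mem_cat => /or3P[/eqP ay|af|af].
  - rewrite ay eqxx; rewrite -ay graft_id; last first.
      by apply/negP => ar; move: uf; rewrite -ay mem_cat ar orbT.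
    by split => [p|c p]; rewrite ?labels_fcat ?edges_fcat !count_cat /=; clear; lia.
  - have [-> E1 E2] : [/\ (y == a) = false, a \notin labels r & True].
      split => //; first by apply/negP => /eqP ya; move: uf; rewrite ya mem_cat af.
      by apply/negP => ar; move: uf; rewrite cat_uniq => /and4P[_ _ /hasPn/(_ _ ar)]; rewrite /= af.
    have [H1 H2] := IHs us af.
    by rewrite [graft a g r]graft_id//; split => [p|c p]; rewrite !count_cat ?H1 ?H2; clear; lia.
  - have [-> E1] : (y == a) = false /\ a \notin labels s.
      split; first by apply/negP => /eqP ya; move: uf; rewrite ya mem_cat af orbT.
      by apply/negP => ar; move: uf; rewrite cat_uniq => /and4P[_ _ /hasPn/(_ _ af)]; rewrite /= ar.
    have [H1 H2] := IHr ur af.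
    by rewrite (graft_id _ E1); split => [p|c p]; rewrite !count_cat ?H1 ?H2; clear; lia.
have [us ut ur] : [/\ uniq (labels s), uniq (labels t) & uniq (labels r)].
  by move: uf => /andP[_]; rewrite cat_uniq /= cat_uniq => /and5P[-> _ _ -> /andP[_ ->]].
have cnt x : (x == y) + count_mem x (labels s) + (x == z) + count_mem x (labels t)
    + count_mem x (labels r) <= 1.
  have uf1 : uniq (y :: labels s ++ z :: labels t ++ labels r) by [].
  have := count_uniq_mem x uf1; rewrite /= !count_cat /= count_cat.
  by rewrite [y == x]eq_sym [z == x]eq_sym; case: (x \in _) => /=; clear; lia.
have mem x (l : seq V) : (x \in l) = (0 < count_mem x l) by rewrite -has_count has_pred1.
have := cnt a; rewrite inE mem_cat inE mem_cat [y == a]eq_sym [z == a]eq_sym => cnta.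
have nm l : count_mem a l = 0 -> a \notin l by move=> l0; rewrite mem l0.
case/or4P => [ay|af|az|/orP[af|af]].
- rewrite ay in cnta *; have -> : (a == z) = false by apply/negP => az; move: cnta; rewrite az; clear; lia.
  rewrite -(eqP ay) !graft_id ?nm; try (move: cnta; clear; lia).
  by split => [p|c p]; rewrite ?labels_fcat ?edges_fcat !count_cat /= ?count_cat; clear; lia.
- have [H1 H2] := IHs us af; move: af; rewrite mem => af.
  have -> : (a == y) = false by apply/negP => ay; move: cnta af; rewrite ay; clear; lia.
  have -> : (a == z) = false by apply/negP => az; move: cnta af; rewrite az; clear; lia.
  rewrite [graft a g t]graft_id ?nm ?[graft a g r]graft_id ?nm; try (move: cnta af; clear; lia).
  by split => [p|c p]; rewrite !count_cat /= ?count_cat ?H1 ?H2; clear; lia.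
- rewrite az in cnta *; have -> : (a == y) = false by apply/negP => ay; move: cnta; rewrite ay; clear; lia.
  rewrite -(eqP az) !graft_id ?nm; try (move: cnta; clear; lia).
  by split => [p|c p]; rewrite ?labels_fcat ?edges_fcat !count_cat /= ?count_cat ?labels_fcat ?edges_fcat ?count_cat; clear; lia.
- have [H1 H2] := IHt ut af; move: af; rewrite mem => af.
  have -> : (a == y) = false by apply/negP => ay; move: cnta af; rewrite ay; clear; lia.
  have -> : (a == z) = false by apply/negP => az; move: cnta af; rewrite az; clear; lia.
  rewrite [graft a g s]graft_id ?nm ?[graft a g r]graft_id ?nm; try (move: cnta af; clear; lia).
  by split => [p|c p]; rewrite !count_cat /= ?count_cat ?H1 ?H2; clear; lia.
- have [H1 H2] := IHr ur af; move: af; rewrite mem => af.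
  have -> : (a == y) = false by apply/negP => ay; move: cnta af; rewrite ay; clear; lia.
  have -> : (a == z) = false by apply/negP => az; move: cnta af; rewrite az; clear; lia.
  rewrite [graft a g s]graft_id ?nm ?[graft a g t]graft_id ?nm; try (move: cnta af; clear; lia).
  by split => [p|c p]; rewrite !count_cat /= ?count_cat ?H1 ?H2; clear; lia.
Qed.

Lemma attach_perm r a g f : uniq (r :: labels f) -> a \in r :: labels f ->
  perm_eq (labels (attach r a g f)) (labels g ++ labels f) /\
  perm_eq (edges r (attach r a g f)) (edges a g ++ edges r f).
Proof.
rewrite /attach inE; have [-> _ _|ar uf /= af] := eqVneq a r.
  by rewrite labels_fcat edges_fcat.
have [|H1 H2] := count_graft g _ af; first by case/andP: uf.
by split; apply/permP => p; rewrite count_cat ?H1 ?H2.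
Qed.

Section Growth.
Variables (E : {set {set V}}) (r : V).
Hypotheses (hypE : hypertree E) (rankE : rank_le3 E).

Definition subtree f := uniq (r :: labels f) /\ {subset edges r f <= E}.

(** Otherwise [e] would close the tree geodesic between two common vertices to a loose cycle. *)
Lemma subtree_acyclic f e u v : subtree f -> e \in E -> e \notin edges r f ->
  u \in e -> v \in e -> u \in r :: labels f -> v \in r :: labels f -> u = v.
Proof.
move=> [uf fE] eE ef ue ve uL vL; apply/eqP/negPn/negP => uv.
pose P (w : V * V) := [&& w.1 \in e, w.2 \in e, w.1 \in r :: labels f,
  w.2 \in r :: labels f & w.1 != w.2].
have Puv : P (u, v) by rewrite /P/= ue ve uL vL uv.
(* The common vertices are taken at least tree distance; minimality is what keeps the cycle
   loose. *)
case: (arg_minnP (fun w : V * V => fdist f w.1 w.2) Puv) => -[{Puv}u' v'] /=.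
move=> {ue ve uL vL uv u v}; rename u' into u; rename v' into v.
move=> /and5P[/= ue ve uL vL uv] minuv.
pose E0 := [set e in edges r f].
have lip w : lipschitz E0 (fun u => fdist f u w).
  by apply: fdist_lipschitz uf _ => e'; rewrite inE.
have W : walk E0 u v (fdist f u v).
  by apply: (fdist_walk uf) => // e' e'f; rewrite inE.
have [p [h [p0 pv geo]]] := walk_geodesic (lip v) (fdistxx f v) W.
set k := fdist f u v in minuv W pv geo.
have k0 : 0 < k by case: k pv {minuv W geo} => // pv; move: uv; rewrite -p0 -pv eqxx.
have hE i : i < k -> [/\ h i \in edges r f, p i \in h i & p i.+1 \in h i].
  by move=> ik; have [_ /(_ i ik)[]] := geo; rewrite inE.
have [_ [_ ncyc]] := hypE; apply: ncyc.
pose q (i : nat) := if i < k then h i else e.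
exists k.+1, [tuple p i | i < k.+1], [tuple q i | i < k.+1].
have qin (i : nat) : i < k -> q i = h i by rewrite /q => ->.
have qout : q k = e by rewrite /q ltnn.
have qne i : i < k -> h i <> e by move=> ik hie; have [+ _ _] := hE i ik; rewrite hie (negPf ef).
have ordk (i : 'I_k.+1) : (i < k) || (i == k :> nat) by rewrite orbC -leq_eqVlt; exact: (ltn_ord i).
apply/and5P; split => //.
- rewrite map_inj_in_uniq ?enum_uniq// => i j _ _ pij.
  exact/val_inj/(geodesic_inj geo (leq_ord i) (leq_ord j)).
- rewrite map_inj_in_uniq ?enum_uniq// => i j _ _ qij; apply/val_inj => /=.
  move: qij; case/orP: (ordk i) => [ik|/eqP ->]; case/orP: (ordk j) => [jk|/eqP ->] //.
  + by rewrite !qin//; exact: (geodesic_edge_inj (lip v) geo).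
  + by rewrite qout qin// => /qne; case.
  + by rewrite qout qin// => /esym/qne; case.
- apply/allP => x /mapP[i _ ->]; case/orP: (ordk i) => [ik|/eqP ->]; last by rewrite qout.
  by rewrite qin//; apply: fE; have [] := hE i ik.
apply/andP; split.
  apply/forallP => i; rewrite !tnth_mktuple; case/orP: (ordk i) => [ik|/eqP ik].
    rewrite qin//; have [_ -> pi1] := hE i ik; apply/existsP.
    have ik' : i.+1 < k.+1 by [].
    by exists (Ordinal ik'); rewrite tnth_mktuple /= modn_small// eqxx.
  rewrite ik qout pv ve; apply/existsP; exists ord0.
  by rewrite tnth_mktuple /= modnn p0 ue.
apply/forallP => i; apply/forallP => j; apply/implyP => /andP[ij nij].
rewrite !tnth_mktuple qin; last exact: leq_trans (ltnW ij) (ltn_ord j : j <= k).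
case/orP: (ordk j) => [jk|/eqP jk]; first by rewrite qin//; exact: (geodesic_disjoint (lip v) geo).
have ik : i < k := leq_trans (ltnW ij) (ltn_ord j : j <= k).
have i0 : 0 < i by move: nij; rewrite /= jk eqxx andbT lt0n.
rewrite jk qout; apply/pred0P => z /=; apply/negP => /andP[zh ze].
have [hi pi pi1] := hE i ik.
have hi0 : h i \in E0 by rewrite inE.
have [gp _] := geo.
(* As [i > 0], the vertex [z] is nearer to [v] than [u] is, so [(z, v)] would beat the minimal pair,
   unless [z = v]; but [v] is too far from [p i] to lie in [h i]. *)
have dz : fdist f z v <= k - i.
  by have := lip v _ _ _ hi0 zh pi1; rewrite gp// subnSK.
have [zv|zv] := eqVneq z v.
  have := lip v _ _ _ hi0 pi zh; rewrite zv fdistxx gp; last exact: ltnW.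
  by move: ij; rewrite jk; clear; lia.
have := minuv (z, v); rewrite /P /= ze ve vL zv (edges_labels hi zh) => /(_ isT).
by move: dz ik i0; rewrite /=; move: (fdist f z v) => d; clear; lia.
Qed.

Lemma subtree_grow f w : subtree f -> w \notin r :: labels f ->
  exists f', subtree f' /\ size (labels f) < size (labels f').
Proof.
move=> subf; have [uf fE] := subf; move=> wf.
have [hypG [conE _]] := hypE.
have [e [a [b [eE ae be aL bL]]]] : exists e a b,
    [/\ e \in E, a \in e, b \in e, a \in r :: labels f & b \notin r :: labels f].
  have [/existsP[e /existsP[a /existsP[b /and5P[? ? ? ? ?]]]]|H] :=
    boolP [exists e : {set V}, [exists a, [exists b, [&& e \in E, a \in e, b \in e,
      a \in r :: labels f & b \notin r :: labels f]]]].
    by exists e, a, b.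
  have [p pP] := conE r w.
  (* If no edge leaves the subtree, its indicator is constant on edges, so any multiple of it is
     Lipschitz. The factor [p.+1] makes it drop by more than the length [p] of the path. *)
  have : lipschitz E (fun u => p.+1 * (u \in r :: labels f)).
    move=> e u v eE ue ve; have [uL|uL] := boolP (u \in _); last by rewrite muln0.
    have [vL|vL] := boolP (v \in _); first by [].
    case/negP: H; apply/existsP; exists e; apply/existsP; exists u.
    by apply/existsP; exists v; rewrite eE ue ve uL vL.
  move=> /loose_path_lipschitz/(_ pP); rewrite mem_head (negPf wf).
  by rewrite muln0 muln1 add0n ltnn.
have ef : e \notin edges r f.
  by apply/negP => /edges_labels/(_ be); rewrite (negPf bL).
have eL x : x \in e -> x \in r :: labels f -> x = a.
  by move=> xe xL; exact: (subtree_acyclic subf eE ef).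
have ab : a != b by apply: contraNneq bL => <-.
have [g [gE gL]] : exists g, edges a g = [:: e] /\
    [/\ uniq (labels g), 0 < size (labels g) & forall x, x \in labels g -> x \in e :\ a].
  have e3 := rankE eE; have cb := cardsD1 a e; rewrite ae in cb.
  have cb2 := cardsD1 b (e :\ a); rewrite !inE eq_sym ab be /= in cb2.
  have [/eqP c0|c1] := posnP #|e :\ a :\ b|.
    exists (Br2 b Leaf Leaf); split => /=.
      congr [:: _]; apply/setP => x; rewrite !inE; apply/orP/idP => [[]/eqP -> //|xe].
      have [->|xa] := eqVneq x a; [by left|right].
      have := in_set0 x; rewrite -(cards0_eq (eqP c0)) !inE xe xa andbT /=.
      by case: (x == b).
    by split => // x; rewrite inE => /eqP ->; rewrite !inE eq_sym ab be.
  have /card_gt0P[d] := c1; rewrite !inE => /and3P[db da de].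
  exists (Br3 b Leaf d Leaf Leaf); split => /=.
    congr [:: _]; apply/eqP; rewrite eqEcard; apply/andP; split.
      by apply/subsetP => x; rewrite !inE => /orP[/orP[]|] /eqP ->.
    by rewrite setUC cardsU1 cards2 !inE ab (negPf da) (negPf db).
  split => //=; first by rewrite inE eq_sym db.
  by move=> x; rewrite !inE => /orP[]/eqP ->; rewrite ?de ?da ?be ?andbT // eq_sym ab.
have [pl pe] := attach_perm g uf aL.
have [gu g0 gsub] := gL.
exists (attach r a g f); split; last by rewrite (perm_size pl) size_cat -[X in X < _]add0n ltn_add2r.
have gf x : x \in labels g -> x \notin r :: labels f.
  move=> /gsub; rewrite in_setD1 => /andP[xa xe].
  by apply/negP => /(eL _ xe) xa'; rewrite xa' eqxx in xa.
split.
  rewrite /= (perm_mem pl) (perm_uniq pl) mem_cat cat_uniq gu negb_or.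
  move: uf => /= /andP[-> ->]; rewrite !andbT; apply/andP; split.
    by apply/negP => /gf; rewrite mem_head.
  by apply/hasPn => x xf; apply/negP => /gf; rewrite inE xf orbT.
by move=> x; rewrite (perm_mem pe) gE inE => /orP[/eqP ->|/fE].
Qed.

(** A subtree that cannot grow spans all vertices, and an edge outside it would then meet it in two
    vertices. *)
Lemma hypertree_forest : exists f, [/\ uniq (r :: labels f),
  forall v, v \in r :: labels f & E = [set e in edges r f]].
Proof.
have [f [subf allf]] : exists f, subtree f /\ forall v, v \in r :: labels f.
  suff H k f : n <= k + size (labels f) -> subtree f ->
      exists f', subtree f' /\ forall v, v \in r :: labels f'.
    by apply: (H n Leaf); rewrite ?leq_addr//; split.
  elim: k f => [|k IH] f nf subf.
    exists f; split => // v; have [uf _] := subf.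
    have /(uniq_min_size uf) : {subset r :: labels f <= enum V} by move=> x; rewrite mem_enum.
    rewrite -cardE card_ord /= => /(_ (leqW nf))[_ ->].
    by rewrite mem_enum.
  have [/forallP allf|] := boolP [forall v, v \in r :: labels f]; first by exists f.
  move=> /forallPn[w wf]; have [f' [sub' lt]] := subtree_grow subf wf.
  by apply: IH sub'; move: nf lt; rewrite addSnnS; clear; lia.
exists f; have [uf fE] := subf; split => //.
apply/setP => e; rewrite inE; apply/idP/idP => [eE|/fE//].
apply/negPn/negP => ef; have [hypG _] := hypE.
have [u ue] : exists u, u \in e by apply/card_gt0P; exact: leq_trans (hypG _ eE).
have [v] : exists v, v \in e :\ u.
  by apply/card_gt0P; have := hypG _ eE; rewrite (cardsD1 u) ue.
rewrite in_setD1 => /andP[vu ve]; case/eqP: vu.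
exact: (subtree_acyclic subf eE ef).
Qed.

End Growth.
End HypertreeForest.

(** * Chains of edges *)

Section Chains.
Variable n : nat.
Local Notation V := 'I_n.
Implicit Types (c : seq (option V * V)) (o : option V).

(* [(o, v) :: c] is the edge from the current vertex to [v], containing in
   addition the vertex [w] if [o = Some w], continued by [c] at [v]. *)
Fixpoint chain c : forest V := match c with
  | [::] => Leaf
  | (None, v) :: c' => Br2 v (chain c') Leaf
  | (Some w, v) :: c' => Br3 w Leaf v (chain c') Leaf
  end.

Definition block (a : V) o (v : V) : {set V} :=
  if o is Some w then [set a; w; v] else [set a; v].

Lemma labels_chain_cons o v c :
  labels (chain ((o, v) :: c)) = seq_of_opt o ++ v :: labels (chain c).
Proof. by case: o => /= [w|]; rewrite cats0. Qed.

Lemma labels_chain_cat c1 c2 :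
  labels (chain (c1 ++ c2)) = labels (chain c1) ++ labels (chain c2).
Proof.
elim: c1 => // -[o v] c1 IH.
by rewrite cat_cons !labels_chain_cons IH -catA cat_cons.
Qed.

Lemma edges_chain_cons a o v c :
  edges a (chain ((o, v) :: c)) = block a o v :: edges v (chain c).
Proof. by case: o => /= [w|]; rewrite cats0. Qed.

Lemma triangles_chain_cons o v c :
  triangles (chain ((o, v) :: c)) = (isSome o + triangles (chain c))%N.
Proof. by case: o => /= [w|]; rewrite ?addn0. Qed.

Lemma triangles_chain_cat c1 c2 :
  triangles (chain (c1 ++ c2)) = (triangles (chain c1) + triangles (chain c2))%N.
Proof. by elim: c1 => // -[o v] c1 IH; rewrite cat_cons !triangles_chain_cons IH addnA. Qed.

Lemma blockC a o v : block a o v = block v o a.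
Proof.
by rewrite /block; case: o => [w|]; apply/setP => u; rewrite !inE; case: (u == a);
  case: (u == v); rewrite ?orbT ?orbF.
Qed.

(** The root walks to the far end of [c1]: each step reverses the first edge of [c1] and puts it in
    front of [c2], which leaves the edge set unchanged. *)
Lemma chain_reroot r c1 c2 : exists v0 c, [/\
  perm_eq (v0 :: labels (chain c)) (r :: labels (fcat (chain c1) (chain c2))),
  triangles (chain c) = triangles (fcat (chain c1) (chain c2)) &
  edges v0 (chain c) =i edges r (fcat (chain c1) (chain c2))].
Proof.
elim: c1 r c2 => [|[o v] c1 IH] r c2; first by exists r, c2.
have [v0 [c [pc tc ec]]] := IH v ((o, r) :: c2); exists v0, c; split.
- apply: perm_trans pc _; rewrite !labels_fcat !labels_chain_cons.
  by apply/permP => p; rewrite /= !count_cat /=; clear; lia.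
- by rewrite tc !triangles_fcat !triangles_chain_cons; clear; lia.
- move=> e; rewrite ec !edges_fcat !edges_chain_cons !(mem_cat, inE) blockC.
  by rewrite orbCA orbA.
Qed.

End Chains.

(* Positions [0 .. 2 L] along a chain with [L] edges: the even position [2 i]
   is the [i]-th vertex of the path, the odd position [2 i + 1] is the possible
   third vertex of the edge between [2 i] and [2 i + 2]. *)
Definition pdist (s t : nat) : nat :=
  if s == t then 0 else ((s - t) + (t - s) + odd s + odd t)./2.

Lemma pdistC s t : pdist s t = pdist t s.
Proof. by rewrite /pdist eq_sym addnAC [s - t + _]addnC addnAC -!addnA [odd s + _]addnC !addnA addnAC. Qed.

Lemma pdist_edge j s s' t : 2 * j <= s <= (2 * j).+2 -> 2 * j <= s' <= (2 * j).+2 ->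
  pdist s t <= (pdist s' t).+1.
Proof.
move=> hs hs'.
have [s1 s1E] : exists s1, s = 2 * s1 + odd s by exists s./2; clear; lia.
have [s2 s2E] : exists s2, s' = 2 * s2 + odd s' by exists s'./2; clear; lia.
have [t1 t1E] : exists t1, t = 2 * t1 + odd t by exists t./2; clear; lia.
rewrite /pdist; move: s1E s2E t1E hs hs'.
case: (odd s); case: (odd s'); case: (odd t); rewrite ?addn1 ?addn0 => -> -> -> hs hs';
  case: eqP => [_ //|ne1]; case: eqP => ne2; lia.
Qed.

(** * Hypertrees laid out along a path *)

Section Positional.
Variable n : nat.
Local Notation V := 'I_n.
Implicit Types (E F : {set {set V}}) (u v w : V) (o : option V) (c : seq (option V * V)).

Definition slot L (pos : V -> 'I_(2 * L).+1) (j : nat) : {set V} :=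
  [set u | 2 * j <= pos u <= (2 * j).+2].

(** The image of [pos] is the set [P] of the overview together with all even positions; it
    determines the hypergraph up to isomorphism. *)
Definition positional L (pos : V -> 'I_(2 * L).+1) (E : {set {set V}}) : Prop :=
  [/\ injective pos, forall i, i <= L -> exists u, pos u = 2 * i :> nat &
      E = [set slot pos j | j : 'I_L]].

(** Each step goes to the right end of the slot containing [u]; such a vertex exists because all
    even positions are occupied. *)
Lemma positional_walk L (pos : V -> 'I_(2 * L).+1) E u v : positional pos E ->
  pos u <= pos v -> walk E u v (pdist (pos u) (pos v)).
Proof.
move=> [pinj peven ->].
have [k] := ubnP (pos v - pos u); elim: k u => // k IH u; rewrite ltnS => kb le.
have [e|ne] := eqVneq (pos u) (pos v).
  by rewrite (pinj _ _ e) /pdist eqxx; exact: walk0.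
have lt : pos u < pos v by rewrite ltn_neqAle ne.
have vL := ltn_ord (pos v).
have jL : (pos u)./2 < L by move: lt vL; clear; lia.
have slE : slot pos (pos u)./2 \in [set slot pos j | j : 'I_L].
  by apply/imsetP; exists (Ordinal jL).
have us : u \in slot pos (pos u)./2 by rewrite inE; clear; lia.
have [le2|gt2] := leqP (pos v) (2 * (pos u)./2).+2.
  have -> : pdist (pos u) (pos v) = 1.
    by rewrite /pdist (negPf (ne : pos u != pos v :> nat)); move: lt le2; clear; lia.
  apply: (walk_edge slE us); rewrite inE le2 andbT.
  by move: lt; clear; lia.
have [w wE] := peven (pos u)./2.+1 jL.
have ws : w \in slot pos (pos u)./2 by rewrite inE wE; clear; lia.
have wv : pos w < pos v by rewrite wE; move: gt2; clear; lia.
have -> : pdist (pos u) (pos v) = 1 + pdist (pos w) (pos v).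
  rewrite /pdist (negPf (ne : pos u != pos v :> nat)) (ltn_eqF wv) wE.
  by move: lt gt2; clear; lia.
apply: walk_cat (walk_edge slE us ws) _; apply: IH; last exact: ltnW.
by move: kb gt2; rewrite wE; clear; lia.
Qed.

Lemma dist_positional L (pos : V -> 'I_(2 * L).+1) E u v : positional pos E ->
  dist E u v = pdist (pos u) (pos v).
Proof.
move=> posE; apply: (@distE _ _ (fun u v => pdist (pos u) (pos v))) => {u v} [v|v|u v].
- by rewrite /pdist eqxx.
- have [_ _ ->] := posE => _ u w /imsetP[j _ ->]; rewrite !inE => us ws.
  exact: pdist_edge us ws.
- have [|/ltnW] := leqP (pos u) (pos v); first exact: positional_walk.
  by rewrite pdistC => /(positional_walk posE)/walk_sym.
Qed.

Lemma positional_iso L (pos1 pos2 : V -> 'I_(2 * L).+1) E1 E2 :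
  positional pos1 E1 -> positional pos2 E2 ->
  [set pos1 u | u : V] = [set pos2 u | u : V] -> isomorphic E1 E2.
Proof.
move=> [inj1 _ E1E] [inj2 _ E2E] im.
pose f u := odflt u [pick v | pos2 v == pos1 u].
have fP u : pos2 (f u) = pos1 u.
  have /imsetP[v _ uv] : pos1 u \in [set pos2 u | u : V] by rewrite -im imset_f.
  by rewrite /f; case: pickP => [w /eqP//|/(_ v)]; rewrite uv eqxx.
have finj : injective f by move=> u v e; apply: inj1; rewrite -!fP e.
have fslot j : f @: slot pos1 j = slot pos2 j.
  apply/setP => v; rewrite inE; apply/imsetP/idP => [[u]|vj].
    by rewrite inE -fP => uj ->.
  have [g _ gK] := injF_bij finj; exists (g v); rewrite ?gK//.
  by rewrite inE -fP gK.
exists f; split; first exact: injF_bij.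
rewrite E1E E2E; apply/setP => e; apply/imsetP/imsetP => [[j _ ->]|[_ /imsetP[j _ ->] ->]].
  by exists (slot pos1 j); rewrite ?fslot ?imset_f.
by exists j.
Qed.

Lemma isomorphic_positional L (pos : V -> 'I_(2 * L).+1) E F : isomorphic E F ->
  positional pos F -> exists pos', positional pos' E /\
    [set pos' u | u : V] = [set pos u | u : V].
Proof.
move=> [f [bijf FE]] [inj even FP]; have [g fK gK] := bijf.
exists (pos \o f); split; last first.
  apply/setP => s; apply/imsetP/imsetP => -[u _ ->]; first by exists (f u).
  by exists (g u); rewrite //= gK.
have slE j : f @: slot (pos \o f) j = slot pos j.
  apply/setP => v; rewrite inE; apply/imsetP/idP => [[u]|vj]; first by rewrite inE => ? ->.
  by exists (g v); rewrite ?gK// inE /= gK.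
have injim : injective (fun e : {set V} => f @: e) := imset_inj (bij_inj bijf).
split; first exact: inj_comp inj (bij_inj bijf).
  by move=> i /even[u uE]; exists (g u); rewrite /= gK.
apply/setP => e; rewrite -(mem_imset _ _ injim) -FE FP.
apply/imsetP/imsetP => -[j _ ej]; exists j => //; last by rewrite ej slE.
by apply: injim; rewrite slE.
Qed.

Lemma positional_rev L (pos : V -> 'I_(2 * L).+1) E :
  positional pos E -> positional (fun u => rev_ord (pos u)) E.
Proof.
move=> [inj even EE].
have slE j : j < L -> slot (fun u => rev_ord (pos u)) j = slot pos (L - j.+1).
  move=> jL; apply/setP => u; rewrite !inE /=.
  by have := ltn_ord (pos u); move: jL; clear; lia.
split; first by move=> u v /rev_ord_inj/inj.
  move=> i iL; have [|u uE] := even (L - i); first exact: leq_subr.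
  by exists u; rewrite /= uE; move: iL; clear; lia.
rewrite EE; apply/setP => e; apply/imsetP/imsetP => -[j _ ->].
  exists (rev_ord j) => //; rewrite slE; last exact: ltn_ord (rev_ord j).
  congr (slot pos _) => /=.
  by have := ltn_ord j; clear; lia.
by exists (rev_ord j); rewrite // slE.
Qed.

(** The value at a vertex outside the chain is meaningless, but it still is at most [2 * size c], so
    that [inord] never truncates. *)
Fixpoint chain_pos (v0 : V) (c : seq (option V * V)) (u : V) : nat :=
  if u == v0 then 0 else
  if c is (o, v) :: c' then if o == Some u then 1 else (chain_pos v c' u).+2 else 0.

Lemma chain_pos_cons v0 o v c u : uniq (v0 :: labels (chain ((o, v) :: c))) ->
  u \in v :: labels (chain c) -> chain_pos v0 ((o, v) :: c) u = (chain_pos v c u).+2.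
Proof.
rewrite labels_chain_cons => uc uin /=.
move: uc; rewrite cons_uniq mem_cat negb_or => /andP[/andP[_ v0n]].
rewrite cat_uniq => /and3P[_ /hasPn H _].
have -> : (u == v0) = false by apply/negP => /eqP uv; rewrite -uv uin in v0n.
case: eqP => // ou; have := H u uin; rewrite ou /=.
by rewrite inE eqxx.
Qed.

Lemma chain_uniq_cons v0 o v c : uniq (v0 :: labels (chain ((o, v) :: c))) ->
  uniq (v :: labels (chain c)).
Proof. by rewrite labels_chain_cons cons_uniq cat_uniq => /and4P[_ _ _]. Qed.

Lemma in_chain_cons v0 o v c u : u \in v0 :: labels (chain ((o, v) :: c)) ->
  [\/ u = v0, o = Some u | u \in v :: labels (chain c)].
Proof.
rewrite labels_chain_cons in_cons mem_cat => /or3P[/eqP|uo|].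
- exact: Or31.
- by apply: Or32; case: o uo => //= w; rewrite inE => /eqP ->.
- exact: Or33.
Qed.

Lemma chain_pos_root v0 c : chain_pos v0 c v0 = 0.
Proof. by case: c => [|[o v] c] /=; rewrite eqxx. Qed.

Lemma chain_pos_opt v0 v c w : uniq (v0 :: labels (chain ((Some w, v) :: c))) ->
  chain_pos v0 ((Some w, v) :: c) w = 1.
Proof.
by rewrite /= !inE negb_or eq_sym => /andP[/andP[/negPf -> _] _]; rewrite eqxx.
Qed.

Lemma chain_pos_le v0 c u : chain_pos v0 c u <= 2 * size c.
Proof.
elim: c v0 => [|[o v] c IH] v0 /=; first by case: ifP.
by do 2 case: ifP => _ //; [move: (IH v); clear; lia..].
Qed.

Lemma chain_pos_inj v0 c : uniq (v0 :: labels (chain c)) ->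
  {in v0 :: labels (chain c) &, injective (chain_pos v0 c)}.
Proof.
elim: c v0 => [|[o v] c IH] v0 uc u w.
  by rewrite !inE => /eqP -> /eqP ->.
have IHc := IH v (chain_uniq_cons uc).
move=> /in_chain_cons[->|ou|uc'] /in_chain_cons[->|ow|wc'] //;
  rewrite ?chain_pos_root ?(chain_pos_cons uc uc') ?(chain_pos_cons uc wc').
- by move: uc; rewrite ow => uc; rewrite chain_pos_opt.
- by [].
- by move: uc; rewrite ou => uc; rewrite chain_pos_opt.
- by move: ow; rewrite ou => -[].
- by move: uc wc'; rewrite ou => uc wc'; rewrite chain_pos_opt.
- by [].
- by move: uc; rewrite ow => uc; rewrite chain_pos_opt.
- by move=> [] /IHc; apply.
Qed.

Lemma chain_pos_even v0 c i : uniq (v0 :: labels (chain c)) -> i <= size c ->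
  exists2 u, u \in v0 :: labels (chain c) & chain_pos v0 c u = 2 * i.
Proof.
elim: c v0 i => [|[o v] c IH] v0 [|i] uc //= ilt; try by exists v0; rewrite ?mem_head// ?eqxx.
have [u uin uE] := IH v i (chain_uniq_cons uc) ilt.
exists u; first by rewrite labels_chain_cons in_cons mem_cat uin !orbT.
by rewrite -/(chain_pos v0 ((o, v) :: c) u) chain_pos_cons// uE mulnS.
Qed.

Lemma edges_chain v0 c : uniq (v0 :: labels (chain c)) ->
  edges v0 (chain c) = [seq [set u in v0 :: labels (chain c) |
    2 * j <= chain_pos v0 c u <= (2 * j).+2] | j <- iota 0 (size c)].
Proof.
elim: c v0 => [|[o v] c IH] v0 uc //.
have uc' := chain_uniq_cons uc.
rewrite edges_chain_cons IH// -[iota 0 (size (_ :: c))]/(0 :: iota 1 (size c)) map_cons.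
congr (_ :: _).
  apply/setP => u; rewrite in_set; apply/idP/andP => [ub|[uin uE]].
    have : [\/ u = v0, o = Some u | u = v].
      move: ub; rewrite /block; case: (o) => [w|]; rewrite !inE.
        by case/orP => [/orP[/eqP ->|/eqP ->]|/eqP ->]; constructor.
      by case/orP => /eqP ->; constructor.
    case=> [->|ou|->]; first by rewrite mem_head chain_pos_root.
      split; last by move: uc; rewrite ou => uc; rewrite chain_pos_opt.
      by rewrite labels_chain_cons ou /= !inE eqxx orbT.
    by rewrite labels_chain_cons in_cons mem_cat mem_head !orbT (chain_pos_cons uc) ?mem_head// chain_pos_root.
  case/in_chain_cons: uin uE => [->|ou|uin].
  - by move=> _; rewrite /block; case: (o) => [w|]; rewrite !inE eqxx.
  - by move=> _; rewrite ou /block !inE eqxx orbT.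
  - rewrite (chain_pos_cons uc uin) => /= u0.
    have -> : u = v; last by rewrite /block; case: (o) => [w|]; rewrite !inE eqxx orbT.
    apply: (chain_pos_inj uc' uin (mem_head _ _)); rewrite chain_pos_root.
    by move: u0; clear; lia.
rewrite -[iota 1 _]/(iota (1 + 0) _) iotaDl -map_comp; apply: eq_map => j /=; apply/setP => u; rewrite !in_set.
rewrite -/(chain_pos v0 ((o, v) :: c) u) -/(chain ((o, v) :: c)).
have [uin|unin] := boolP (u \in v :: labels (chain c)).
  rewrite (chain_pos_cons uc uin) labels_chain_cons in_cons mem_cat uin !orbT /=.
  by clear; lia.
apply/esym/negP => /andP[/in_chain_cons[->|ou|]]; last by rewrite (negPf unin).
  by rewrite chain_pos_root; clear; lia.
by move: uc; rewrite ou => uc; rewrite chain_pos_opt//; clear; lia.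
Qed.

Lemma chain_positional v0 c : uniq (v0 :: labels (chain c)) ->
  (forall v, v \in v0 :: labels (chain c)) ->
  exists pos : V -> 'I_(2 * size c).+1,
    positional pos [set e in edges v0 (chain c)].
Proof.
move=> uc allc; exists (fun u => inord (chain_pos v0 c u)).
have posE u : (inord (chain_pos v0 c u) : 'I_(2 * size c).+1) = chain_pos v0 c u :> nat.
  by rewrite inordK// ltnS chain_pos_le.
split.
- move=> u v /(congr1 (fun s : 'I_(2 * size c).+1 => val s)) /=.
  by rewrite !posE => /(chain_pos_inj uc); apply.
- by move=> i /(chain_pos_even uc)[u _ uE]; exists u; rewrite posE.
- have slE j : slot (fun u => inord (chain_pos v0 c u) : 'I_(2 * size c).+1) j =
    [set u in v0 :: labels (chain c) | 2 * j <= chain_pos v0 c u <= (2 * j).+2].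
    by apply/setP => u; rewrite [RHS]in_set in_set posE allc.
  apply/setP => e; rewrite inE edges_chain//; apply/mapP/imsetP => [[j]|[j _ ->]].
    by rewrite mem_iota add0n => /andP[_ jc] ->; exists (Ordinal jc); rewrite ?slE.
  by exists (val j); rewrite ?slE// mem_iota add0n ltn_ord.
Qed.

Lemma size_labels_chain c : size (labels (chain c)) = size c + triangles (chain c).
Proof.
elim: c => // -[o v] c IH.
by rewrite labels_chain_cons triangles_chain_cons size_cat /= IH; case: o => [w|] /=; lia.
Qed.

End Positional.

(** * The positions occupied by T(n, a, b) *)

Definition pattern (L a b : nat) : {set 'I_(2 * L).+1} :=
  [set s : 'I_(2 * L).+1 | ~~ odd s || (s./2 < a) || (L - b <= s./2)].

Section TnabPositional.
Variables (n L a b : nat).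
Hypotheses (abL : a + b <= L) (nE : n = L.+1 + (a + b)).

(** This inverts the numbering of [Tedge]: numbers up to [L] are path vertices, the next [a] are the
    third vertices of the first [a] edges, and the remaining ones those of the last [b] edges. *)
Let tpos (x : 'I_n) : nat :=
  if x <= L then 2 * x else
  if x < L.+1 + a then (2 * (x - L.+1)).+1 else (2 * (x - L.+1 - a + (L - b))).+1.

Lemma tpos_lt x : tpos x < (2 * L).+1.
Proof.
rewrite /tpos; have := ltn_ord x; move: nE abL; clear.
by case: (leqP x L) => ?; [|case: (ltnP x (L.+1 + a)) => ?]; lia.
Qed.

Let pos x : 'I_(2 * L).+1 := Ordinal (tpos_lt x).

Lemma Tnab_positional : exists pos : 'I_n -> 'I_(2 * L).+1,
  positional pos (Tnab n a b) /\ [set pos x | x : 'I_n] = pattern L a b.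
Proof.
exists pos; split.
  have lE : n - a - b = L.+1 by rewrite nE; clear; lia.
  split.
  - move=> u v /(congr1 val) /=; rewrite /tpos => e; apply/val_inj => /=.
    have := ltn_ord u; have := ltn_ord v; move: nE abL e; clear.
    by case: (leqP u L) => ?; [|case: (ltnP u (L.+1 + a)) => ?];
      (case: (leqP v L) => ?; [|case: (ltnP v (L.+1 + a)) => ?]); lia.
  - move=> i iL; have iN : i < n by move: nE iL; clear; lia.
    by exists (Ordinal iN); rewrite /= /tpos /= iL.
  - have slE j : j < L -> Tedge n a b j = slot pos j.
      move=> jL; apply/setP => x; rewrite !inE lE /= /tpos.
      have := ltn_ord x; move: nE abL jL; clear.
      by case: (leqP x L) => ?; [|case: (ltnP x (L.+1 + a)) => ?]; lia.
    apply/setP => e; apply/imsetP/imsetP => [[j]|[j _ ->]].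
      rewrite inE lE subn1 /= => jL ->; exists (Ordinal jL) => //; exact: slE.
    have jN : j < n by have := ltn_ord j; move: nE; clear; lia.
    exists (Ordinal jN); last by rewrite (slE _ (ltn_ord j)).
    by rewrite inE lE subn1; exact: ltn_ord j.
apply/setP => s; rewrite inE; apply/imsetP/idP => [[x _ ->] /=|].
  rewrite /tpos; have := ltn_ord x; move: nE abL; clear.
  by case: (leqP x L) => ?; [|case: (ltnP x (L.+1 + a)) => ?]; lia.
have sL := ltn_ord s.
have H u : u < n -> (forall x : 'I_n, val x = u -> tpos x = s) -> exists2 x, x \in 'I_n & s = pos x.
  by move=> un e; exists (Ordinal un) => //; apply/val_inj; rewrite /= e.
have [os /= ab|es _] := boolP (odd s); last first.
  apply: (H s./2) => [|x xE]; first by move: nE sL; clear; lia.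
  by rewrite /tpos xE; move: sL es; clear; case: (leqP s./2 L) => ?; lia.
have [sa|sa] := ltnP s./2 a.
  apply: (H (L.+1 + s./2)) => [|x xE]; first by move: nE sa; clear; lia.
  have -> : tpos x = (2 * (L.+1 + s./2 - L.+1)).+1.
    by rewrite /tpos xE ltn_add2l sa leqNgt ltn_addr.
  by move: os; clear; lia.
have {}ab : L - b <= s./2 by move: ab; rewrite ltnNge sa.
apply: (H (L.+1 + a + (s./2 - (L - b)))) => [|x xE]; first by move: nE ab sL os abL; clear; lia.
have -> : tpos x = (2 * (L.+1 + a + (s./2 - (L - b)) - L.+1 - a + (L - b))).+1.
  by rewrite /tpos xE ltnNge leq_addr /= leqNgt -addnA addSn ltnS leq_addr.
by move: ab os; clear; lia.
Qed.

End TnabPositional.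

Local Open Scope ring_scope.

(** * Quadratic forms and Rayleigh quotients *)

Section BilinearForm.
Variables (R : realType) (I : finType).
Implicit Types (B : I -> I -> R) (y z : I -> R).

Definition bilin B y z : R := \sum_i \sum_j B i j * y i * z j.
Definition sqnorm y : R := \sum_i y i ^+ 2.
Definition delta (i : I) : I -> R := fun j => (j == i)%:R.

Lemma bilinDl B y y' z : bilin B (fun i => y i + y' i) z = bilin B y z + bilin B y' z.
Proof.
rewrite /bilin -big_split; apply: eq_bigr => i _; rewrite -big_split.
by apply: eq_bigr => j _ /=; ring.
Qed.

Lemma bilinDr B y z z' : bilin B y (fun i => z i + z' i) = bilin B y z + bilin B y z'.
Proof.
rewrite /bilin -big_split; apply: eq_bigr => i _; rewrite -big_split.
by apply: eq_bigr => j _ /=; ring.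
Qed.

Lemma bilinZl B a y z : bilin B (fun i => a * y i) z = a * bilin B y z.
Proof.
rewrite /bilin mulr_sumr; apply: eq_bigr => i _; rewrite mulr_sumr.
by apply: eq_bigr => j _ /=; ring.
Qed.

Lemma bilinZr B a y z : bilin B y (fun i => a * z i) = a * bilin B y z.
Proof.
rewrite /bilin mulr_sumr; apply: eq_bigr => i _; rewrite mulr_sumr.
by apply: eq_bigr => j _ /=; ring.
Qed.

Lemma bilinC B y z : (forall i j, B i j = B j i) -> bilin B y z = bilin B z y.
Proof.
move=> symB; rewrite /bilin exchange_big; apply: eq_bigr => i _.
by apply: eq_bigr => j _; rewrite symB; ring.
Qed.

Lemma eq_bilin B y y' z z' : y =1 y' -> z =1 z' -> bilin B y z = bilin B y' z'.
Proof.
by move=> ey ez; apply: eq_bigr => i _; apply: eq_bigr => j _; rewrite ey ez.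
Qed.

Lemma sum_delta i z : \sum_j delta i j * z j = z i.
Proof.
rewrite (bigD1 i)//= /delta eqxx mul1r big1 ?addr0// => j /negPf ->.
by rewrite mul0r.
Qed.

Lemma bilin_deltal B i z : bilin B (delta i) z = \sum_j B i j * z j.
Proof.
rewrite /bilin (bigD1 i)//= [X in _ + X]big1 ?addr0; last first.
  by move=> j /negPf ji; rewrite big1// => k _; rewrite /delta ji mulr0 mul0r.
by apply: eq_bigr => j _; rewrite /delta eqxx mulr1.
Qed.

Lemma bilin_delta B i j : bilin B (delta i) (delta j) = B i j.
Proof.
rewrite bilin_deltal (eq_bigr (fun k => delta j k * B i k)) ?sum_delta//.
by move=> k _; rewrite mulrC.
Qed.

Lemma bilin_sqrD B y z : (forall i j, B i j = B j i) ->
  bilin B (fun i => y i + z i) (fun i => y i + z i) =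
  bilin B y y + 2 * bilin B y z + bilin B z z.
Proof.
by move=> symB; rewrite bilinDl !bilinDr (bilinC z y symB); ring.
Qed.

Lemma sqnorm_ge0 y : 0 <= sqnorm y.
Proof. by apply: sumr_ge0 => i _; rewrite sqr_ge0. Qed.

Lemma sqnorm_eq0 y : sqnorm y = 0 -> forall i, y i = 0.
Proof.
move=> /eqP; rewrite psumr_eq0; last by move=> i _; rewrite sqr_ge0.
by move=> /allP y0 i; have := y0 i (mem_index_enum i); rewrite sqrf_eq0 => /eqP.
Qed.

Lemma sqnormZ a y : sqnorm (fun i => a * y i) = a ^+ 2 * sqnorm y.
Proof. by rewrite /sqnorm mulr_sumr; apply: eq_bigr => i _; rewrite exprMn. Qed.

Lemma bilin_norm B y : (forall i j, 0 <= B i j) ->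
  `|bilin B y y| <= bilin B (fun i => `|y i|) (fun i => `|y i|).
Proof.
move=> B0; apply: le_trans (ler_norm_sum _ _ _) _; apply: ler_sum => i _.
apply: le_trans (ler_norm_sum _ _ _) _; apply: ler_sum => j _.
by rewrite !normrM (ger0_norm (B0 i j)).
Qed.

(** Stationarity at a maximiser: a perturbation by [t] in coordinate [i] changes the form minus
    [lam] times the norm by a quadratic in [t] without constant term, which must stay nonpositive;
    so its linear coefficient vanishes. *)
Lemma rayleigh_eigen B (lam : R) x : (forall i j, B i j = B j i) ->
  (forall y, bilin B y y <= lam * sqnorm y) -> bilin B x x = lam * sqnorm x ->
  forall i, \sum_j B i j * x j = lam * x i.
Proof.
move=> symB maxB eqB i.
set c := \sum_j _; pose e := B i i.
have H t : 2 * t * (c - lam * x i) + t ^+ 2 * (e - lam) <= 0.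
  have := maxB (fun j => x j + t * delta i j).
  rewrite bilin_sqrD// bilinZr bilinZl bilinZr bilin_delta eqB.
  rewrite (bilinC _ _ symB) bilin_deltal -/c.
  have -> : sqnorm (fun j => x j + t * delta i j) =
            sqnorm x + 2 * t * x i + t ^+ 2.
    have -> : sqnorm (fun j => x j + t * delta i j) =
      \sum_j (x j ^+ 2 + 2 * t * (delta i j * x j) + t ^+ 2 * (delta i j * delta i j)).
      by apply: eq_bigr => j _; ring.
    by rewrite !big_split/= -!mulr_sumr !sum_delta /delta eqxx mulr1.
  by rewrite /e; lra.
suff : c - lam * x i = 0 by move/eqP; rewrite subr_eq0 => /eqP.
set d := c - _; set f := e - lam.
have [//|d0] := eqVneq d 0.
(* At [t = d / K] the linear term dominates: multiplied by [K ^+ 2] the inequality reads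
   [d ^+ 2 * (2 * K + f) <= 0], while [2 * K + f > 0]. *)
pose K := `|f| + 1.
have K0 : 0 < K by rewrite /K; have := normr_ge0 f; lra.
have := H (d / K); rewrite -/d -/f => Hd.
have : 2 * d ^+ 2 * K + d ^+ 2 * f <= 0.
  have -> : 2 * d ^+ 2 * K + d ^+ 2 * f =
     (2 * (d / K) * d + (d / K) ^+ 2 * f) * K ^+ 2 by field; rewrite gt_eqF.
  by rewrite mulr_le0_ge0// sqr_ge0.
have d2 : 0 < d ^+ 2 by rewrite exprn_even_gt0.
have fK : - f <= `|f| by rewrite -normrN ler_norm.
have -> : 2 * d ^+ 2 * K + d ^+ 2 * f = d ^+ 2 * (2 * K + f) by ring.
by rewrite pmulr_rle0// => H2; exfalso; move: H2; have := normr_ge0 f; rewrite /K; lra.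
Qed.

End BilinearForm.

Section Rayleigh.
Variable R : realType.
Import mathcomp_extra boolp classical_sets functions topology normedtype derive.
Import numFieldNormedType.Exports.
Local Open Scope classical_set_scope.

Lemma rayleigh_max m (B : 'I_m.+1 -> 'I_m.+1 -> R) :
  exists lam (x : 'I_m.+1 -> R), [/\ sqnorm x = 1, bilin B x x = lam &
    forall y, bilin B y y <= lam * sqnorm y].
Proof.
pose sph : set 'rV[R]_m.+1 := [set v | sqnorm (v ord0) = 1].
pose q (v : 'rV[R]_m.+1) : R := bilin B (v ord0) (v ord0).
have cq : continuous q.
  apply: (@continuous_big _ _ +%R) => [|i _]; first exact: add_continuous.
  apply: (@continuous_big _ _ +%R) => [|j _]; first exact: add_continuous.
  move=> v; apply: (@continuousM R _ (fun w : 'rV[R]_m.+1 => B i j * w ord0 i)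
    (fun w => w ord0 j)); last exact: coord_continuous.
  apply: (@continuousM R _ (fun w : 'rV[R]_m.+1 => B i j) (fun w => w ord0 i)).
    exact: cst_continuous.
  exact: coord_continuous.
have csq : continuous (fun v : 'rV[R]_m.+1 => sqnorm (v ord0)).
  apply: (@continuous_big _ _ +%R) => [|i _]; first exact: add_continuous.
  move=> v; apply: (@continuousM R _ (fun w : 'rV[R]_m.+1 => w ord0 i)
    (fun w => w ord0 i)); exact: coord_continuous.
have sph0 : sph !=set0.
  exists (\row_i (i == ord0)%:R); rewrite /sph/= /sqnorm (bigD1 ord0)//= mxE eqxx.
  by rewrite expr1n big1 ?addr0// => i /negPf i0; rewrite mxE i0 expr0n.
have csph : compact sph.
  apply: bounded_closed_compact.
    exists 1; split => // M M1 v /= sv.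
    rewrite /Num.Def.normr/= mx_normrE; apply/bigmax_leP; split; first by apply/ltW/(lt_trans _ M1).
    move=> [i j] _ /=; rewrite (ord1 i); apply: le_trans (ltW M1).
    have : `|v ord0 j| ^+ 2 <= 1.
      rewrite -sv /sqnorm (bigD1 j)//= real_normK ?num_real// lerDl.
      by apply: sumr_ge0 => k _; rewrite sqr_ge0.
    by rewrite expr_le1.
  have -> : sph = (fun v : 'rV[R]_m.+1 => sqnorm (v ord0)) @^-1` [set 1] by [].
  by apply: closed_comp => // v _; exact: csq.
have [v] := @EVT_max_rV R _ q sph sph0 csph (continuous_subspaceT cq).
rewrite inE => sv maxv.
exists (q v), (v ord0); split => // y.
have [y0|y0] := eqVneq (sqnorm y) 0.
  rewrite y0 mulr0 /bilin big1// => i _; rewrite big1// => j _.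
  by rewrite (sqnorm_eq0 y0 i) mulr0 mul0r.
have ysq : 0 < sqnorm y by rewrite lt_neqAle eq_sym y0 sqnorm_ge0.
pose a := (Num.sqrt (sqnorm y))^-1.
have a2 : a ^+ 2 = (sqnorm y)^-1 by rewrite /a exprVn sqr_sqrtr// ltW.
have := maxv (\row_i (a * y i)); rewrite inE.
have E : (\row_i (a * y i)) ord0 =1 (fun i => a * y i) by move=> i; rewrite mxE.
have Es : sqnorm ((\row_i (a * y i)) ord0) = 1.
  have -> : sqnorm ((\row_i (a * y i)) ord0) = sqnorm (fun i => a * y i).
    by apply: eq_bigr => i _; rewrite E.
  by rewrite sqnormZ a2 mulVf.
move=> /(_ Es); rewrite {1}/q (eq_bilin _ E E) bilinZl bilinZr mulrA -expr2 a2.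
by rewrite ler_pdivrMl// mulrC.
Qed.

End Rayleigh.

(** * Perron vectors and the largest eigenvalue *)

Section Perron.
Variable R : realType.

(** Since [B] is nonnegative, the absolute value of a maximiser is again a maximiser, hence an
    eigenvector; one positive entry then spreads to all of [S] through the eigenvalue equation. The
    set [S] allows matrices that are zero outside a block. *)
Lemma perron m (B : 'I_m -> 'I_m -> R) (S : {set 'I_m}) :
  (forall i j, B i j = B j i) -> (forall i j, 0 <= B i j) ->
  (forall i j, i \in S -> j \in S -> i != j -> 0 < B i j) ->
  (forall i j, i \notin S -> B i j = 0) -> (1 < #|S|)%N ->
  exists lam x, [/\ 0 < lam, forall y, bilin B y y <= lam * sqnorm y,
    forall i, \sum_j B i j * x j = lam * x i,
    forall i, i \in S -> 0 < x i & forall i, i \notin S -> x i = 0].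
Proof.
move=> symB B0 BS BnS; case: m B S symB B0 BS BnS => [|m] B S symB B0 BS BnS S1.
  by have := leq_trans S1 (max_card _); rewrite card_ord.
have [lam [x0 [x01 x0lam maxB]]] := rayleigh_max B.
have [s [t [sS tS st]]] : exists s t, [/\ s \in S, t \in S & s != t].
  have /card_gt0P [s sS] : (0 < #|S|)%N by lia.
  have /card_gt0P [t tS] : (0 < #|S :\ s|)%N by have := cardsD1 s S; rewrite sS; lia.
  by move: tS; rewrite !inE => /andP[ts tS]; exists s, t; rewrite eq_sym.
have lam0 : 0 < lam.
  have := maxB (fun i => delta R s i + delta R t i).
  rewrite bilin_sqrD// !bilin_delta.
  have Hst := BS _ _ sS tS st; have := B0 s s; have := B0 t t.
  have : 0 <= sqnorm (fun i => delta R s i + delta R t i) by exact: sqnorm_ge0.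
  by move=> *; nra.
pose x i := `|x0 i|.
have x1 : sqnorm x = 1 by rewrite -x01; apply: eq_bigr => i _; rewrite real_normK ?num_real.
have xlam : bilin B x x = lam * sqnorm x.
  apply/eqP; rewrite eq_le maxB x1 mulr1 -x0lam.
  exact: le_trans (ler_norm _) (bilin_norm _ B0).
have eigx := rayleigh_eigen symB maxB xlam.
have x_ge0 i : 0 <= x i by rewrite normr_ge0.
have xnS i : i \notin S -> x i = 0.
  move=> iS; have := eigx i; rewrite big1; last by move=> j _; rewrite BnS// mul0r.
  by move/esym/eqP; rewrite mulf_eq0 gt_eqF//= => /eqP.
have [j xj0] : exists j, 0 < x j.
  have [/existsP//|/existsPn H] := boolP [exists j, 0 < x j].
  move: x1; rewrite /sqnorm big1 => [/eqP|i _]; first by rewrite eq_sym oner_eq0.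
  by have := H i; rewrite -leNgt => xi; apply/eqP; rewrite sqrf_eq0 eq_le xi x_ge0.
have jS : j \in S by apply/negPn/negP => /xnS; apply/eqP; rewrite gt_eqF.
have xpos i : i \in S -> i != j -> 0 < x i.
  move=> iS ij; rewrite -(pmulr_rgt0 _ lam0) -eigx (bigD1 j)//=.
  rewrite ltr_wpDr// ?mulr_gt0 ?BS//.
  by apply: sumr_ge0 => k _; rewrite mulr_ge0.
exists lam, x; split => // i iS.
by have [->|ij] := eqVneq i j; [exact: xj0 | exact: xpos].
Qed.

Lemma largest_eigenvalueP m (A : 'M[R]_m) (lam : R) (x : 'I_m -> R) :
  (forall i j, A i j = A j i) ->
  (forall y, bilin A y y <= lam * sqnorm y) ->
  (forall i, \sum_j A i j * x j = lam * x i) -> (exists i, x i != 0) ->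
  largest_eigenvalue A lam.
Proof.
move=> symA maxA eigx [i xi0]; split.
  apply/eigenvalueP; exists (\row_j x j).
    apply/rowP => j; rewrite !mxE -eigx; apply: eq_bigr => k _.
    by rewrite mxE symA mulrC.
  by apply/eqP => /rowP/(_ i); rewrite !mxE => /eqP; rewrite (negPf xi0).
move=> s /eigenvalueP[v vA v0].
have v2 : 0 < sqnorm (v ord0).
  rewrite lt_neqAle sqnorm_ge0 andbT eq_sym; apply: contra v0 => /eqP/sqnorm_eq0 v0.
  by apply/eqP/rowP => j; rewrite v0 mxE.
rewrite -(ler_pM2r v2); apply: le_trans (maxA _).
rewrite /bilin /sqnorm mulr_sumr exchange_big; apply: ler_sum => j _.
have /rowP/(_ j) := vA; rewrite !mxE => E.
rewrite expr2 mulrA -E mulr_suml; apply: ler_sum => k _.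
by rewrite [v _ _ * A k j]mulrC.
Qed.

Lemma largest_eigenvalue_inj m (A : 'M[R]_m) (r s : R) :
  largest_eigenvalue A r -> largest_eigenvalue A s -> r = s.
Proof. by move=> [Ar rmax] [As smax]; apply/eqP; rewrite eq_le smax ?rmax. Qed.

End Perron.

(** * The distance form as a sum over edges *)

Section ForestWeights.
Variables (R : realType) (n : nat) (x : 'I_n -> R).
Local Notation V := 'I_n.
Implicit Types (f s t : forest V) (c u v y z : V) (S : R).

Fixpoint weight f : R := match f with
  | Leaf => 0
  | Br2 y s r => x y + weight s + weight r
  | Br3 y s z t r => x y + weight s + (x z + weight t) + weight r
  end.

(* The number of pairs separated by an edge whose parts below the parent
   weigh [p] and [q] (with [q = 0] for an edge of size two). *)
Definition cut S p q : R := p * q + (p + q) * (S - p - q).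

Fixpoint energy S f : R := match f with
  | Leaf => 0
  | Br2 y s r => cut S (x y + weight s) 0 + energy S s + energy S r
  | Br3 y s z t r => cut S (x y + weight s) (x z + weight t)
      + energy S s + energy S t + energy S r
  end.

Lemma weight_labels f : weight f = \sum_(v <- labels f) x v.
Proof.
elim: f => /= [|y s -> r ->|y s -> z t -> r ->]; first by rewrite big_nil.
  by rewrite big_cons big_cat /= addrA.
by rewrite big_cons big_cat big_cons big_cat /= !addrA.
Qed.

Lemma weight_fcat f g : weight (fcat f g) = weight f + weight g.
Proof. by elim: f => //= [|y s _ r ->|y s _ z t _ r ->]; rewrite ?add0r ?addrA. Qed.

Lemma energy_fcat S f g : energy S (fcat f g) = energy S f + energy S g.
Proof. by elim: f => //= [|y s _ r ->|y s _ z t _ r ->]; rewrite ?add0r ?addrA. Qed.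

Lemma sum_mem (P : seq V) : uniq P -> \sum_v (v \in P)%:R * x v = \sum_(v <- P) x v.
Proof.
move=> uP; rewrite [RHS]big_uniq// [RHS]big_mkcond; apply: eq_bigr => v _.
by case: (v \in P); rewrite ?mul1r ?mul0r.
Qed.

(** The indicator is one minus that of lying in the same part, so the double sum is the square of
    the total minus the squares of the three parts. The factor 2 counts each pair in both orders. *)
Lemma sum_separates (P Q : seq V) : uniq P -> uniq Q ->
  (forall v, v \in P -> v \notin Q) ->
  \sum_u \sum_v (separates P Q u v)%:R * x u * x v =
  2 * cut (\sum_v x v) (\sum_(v <- P) x v) (\sum_(v <- Q) x v).
Proof.
move=> uP uQ PQ; rewrite -(sum_mem uP) -(sum_mem uQ).
set S := \sum_v x v.
pose a u : R := (u \in P)%:R; pose b u : R := (u \in Q)%:R.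
have sepE u v : (separates P Q u v)%:R =
    1 - (a u * a v + b u * b v + (1 - a u - b u) * (1 - a v - b v)) :> R.
  rewrite /separates /a /b; have := PQ u; have := PQ v.
  case: (u \in P); case: (u \in Q); case: (v \in P); case: (v \in Q) => //=;
  by [move=> /(_ isT)|move=> _ /(_ isT)|move=> _ _; lra].
have sumM (f g : V -> R) : \sum_u \sum_v (f u * g v) = (\sum_u f u) * (\sum_v g v).
  by rewrite mulr_suml; apply: eq_bigr => u _; rewrite mulr_sumr.
rewrite (eq_bigr (fun u => \sum_v (x u * x v - (a u * x u) * (a v * x v)
   - (b u * x u) * (b v * x v) -
   (x u - a u * x u - b u * x u) * (x v - a v * x v - b v * x v)))); last first.
  by move=> u _; apply: eq_bigr => v _; rewrite sepE; ring.
rewrite (eq_bigr _ (fun u _ => sumrB _ _ _ _)) sumrB.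
rewrite (eq_bigr _ (fun u _ => sumrB _ _ _ _)) sumrB.
rewrite (eq_bigr _ (fun u _ => sumrB _ _ _ _)) sumrB.
rewrite !sumM !sumrB -/S /cut; ring.
Qed.

Lemma bilin_natD (F G : V -> V -> nat) :
  bilin (fun u v => (F u v + G u v)%:R) x x =
  bilin (fun u v => (F u v)%:R) x x + bilin (fun u v => (G u v)%:R) x x :> R.
Proof.
rewrite /bilin -big_split; apply: eq_bigr => u _; rewrite -big_split.
by apply: eq_bigr => v _ /=; rewrite natrD !mulrDl.
Qed.

Lemma uniq_labels2 y s r : uniq (labels (Br2 y s r)) ->
  [/\ uniq (y :: labels s), uniq (labels s) & uniq (labels r)].
Proof.
rewrite -[labels _]/((y :: labels s) ++ labels r) cat_uniq => /and3P[us _ ->].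
by split => //; case/andP: us.
Qed.

Lemma uniq_labels3 y s z t r : uniq (labels (Br3 y s z t r)) ->
  [/\ uniq (y :: labels s), uniq (z :: labels t) &
      forall v, v \in y :: labels s -> v \notin z :: labels t] /\
  [/\ uniq (labels s), uniq (labels t) & uniq (labels r)].
Proof.
rewrite -[labels _]/((y :: labels s) ++ (z :: labels t) ++ labels r).
rewrite cat_uniq => /and3P[us /hasPn H].
rewrite cat_uniq => /and3P[ut _ ur]; split; last first.
  by split => //; [case/andP: us | case/andP: ut].
split => // v vs; apply/negP => vt.
by have := H v; rewrite mem_cat vt => /(_ isT) /=; rewrite vs.
Qed.

Lemma bilin_fdist f : uniq (labels f) ->
  bilin (fun u v => (fdist f u v)%:R) x x = 2 * energy (\sum_v x v) f.
Proof.
elim: f => [_|y s IHs r IHr|y s IHs z t IHt r IHr].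
- by rewrite mulr0; apply: big1 => u _; apply: big1 => v _; rewrite !mul0r.
- move=> /uniq_labels2[uy us ur].
  rewrite -[fdist _]/(fun u v => (separates (y :: labels s) [::] u v + fdist s u v
    + fdist r u v)%N) bilin_natD bilin_natD IHs// IHr//.
  rewrite [bilin _ _ _]sum_separates// big_cons big_nil -weight_labels /=.
  by ring.
move=> /uniq_labels3[[uy uz yz] [us ut ur]].
rewrite -[fdist _]/(fun u v => (separates (y :: labels s) (z :: labels t) u v
  + fdist s u v + fdist t u v + fdist r u v)%N).
rewrite !bilin_natD IHs// IHt// IHr//.
by rewrite [bilin _ _ _]sum_separates// !big_cons -!weight_labels /=; ring.
Qed.

(** Only the edges at the root are constrained, so [s] and [t] are not entered. *)
Fixpoint balanced S f : Prop := match f with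
  | Leaf => True
  | Br2 y s r => 2 * (x y + weight s) <= S /\ balanced S r
  | Br3 y s z t r => [/\ 2 * (x y + weight s) + (x z + weight t) <= S,
      2 * (x z + weight t) + (x y + weight s) <= S & balanced S r]
  end.

(** Moving the root from [c] to [y] brings the part of [y] nearer by one, leaves the part of [z] at
    the same distance and takes the rest farther by one. The weighted sum changes by [S - 2 * Y - Z]
    for the weights [Y] and [Z] of the two parts, and minimality makes this nonnegative. *)
Lemma median_balanced c f : uniq (c :: labels f) ->
  (forall y, y \in labels f ->
     \sum_v (fdist f c v)%:R * x v <= \sum_v (fdist f y v)%:R * x v) ->
  balanced (\sum_v x v) f.
Proof.
elim: f => //= [y s _ r IHr|y s _ z t _ r IHr].
  move=> uf med; have [uy ur sr] := uniq_br2 uf.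
  have cs : c \notin labels s.
    by apply/negP => cs; have := sr c; rewrite !inE cs eqxx orbT => /(_ isT).
  have cy : c \notin y :: labels s.
    by rewrite inE negb_or cs andbT; apply/negP => /eqP cy; have := sr c; rewrite !inE cy !eqxx => /(_ isT).
  have ys : y \notin labels s by case/andP: uy.
  have yr : y \notin labels r := notin_cons (sr _ (mem_head _ _)).
  have cr : c \notin labels r by case/andP: ur.
  split.
    have := med y (mem_head _ _); rewrite -subr_ge0 -sumrB.
    rewrite (eq_bigr (fun v => x v - 2 * ((v \in y :: labels s)%:R * x v))).
      by rewrite sumrB -mulr_sumr (sum_mem uy) big_cons -weight_labels; lra.
    move=> v _; rewrite (fdist_out v ys cs) (fdist_out v yr cr) /separates /=.
    rewrite !orbF mem_head (negPf cy).
    by case: (v \in _) => /=; rewrite !natrD; ring.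
  apply: IHr => // w wr; rewrite -subr_ge0 -sumrB.
  have wys : w \notin y :: labels s.
    by apply/negP => /sr; rewrite inE wr orbT.
  have := med w; rewrite inE mem_cat wr !orbT => /(_ isT).
  rewrite -subr_ge0 -sumrB; congr (0 <= _); apply: eq_bigr => v _.
  rewrite (fdist_out v (notin_cons wys) cs) /separates (negPf cy) (negPf wys).
  by rewrite !natrD; ring.
move=> uf med; have [[uy uz ur] [sr tr st]] := uniq_br3 uf.
have cy : c \notin y :: labels s by apply/negP => /sr; rewrite mem_head.
have cz : c \notin z :: labels t by apply/negP => /tr; rewrite mem_head.
have cs := notin_cons cy; have ct := notin_cons cz.
have ys : y \notin labels s by case/andP: uy.
have zt : z \notin labels t by case/andP: uz.
have yz : y \notin z :: labels t := st _ (mem_head _ _).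
have zy : z \notin y :: labels s by apply/negP => /st; rewrite mem_head.
have yr : y \notin labels r := notin_cons (sr _ (mem_head _ _)).
have zr : z \notin labels r := notin_cons (tr _ (mem_head _ _)).
have cr : c \notin labels r by case/andP: ur.
have disj v : v \in y :: labels s -> (v \in z :: labels t) = false by move=> /st /negPf.
have wP : weight s + x y = \sum_(v <- y :: labels s) x v by rewrite big_cons -weight_labels addrC.
have wQ : weight t + x z = \sum_(v <- z :: labels t) x v by rewrite big_cons -weight_labels addrC.
split.
- have := med y (mem_head _ _); rewrite -subr_ge0 -sumrB.
  rewrite (eq_bigr (fun v => x v - 2 * ((v \in y :: labels s)%:R * x v)
     - (v \in z :: labels t)%:R * x v)).
    by rewrite !sumrB -mulr_sumr (sum_mem uy) (sum_mem uz) -wP -wQ; lra.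
  move=> v _; rewrite (fdist_out v ys cs) (fdist_out v yr cr).
  rewrite (fdist_out v (notin_cons yz) ct) /separates mem_head (negPf cy) (negPf cz) (negPf yz).
  have := disj v; case: (v \in _ :: labels s) => [->//|_] /=; first by rewrite !natrD; ring.
  by case: (v \in _) => /=; rewrite !natrD; ring.
- have := med z; rewrite inE mem_cat mem_head !orbT => /(_ isT).
  rewrite -subr_ge0 -sumrB.
  rewrite (eq_bigr (fun v => x v - 2 * ((v \in z :: labels t)%:R * x v)
     - (v \in y :: labels s)%:R * x v)).
    by rewrite !sumrB -mulr_sumr (sum_mem uy) (sum_mem uz) -wP -wQ; lra.
  move=> v _; rewrite (fdist_out v zt ct) (fdist_out v zr cr).
  rewrite (fdist_out v (notin_cons zy) cs) /separates mem_head (negPf cy) (negPf cz) (negPf zy).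
  have := disj v; case: (v \in _ :: labels s) => [->//|_] /=; first by rewrite !natrD; ring.
  by case: (v \in _) => /=; rewrite !natrD; ring.
apply: IHr => // w wr; rewrite -subr_ge0 -sumrB.
have wys : w \notin y :: labels s by apply/negP => /sr; rewrite inE wr orbT.
have wzt : w \notin z :: labels t by apply/negP => /tr; rewrite inE wr orbT.
have := med w; rewrite inE !mem_cat inE mem_cat wr !orbT => /(_ isT).
rewrite -subr_ge0 -sumrB; congr (0 <= _); apply: eq_bigr => v _.
rewrite (fdist_out v (notin_cons wys) cs) (fdist_out v (notin_cons wzt) ct).
rewrite /separates (negPf cy) (negPf wys) (negPf cz) (negPf wzt).
by rewrite !natrD; ring.
Qed.

End ForestWeights.

(** * Straightening the branches *)

Section Straighten.
Variables (R : realType) (n : nat) (x : 'I_n -> R) (S : R).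
Hypothesis x_gt0 : forall v, 0 < x v.
Local Notation V := 'I_n.
Local Notation weight := (weight x).
Local Notation energy := (energy x S).
Local Notation cut := (cut S).
Implicit Types (f g s t : forest V) (c : seq (option V * V)) (o : option V).

Lemma weight_ge0 f : 0 <= weight f.
Proof.
have := x_gt0; elim: f => //= [y s IHs r IHr|y s IHs z t IHt r IHr] x0.
  by rewrite !addr_ge0 ?IHs ?IHr// ltW.
by rewrite !addr_ge0 ?IHs ?IHr ?IHt// ltW.
Qed.

Definition oweight o : R := if o is Some w then x w else 0.

Lemma oweight_ge0 o : 0 <= oweight o.
Proof. by case: o => //= w; rewrite ltW. Qed.

Lemma weight_chain_cons o v c :
  weight (chain ((o, v) :: c)) = oweight o + x v + weight (chain c).
Proof. by case: o => [w|] /=; ring. Qed.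

Lemma energy_chain_cons o v c :
  energy (chain ((o, v) :: c)) =
  cut (oweight o) (x v + weight (chain c)) + energy (chain c).
Proof. by case: o => [w|] /=; rewrite /cut; ring. Qed.

Lemma weight_chain_cat c1 c2 :
  weight (chain (c1 ++ c2)) = weight (chain c1) + weight (chain c2).
Proof.
elim: c1 => [|[o v] c1 IH]; first by rewrite add0r.
by rewrite cat_cons !weight_chain_cons IH !addrA.
Qed.

(** Hanging [c2] at the end of [c1] adds its weight [W2] to the far side of every edge [(o, v)] of
    [c1]. With [b] the former weight of that side, the edge gains
    [W2 * (S - oweight o - 2 * b - W2)]. *)
Lemma energy_chain_cat c1 c2 : 2 * weight (chain c1) + weight (chain c2) <= S ->
  energy (chain c1) + energy (chain c2) <= energy (chain (c1 ++ c2)).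
Proof.
elim: c1 => [|[o v] c1 IH]; first by rewrite add0r.
rewrite cat_cons !energy_chain_cons weight_chain_cons weight_chain_cat /cut => le.
have := x_gt0 v; have := oweight_ge0 o; have W1 := weight_ge0 (chain c1).
have W2 := weight_ge0 (chain c2) => o0 v0.
have : 2 * weight (chain c1) + weight (chain c2) <= S by lra.
move=> /IH; set e1 := energy _; set e2 := energy _; set e3 := energy _ => IHe.
have : 0 <= weight (chain c2) *
  (S - oweight o - 2 * (x v + weight (chain c1)) - weight (chain c2)).
  by apply: mulr_ge0 => //; lra.
by move: IHe; clear; nra.
Qed.

Lemma energy_chain_cat_lt c1 c2 : c1 != [::] -> c2 != [::] ->
  2 * weight (chain c1) + weight (chain c2) < S ->
  energy (chain c1) + energy (chain c2) < energy (chain (c1 ++ c2)).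
Proof.
case: c1 => [//|[o v] c1] _; case: c2 => [//|[o' v'] c2'] _.
set c2 := _ :: c2'.
have W2 : 0 < weight (chain c2).
  rewrite weight_chain_cons; have := x_gt0 v'; have := oweight_ge0 o'.
  by have := weight_ge0 (chain c2'); lra.
clearbody c2.
rewrite cat_cons !energy_chain_cons weight_chain_cons weight_chain_cat /cut => le.
have := x_gt0 v; have := oweight_ge0 o; have W1 := weight_ge0 (chain c1) => o0 v0.
have : 2 * weight (chain c1) + weight (chain c2) <= S by lra.
move=> /energy_chain_cat; set e1 := energy _; set e2 := energy _; set e3 := energy _ => IHe.
have : 0 < weight (chain c2) *
  (S - oweight o - 2 * (x v + weight (chain c1)) - weight (chain c2)).
  by apply: mulr_gt0 => //; lra.
by move: IHe; clear; nra.
Qed.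

(** The equality case rests on the second alternative: without a strict gain the edge set itself is
    unchanged, whatever the root. *)
Definition improves f g : Prop := [/\ perm_eq (labels g) (labels f),
  triangles g = triangles f &
  energy f < energy g \/ energy f = energy g /\ forall a, edges a g =i edges a f].

Lemma improves_refl f : improves f f.
Proof. by split => //; right. Qed.

Lemma improves_trans g f h : improves f g -> improves g h -> improves f h.
Proof.
move=> [p1 t1 e1] [p2 t2 e2]; split; [exact: perm_trans p2 p1|by rewrite t2|].
case: e1 => [e1|[e1 d1]]; first by left; case: e2 => [/(lt_trans e1)|[<- _]].
rewrite e1; case: e2 => [e2|[e2 d2]]; [by left|right; split=> // a e].
by rewrite d2 d1.
Qed.

Lemma improves_weight f g : improves f g -> weight g = weight f.
Proof. by move=> [pl _ _]; rewrite !weight_labels (perm_big _ pl). Qed.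

Lemma improves_le f g : improves f g -> energy f <= energy g.
Proof. by move=> [_ _ [/ltW//|[-> _]]]. Qed.

Lemma improves_br2 y s s' : improves s s' ->
  improves (Br2 y s Leaf) (Br2 y s' Leaf).
Proof.
move=> imp; have W := improves_weight imp; have [p t e] := imp; split => /=.
- by rewrite !cats0 perm_cons.
- by rewrite t.
- rewrite W; case: e => [e|[-> e]]; [by left; lra|right; split => // a X].
  by rewrite !(mem_cat, inE) e.
Qed.

Lemma improves_br3 y s z t s' t' : improves s s' -> improves t t' ->
  improves (Br3 y s z t Leaf) (Br3 y s' z t' Leaf).
Proof.
move=> imp imp'; have W := improves_weight imp; have W' := improves_weight imp'.
have le := improves_le imp; have le' := improves_le imp'.
have [p q e] := imp; have [p' q' e'] := imp'; split => /=.
- by rewrite perm_cons !cats0 perm_cat// perm_cons.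
- by rewrite q q'.
- rewrite W W'; case: e => [e|[-> e]]; first by left; lra.
  case: e' => [e'|[-> e']]; [by left; lra|right; split => // a X].
  by rewrite !(mem_cat, inE) e e'.
Qed.

Lemma improves_fcat f g f' g' : improves f f' -> improves g g' ->
  improves (fcat f g) (fcat f' g').
Proof.
move=> imp imp'; have le := improves_le imp; have le' := improves_le imp'.
have [p q e] := imp; have [p' q' e'] := imp'; split.
- by rewrite !labels_fcat perm_cat.
- by rewrite !triangles_fcat q q'.
- rewrite !energy_fcat; case: e => [e|[-> e]]; first by left; lra.
  case: e' => [e'|[-> e']]; [by left; lra|right; split => // a X].
  by rewrite !edges_fcat !mem_cat e e'.
Qed.

Lemma improves_fcatC f g : improves (fcat f g) (fcat g f).
Proof.
split; first by rewrite !labels_fcat perm_catC.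
  by rewrite !triangles_fcat addnC.
right; split; first by rewrite !energy_fcat addrC.
by move=> a e; rewrite !edges_fcat !mem_cat orbC.
Qed.

Lemma improves_fcatA f g h : improves (fcat f (fcat g h)) (fcat (fcat f g) h).
Proof.
split; first by rewrite !labels_fcat catA.
  by rewrite !triangles_fcat addnA.
right; split; first by rewrite !energy_fcat addrA.
by move=> a e; rewrite !edges_fcat catA.
Qed.

Lemma fcat_leaf f : fcat f Leaf = f.
Proof. by elim: f => //= [y s _ r ->|y s _ z t _ r ->]. Qed.

Lemma improves_chain_cat c1 c2 : 2 * weight (chain c1) + weight (chain c2) < S ->
  improves (fcat (chain c1) (chain c2)) (chain (c1 ++ c2)).
Proof.
have [->|c10] := eqVneq c1 [::]; first by move=> _; exact: improves_refl.
have [->|c20] := eqVneq c2 [::].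
  by move=> _; rewrite cats0 fcat_leaf; exact: improves_refl.
move=> lt; split; first by rewrite labels_fcat labels_chain_cat.
  by rewrite triangles_fcat triangles_chain_cat.
by left; rewrite energy_fcat; exact: energy_chain_cat_lt.
Qed.

Lemma improves_br3C y s z t : improves (Br3 y s z t Leaf) (Br3 z t y s Leaf).
Proof.
split => /=.
- by apply/permP => p; rewrite /= !cats0 !count_cat /=; clear; lia.
- by rewrite !addn0 addnC.
right; split; first by rewrite /cut; ring.
by move=> a e; rewrite /= !cats0 !inE !mem_cat setUAC (orbC (e \in edges z t)).
Qed.

(* If [Y] and [Z] are the two parts below the edge, [o] the possible third
   vertex and [Y'] the part beyond the first edge of the lighter chain,
   exchanging the branches [Y'] and [Z] gains [(S - Y - Z - o) * (Z - Y')]. *)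
Lemma improves_zip y c1 z c2 :
  x y + weight (chain c1) <= x z + weight (chain c2) ->
  2 * (x y + weight (chain c1)) + (x z + weight (chain c2)) <= S ->
  exists c, improves (Br3 y (chain c1) z (chain c2) Leaf) (chain c).
Proof.
elim: c1 y z c2 => [|[o y'] c1 IH] y z c2.
  by move=> _ _; exists ((Some y, z) :: c2); exact: improves_refl.
rewrite weight_chain_cons => le1 le2.
have := x_gt0 y; have := x_gt0 z; have := x_gt0 y'; have := oweight_ge0 o.
have := weight_ge0 (chain c1); have := weight_ge0 (chain c2) => W2 W1 o0 y'0 z0 y0.
have [||c imp] := IH y' y ((o, z) :: c2).
- by rewrite weight_chain_cons; lra.
- by rewrite weight_chain_cons; lra.
exists c; apply: improves_trans imp; split.
- by apply/permP => p; case: (o) => [w|]; do !rewrite /= ?cats0 ?count_cat; clear; lia.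
- by rewrite [LHS]/= [RHS]/= !triangles_chain_cons; clear; lia.
left; rewrite [ltLHS]/= [ltRHS]/= !energy_chain_cons !weight_chain_cons /cut.
have : 0 < (S - oweight o - (x y + (oweight o + x y' + weight (chain c1)))
    - (x z + weight (chain c2))) * (x z + weight (chain c2) - (x y' + weight (chain c1))).
  by apply: mulr_gt0; lra.
by clear; nra.
Qed.

Lemma improves_br3_chain y c1 z c2 :
  2 * (x y + weight (chain c1)) + (x z + weight (chain c2)) <= S ->
  2 * (x z + weight (chain c2)) + (x y + weight (chain c1)) <= S ->
  exists c, improves (Br3 y (chain c1) z (chain c2) Leaf) (chain c).
Proof.
move=> le1 le2; have [le|/ltW le] := leP (x y + weight (chain c1)) (x z + weight (chain c2)).
  exact: improves_zip.
have [c imp] := improves_zip le le2; exists c; apply: improves_trans imp.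
exact: improves_br3C.
Qed.

(** The bound passes to all subforests, and it implies the inequalities needed both for merging the
    two parts of a triangle and for concatenating chains. *)
Lemma straighten f : 2 * weight f < S -> exists c, improves f (chain c).
Proof.
elim: f => [_|y s IHs r IHr|y s IHs z t IHt r IHr]; first by exists [::]; exact: improves_refl.
  rewrite [weight _]/= => lt; have y0 := x_gt0 y.
  have s0 := weight_ge0 s; have r0 := weight_ge0 r.
  have [|cs imps] := IHs; first lra.
  have [|cr impr] := IHr; first lra.
  exists (((None, y) :: cs) ++ cr).
  rewrite -[Br2 _ _ _]/(fcat (Br2 y s Leaf) r).
  apply: improves_trans (improves_fcat (improves_br2 y imps) impr) _.
  apply: (@improves_chain_cat ((None, y) :: cs)).
  by rewrite weight_chain_cons (improves_weight imps) (improves_weight impr) /=; lra.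
rewrite [weight _]/= => lt; have y0 := x_gt0 y; have z0 := x_gt0 z.
have s0 := weight_ge0 s; have t0 := weight_ge0 t; have r0 := weight_ge0 r.
have [|cs imps] := IHs; first lra.
have [|ct impt] := IHt; first lra.
have [|cr impr] := IHr; first lra.
have [||c impc] := @improves_br3_chain y cs z ct.
- by rewrite (improves_weight imps) (improves_weight impt); lra.
- by rewrite (improves_weight imps) (improves_weight impt); lra.
have imp := improves_trans (improves_br3 y z imps impt) impc.
exists (c ++ cr); rewrite -[Br3 _ _ _ _ _]/(fcat (Br3 y s z t Leaf) r).
apply: improves_trans (improves_fcat imp impr) _.
apply: improves_chain_cat.
by rewrite (improves_weight imp) (improves_weight impr) /=; lra.
Qed.

(** The lighter of [c0] and [c1] receives [c2] at its end: twice its weight plus that of [c2] is at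
    most the sum of all three, hence less than [S]. *)
Lemma merge_chains c0 c1 c2 :
  weight (chain c0) + weight (chain c1) + weight (chain c2) < S ->
  exists d1 d2, improves (fcat (chain c0) (fcat (chain c1) (chain c2)))
    (fcat (chain d1) (chain d2)).
Proof.
move=> lt; have W0 := weight_ge0 (chain c0); have W1 := weight_ge0 (chain c1).
have W2 := weight_ge0 (chain c2).
have [le01|lt01] := leP (weight (chain c1)) (weight (chain c0)).
  exists c0, (c1 ++ c2); apply: improves_fcat; first exact: improves_refl.
  by apply: improves_chain_cat; lra.
exists (c0 ++ c2), c1; apply: (@improves_trans (fcat (chain c0) (fcat (chain c2) (chain c1)))).
  by apply: improves_fcat; [exact: improves_refl | exact: improves_fcatC].
apply: improves_trans (improves_fcatA _ _ _) _.
apply: improves_fcat; last exact: improves_refl.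
by apply: improves_chain_cat; lra.
Qed.

(** A balanced branch minus its top vertex weighs less than half of [S], so it can be straightened.
    The result is merged at once with the two chains of the remaining branches, so never more than
    three chains hang at the root. *)
Lemma straighten_root f : balanced x S f -> weight f < S ->
  exists c1 c2, improves f (fcat (chain c1) (chain c2)).
Proof.
elim: f => [_ _|y s _ r IHr [Ys bal]|y s _ z t _ r IHr [Yst Zst bal]].
- by exists [::], [::]; exact: improves_refl.
- rewrite [weight _]/= => lt; have y0 := x_gt0 y.
  have s0 := weight_ge0 s; have r0 := weight_ge0 r.
  have [|cs imps] := @straighten s; first lra.
  have [//||c1 [c2 impr]] := IHr; first lra.
  have [|d1 [d2 imp]] := @merge_chains ((None, y) :: cs) c1 c2.
    rewrite weight_chain_cons (improves_weight imps) -addrA -weight_fcat.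
    by rewrite (improves_weight impr) /=; lra.
  exists d1, d2; apply: improves_trans imp.
  rewrite -[Br2 _ _ _]/(fcat (Br2 y s Leaf) r).
  exact: (improves_fcat (improves_br2 y imps) impr).
rewrite [weight _]/= => lt; have y0 := x_gt0 y; have z0 := x_gt0 z.
have s0 := weight_ge0 s; have t0 := weight_ge0 t; have r0 := weight_ge0 r.
have [|cs imps] := @straighten s; first lra.
have [|ct impt] := @straighten t; first lra.
have [//||c1 [c2 impr]] := IHr; first lra.
have [||c impc] := @improves_br3_chain y cs z ct.
- by rewrite (improves_weight imps) (improves_weight impt); lra.
- by rewrite (improves_weight imps) (improves_weight impt); lra.
have imp := improves_trans (improves_br3 y z imps impt) impc.
have [|d1 [d2 impd]] := @merge_chains c c1 c2.
  rewrite (improves_weight imp) -addrA -weight_fcat.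
  by rewrite (improves_weight impr) /=; lra.
exists d1, d2; apply: improves_trans impd.
rewrite -[Br3 _ _ _ _ _]/(fcat (Br3 y s z t Leaf) r).
exact: improves_fcat.
Qed.

End Straighten.

(** * The distance kernel and the reflection of the path *)

Section Kernel.
Variables (R : realType) (L : nat).
Local Notation pos := 'I_(2 * L).+1.
Implicit Types (s t : pos) (y z : pos -> R) (M : R).

Definition ndist (s t : nat) : nat := ((s - t) + (t - s))%N.

(** On the diagonal this is the parity instead of zero. The surplus is carried by [nrm]: the
    distance form is at most [M * sqnorm y] exactly when the form of [amat] is at most [nrm M y]. *)
Definition amat s t : R := ((ndist s t)%:R + (odd s)%:R + (odd t)%:R) / 2.
(** Its form is [-4] times that of [amat] on odd parts; the parities cancel because the reflection
    preserves them. *)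
Definition kmat s t : R := (ndist s (rev_ord t))%:R - (ndist s t)%:R.
Definition nrm M y : R := \sum_(s : pos) (M + (odd s)%:R) * y s ^+ 2.
Definition ev y s : R := (y s + y (rev_ord s)) / 2.
Definition od y s : R := (y s - y (rev_ord s)) / 2.

Lemma ndistC (s t : nat) : ndist s t = ndist t s.
Proof. exact: addnC. Qed.

Lemma odd_rev s : odd (rev_ord s) = odd s.
Proof. by rewrite /= subSS oddB; [rewrite oddM | rewrite -ltnS]. Qed.

Lemma amatC s t : amat s t = amat t s.
Proof. by rewrite /amat ndistC; ring. Qed.

Lemma amat_ge0 s t : 0 <= amat s t.
Proof. by rewrite divr_ge0 ?addr_ge0 ?ler0n. Qed.

Lemma ndist_rev s t : ndist (rev_ord s) (rev_ord t) = ndist s t.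
Proof. by rewrite /ndist /=; have := ltn_ord s; have := ltn_ord t; clear; lia. Qed.

Lemma amat_rev s t : amat (rev_ord s) (rev_ord t) = amat s t.
Proof. by rewrite /amat !odd_rev ndist_rev. Qed.

Lemma pdist_amat s t : (pdist s t)%:R = amat s t - (s == t)%:R * (odd s)%:R.
Proof.
rewrite /pdist /amat -[s == t :> nat]/(s == t).
have [<-|st] := eqVneq s t.
  by rewrite /ndist subnn addn0 mul1r; lra.
rewrite mul0r subr0 -!natrD -/(ndist s t).
have : ~~ odd (ndist s t + odd s + odd t).
  by rewrite /ndist; clear; lia.
move: (_ + _ + _)%N => k /even_halfK {2}<-.
by rewrite -muln2 natrM mulfK ?pnatr_eq0.
Qed.

Lemma bilin_pdist y :
  bilin (fun s t => (pdist s t)%:R) y y = bilin amat y y - \sum_(s : pos) (odd s)%:R * y s ^+ 2.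
Proof.
rewrite /bilin -sumrB; apply: eq_bigr => s _.
rewrite (eq_bigr (fun t => amat s t * y s * y t -
   delta R s t * ((odd s)%:R * y s * y t))); last first.
  by move=> t _; rewrite pdist_amat /delta eq_sym; ring.
by rewrite sumrB sum_delta; congr (_ - _); ring.
Qed.

Lemma nrmE M y : nrm M y = M * sqnorm y + \sum_(s : pos) (odd s)%:R * y s ^+ 2.
Proof.
rewrite /nrm /sqnorm mulr_sumr -big_split; apply: eq_bigr => s _ /=.
by ring.
Qed.

Lemma ndist_cuts (N s t : nat) : (s < N)%N -> (t < N)%N ->
  ndist s t = (\sum_(c < N) ((s <= c) != (t <= c)))%N.
Proof.
move=> sN tN.
have H k : (\sum_(c < k) ((s <= c) != (t <= c)))%N = ndist (minn s k) (minn t k).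
  elim: k => [|k IH]; first by rewrite big_ord0 !minn0.
  by rewrite big_ord_recr /= IH /ndist; clear; lia.
by rewrite H !(minn_idPl (ltnW _)).
Qed.

(* The metric is of negative type: the cuts of the path turn the form into
   minus a sum of squares. *)
Lemma bilin_amat_le0 y : \sum_s y s = 0 -> bilin amat y y <= 0.
Proof.
move=> y0.
pose P (c : pos) := \sum_(s : pos) (s <= c)%N%:R * y s.
have -> : bilin amat y y = - \sum_c P c ^+ 2.
  have sumM (f g : pos -> R) : \sum_s \sum_t (f s * g t) = (\sum_s f s) * (\sum_t g t).
    by rewrite mulr_suml; apply: eq_bigr => s _; rewrite mulr_sumr.
  have -> : bilin amat y y = 2^-1 * \sum_(s : pos) \sum_(t : pos) ((ndist s t)%:R * y s * y t)
    + 2^-1 * \sum_(s : pos) \sum_(t : pos) (((odd s)%:R * y s) * y t)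
    + 2^-1 * \sum_(s : pos) \sum_(t : pos) (y s * ((odd t)%:R * y t)).
    rewrite -!mulrDr -!big_split /= mulr_sumr; apply: eq_bigr => s _.
    rewrite -!big_split /= mulr_sumr; apply: eq_bigr => t _.
    by rewrite /amat; field.
  rewrite !sumM y0 mulr0 mul0r !mulr0 !addr0.
  have E (s t : pos) : (ndist s t)%:R * y s * y t = \sum_(c : pos) (
     ((s <= c)%N%:R * y s) * y t + y s * ((t <= c)%N%:R * y t)
     - 2 * (((s <= c)%N%:R * y s) * ((t <= c)%N%:R * y t))).
    rewrite (ndist_cuts (ltn_ord s) (ltn_ord t)) natr_sum !mulr_suml.
    apply: eq_bigr => c _; case: (s <= c)%N; case: (t <= c)%N => /=; ring.
  rewrite (eq_bigr (fun s : pos => \sum_(c : pos) \sum_(t : pos) (((s <= c)%N%:R * y s) * y t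
     + y s * ((t <= c)%N%:R * y t)
     - 2 * (((s <= c)%N%:R * y s) * ((t <= c)%N%:R * y t))))); last first.
    by move=> s _; rewrite exchange_big; apply: eq_bigr => t _; exact: E.
  rewrite exchange_big mulr_sumr -sumrN; apply: eq_bigr => c _.
  rewrite (eq_bigr (fun s : pos => (\sum_(t : pos) ((s <= c)%N%:R * y s) * y t
     + \sum_(t : pos) y s * ((t <= c)%N%:R * y t))
     - 2 * \sum_(t : pos) ((s <= c)%N%:R * y s) * ((t <= c)%N%:R * y t))); last first.
    by move=> s _; rewrite sumrB big_split mulr_sumr.
  by rewrite sumrB big_split /= -mulr_sumr !sumM y0 /P; field.
by rewrite oppr_le0; apply: sumr_ge0 => c _; rewrite sqr_ge0.
Qed.

Lemma sum_rev (F : pos -> R) : \sum_s F (rev_ord s) = \sum_s F s.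
Proof. by rewrite [RHS](reindex_inj rev_ord_inj). Qed.

Lemma sum_od y : \sum_s od y s = 0.
Proof. by rewrite -mulr_suml sumrB sum_rev subrr mul0r. Qed.

Lemma evod y s : y s = ev y s + od y s.
Proof. by rewrite /ev /od; field. Qed.

Lemma bilin_rev y z :
  bilin amat (fun s => y (rev_ord s)) (fun s => z (rev_ord s)) = bilin amat y z.
Proof.
rewrite /bilin [RHS](reindex_inj rev_ord_inj); apply: eq_bigr => s _.
rewrite [RHS](reindex_inj rev_ord_inj); apply: eq_bigr => t _ /=.
by rewrite amat_rev.
Qed.

(** The form is invariant under the reflection, which fixes the even part and negates the odd
    one. *)
Lemma bilin_ev_od y z : bilin amat (ev y) (od z) = 0.
Proof.
have E : bilin amat (ev y) (od z) = - bilin amat (ev y) (od z).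
  rewrite -{1}bilin_rev -mulN1r -bilinZr; apply: eq_bilin => s.
    by rewrite /ev rev_ordK addrC.
  by rewrite /od rev_ordK; ring.
by move: E; lra.
Qed.

Lemma bilin_od y z : bilin amat (od y) (od z) = bilin amat y (od z).
Proof.
have -> : bilin amat y (od z) = bilin amat (fun s => ev y s + od y s) (od z).
  by apply: eq_bilin => // s; exact: evod.
by rewrite bilinDl bilin_ev_od add0r.
Qed.

Lemma bilin_kmat y z : bilin kmat y z = - 4 * bilin amat (od y) (od z).
Proof.
rewrite bilin_od.
have -> : bilin amat y (od z) =
    2^-1 * (bilin amat y z - bilin amat y (fun s => z (rev_ord s))).
  rewrite (@eq_bilin _ _ _ y y (od z) (fun t => 2^-1 * z t + (- 2^-1) * z (rev_ord t)))//.
    by rewrite bilinDr !bilinZr; ring.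
  by move=> t; rewrite /od; field.
have -> : bilin amat y (fun s => z (rev_ord s)) = bilin (fun s t => amat s (rev_ord t)) y z.
  apply: eq_bigr => s _; rewrite (reindex_inj rev_ord_inj); apply: eq_bigr => t _ /=.
  by rewrite rev_ordK.
rewrite /bilin -sumrB !mulr_sumr; apply: eq_bigr => s _.
rewrite -sumrB !mulr_sumr; apply: eq_bigr => t _.
by rewrite /kmat /amat odd_rev; field.
Qed.

Lemma nrmD M y z : (forall s, y s * z s = 0) ->
  nrm M (fun s => y s + z s) = nrm M y + nrm M z.
Proof.
move=> yz; rewrite /nrm -big_split; apply: eq_bigr => s _ /=.
by rewrite sqrrD yz mul0rn addr0 mulrDr.
Qed.

Lemma nrm_evod M y : nrm M y = nrm M (ev y) + nrm M (od y).
Proof.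
have E : nrm M y = nrm M (fun s => y (rev_ord s)).
  by rewrite /nrm (reindex_inj rev_ord_inj); apply: eq_bigr => s _; rewrite odd_rev.
have -> : nrm M y = 2^-1 * (nrm M y + nrm M (fun s => y (rev_ord s))).
  by rewrite -E; field.
rewrite /nrm -!big_split /= mulr_sumr; apply: eq_bigr => s _.
by rewrite /ev /od; field.
Qed.

End Kernel.

Definition supported (R : realType) (I : finType) (P : {set I}) (y : I -> R) : Prop :=
  forall s, s \notin P -> y s = 0.

Definition contains_evens L (P : {set 'I_(2 * L).+1}) : Prop :=
  forall s : 'I_(2 * L).+1, ~~ odd s -> s \in P.

Section KernelSums.
Variables (R : realType) (L : nat).
Local Notation pos := 'I_(2 * L).+1.
Local Notation amat := (@amat R L).
Local Notation delta := (@delta R pos).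
Implicit Types (s t : pos) (y z : pos -> R) (M : R).

Lemma delta_rev s t : delta s (rev_ord t) = delta (rev_ord s) t.
Proof. by rewrite /delta -(inj_eq rev_ord_inj) rev_ordK. Qed.

Lemma nrm_sum_delta (T : eqType) (l : seq T) (f : T -> pos) (F : T -> R) M :
  uniq (map f l) -> nrm M (fun s => \sum_(p <- l) F p * delta (f p) s) =
  \sum_(p <- l) (M + (odd (f p))%:R) * F p ^+ 2.
Proof.
elim: l => [_|p l IH] /=.
  by rewrite big_nil; apply: big1 => s _; rewrite big_nil expr0n mulr0.
move=> /andP[pl ul]; rewrite big_cons -IH//.
have -> : nrm M (fun s => \sum_(q <- p :: l) F q * delta (f q) s) =
    nrm M (fun s => F p * delta (f p) s + \sum_(q <- l) F q * delta (f q) s).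
  by apply: eq_bigr => s _; rewrite big_cons.
rewrite nrmD; last first.
  move=> s; rewrite /delta; have [->|_] := eqVneq s (f p); last by rewrite mulr0 mul0r.
  rewrite big_seq big1 ?mulr0// => q ql.
  have [fpq|_] := eqVneq (f p) (f q); last by rewrite mulr0.
  by rewrite fpq map_f in pl.
congr (_ + _); rewrite /nrm (bigD1 (f p))//= big1 => [|s /negPf sp].
  by rewrite /delta eqxx mulr1 addr0.
by rewrite /delta sp mulr0 expr0n mulr0.
Qed.

Lemma sum_delta_seq (l : seq pos) (F : pos -> R) s : uniq l ->
  \sum_(t <- l) F t * delta t s = if s \in l then F s else 0.
Proof.
elim: l => [_|t l IH] /=; first by rewrite big_nil.
move=> /andP[tl ul]; rewrite big_cons IH// inE /delta.
have [->|st] := eqVneq s t; first by rewrite (negPf tl) mulr1 addr0.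
by rewrite mulr0 add0r.
Qed.

Lemma amat_sum_delta (T : Type) (l : seq T) (f : T -> pos) (F : T -> R) t :
  \sum_s amat t s * (\sum_(p <- l) F p * delta (f p) s) =
  \sum_(p <- l) F p * amat t (f p).
Proof.
rewrite (eq_bigr (fun s => \sum_(p <- l) F p * (delta (f p) s * amat t s))).
  rewrite exchange_big; apply: eq_bigr => p _.
  by rewrite -mulr_sumr sum_delta.
by move=> s _; rewrite mulr_sumr; apply: eq_bigr => p _; ring.
Qed.

(** The distances from [t] to [a] and to its mirror image add up to twice the maximum of the
    distances of [t] and of [a] from the centre [L], which grows as [a] moves outwards. *)
Lemma amat_outward (a b t : pos) : odd a -> odd b -> (ndist a L <= ndist b L)%N ->
  amat t a + amat t (rev_ord a) <= amat t b + amat t (rev_ord b).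
Proof.
move=> oa ob ab.
suff : (ndist t a + ndist t (rev_ord a) <= ndist t b + ndist t (rev_ord b))%N.
  rewrite -(ler_nat R) natrD [in X in _ <= X -> _]natrD /amat !odd_rev oa ob.
  by clear; lra.
move: ab; rewrite /ndist /=.
by have := ltn_ord a; have := ltn_ord b; have := ltn_ord t; clear; lia.
Qed.

(** Replacing one argument at a time, the form increases from [(u, u)] to [(u, u')] to [(u', u')],
    and likewise from [(z, u)] to [(z, u')]. *)
Lemma bilin_amat_mono z u u' : (forall s, 0 <= z s) -> (forall s, 0 <= u s) ->
  (forall s, 0 <= u' s) ->
  (forall t, \sum_s amat t s * u s <= \sum_s amat t s * u' s) ->
  bilin amat (fun s => z s + u s) (fun s => z s + u s) <=
  bilin amat (fun s => z s + u' s) (fun s => z s + u' s).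
Proof.
move=> z0 u0 u'0 le.
have H w : (forall s, 0 <= w s) -> bilin amat w u <= bilin amat w u'.
  move=> w0.
  have E v : bilin amat w v = \sum_t w t * \sum_s amat t s * v s.
    apply: eq_bigr => t _; rewrite mulr_sumr; apply: eq_bigr => s _; ring.
  by rewrite !E; apply: ler_sum => t _; rewrite ler_wpM2l.
rewrite !bilin_sqrD; [|exact: amatC..].
have h1 := H z z0; have h2 := H u u0; have h3 := H u' u'0.
have h4 : bilin amat u' u = bilin amat u u' by apply: bilinC; exact: amatC.
by lra.
Qed.

Lemma nrm_norm M y : nrm M (fun s => `|y s|) = nrm M y.
Proof. by apply: eq_bigr => s _; rewrite real_normK ?num_real. Qed.

End KernelSums.

(** The arithmetic of the final contradiction: [K] is the form of [kmat] on the part of the vector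
    not left symmetric, bounded above by symmetrising and below by folding. [c] is the distance of
    the block [q] from the centre, [S] a squared folded mass, and [Xq], [Xr] are squared entries. *)
Lemma fold_absurd (R : realFieldType) (c S K B Xq Xr : R) :
  K <= 2 * (2 * c * Xq) -> 2 * c * S + B <= K -> 4 * Xr <= B -> 0 < Xr ->
  0 <= c -> 0 <= S -> 0 <= Xq ->
  [\/ c = 0, 4 * Xq <= S | c = 1 /\ Xq < Xr] -> False.
Proof.
move=> h1 h2 h3 h4 c0 S0 Xq0 [h|h|[h h']]; [by rewrite h in h1 h2; lra| |by rewrite h in h1 h2; lra].
have : 0 <= c * (S - 4 * Xq) by rewrite mulr_ge0// subr_ge0.
have : 0 <= c * Xq by rewrite mulr_ge0.
by lra.
Qed.

(** * A lower bound for the folded form *)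

Section KernelBound.
Variables (R : realType) (L : nat).
Local Notation pos := 'I_(2 * L).+1.
Local Notation kmat := (@kmat R L).
Implicit Types (q r s t : pos) (y : pos -> R).

Lemma kmatE s t : (L <= s)%N -> (L <= t)%N -> kmat s t = 2 * (minn s t - L)%:R.
Proof.
move=> Ls Lt; rewrite /kmat.
have -> : ndist s (rev_ord t) = (ndist s t + 2 * (minn s t - L))%N.
  by rewrite /ndist /=; have := ltn_ord t; move: Ls Lt; clear; lia.
by rewrite natrD natrM; ring.
Qed.

(* Folding the chain at its centre, the form becomes [2 min(s, t)] in the
   distances to the centre. *)
Lemma kmat_lower q r y : (forall s, 0 <= y s) -> (L <= q)%N -> (q < r)%N ->
  (forall s, y s != 0 -> (q <= s)%N \/ s = rev_ord q) ->
  2 * (q - L)%:R * (\sum_(s : pos | (q < s)%N) y s + (y q - y (rev_ord q))) ^+ 2 +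
  2 * (r - q)%:R * y r ^+ 2 <= bilin kmat y y.
Proof.
move=> y0 Lq qr suppy.
(* [z] is [y] folded onto the right half. By the support condition only [q] can have mass at its
   mirror image, so [z] can be negative only at [q]. *)
pose z s : R := if s == q then y q - y (rev_ord q) else if (q < s)%N then y s else 0.
have odE s : od y s = od z s.
  rewrite /od; congr (_ / 2).
  wlog Ls : s / (L <= s)%N.
    move=> W; have [/W//|sL] := leqP L s.
    have := W (rev_ord s); rewrite rev_ordK => H.
    have {}H := H (_ : (L <= rev_ord s)%N).
    rewrite -opprB H ?opprB//=.
    by have := ltn_ord s; move: sL; clear; lia.
  have yr0 : y (rev_ord s) != 0 -> (s <= q)%N.
    by move=> /suppy[|/rev_ord_inj ->//] /=; have := ltn_ord s; move: Ls Lq; clear; lia.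
  have zr : z (rev_ord s) = if (s == q) && (rev_ord s == q) then z q else 0.
    rewrite /z; case: (eqVneq (rev_ord s) q) => [rq|rq].
      have -> : s = q.
        apply/val_inj => /=; move: (congr1 val rq) Ls Lq => /=; have := ltn_ord s.
        by clear; lia.
      by rewrite eqxx.
    rewrite andbF; case: ifP => //; have := ltn_ord s; move: Ls Lq rq; clear => /= *.
    lia.
  rewrite zr; have [sq|sq] := eqVneq s q.
    rewrite sq /=; case: eqP => [rq|_]; last by rewrite /z eqxx subr0.
    by rewrite rq !subrr.
  rewrite /= subr0 /z (negPf sq).
  have [qs|] := boolP (q < s)%N.
    have -> : y (rev_ord s) = 0.
      by apply/eqP/negPn/negP => /yr0; rewrite leqNgt qs.
    by rewrite subr0.
  rewrite -leqNgt => sq'.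
  have lt : (s < q)%N by rewrite ltn_neqAle sq' andbT.
  have ys : y s = 0.
    apply/eqP/negPn/negP => /suppy[|]; first by rewrite leqNgt lt.
    move=> /(congr1 val) /=; have := ltn_ord q; move: lt Ls Lq; clear; lia.
  have yrs : y (rev_ord s) = 0.
    apply/eqP/negPn/negP => /suppy[|/rev_ord_inj sq2] /=; last by rewrite sq2 eqxx in sq.
    have := ltn_ord s; move: lt Ls Lq; clear; lia.
  by rewrite ys yrs subr0.
have -> : bilin kmat y y = bilin kmat z z by rewrite !bilin_kmat (eq_bilin _ odE odE).
have z0 s : s != q -> 0 <= z s by move=> sq; rewrite /z (negPf sq); case: ifP.
have zlt s : (s < q)%N -> z s = 0.
  by move=> sq; rewrite /z ltnNge (ltnW sq) /=; case: eqP => // e; rewrite e ltnn in sq.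
have sumz : \sum_s z s = \sum_(s : pos | (q < s)%N) y s + (y q - y (rev_ord q)).
  rewrite (bigD1 q)//= {1}/z eqxx addrC [in RHS]big_mkcond; congr (_ + _).
  rewrite [RHS](bigD1 q)//= ltnn add0r; apply: eq_bigr => s /negPf sq.
  by rewrite /z sq.
rewrite -sumz.
(* The constant [2 * (q - L)] is split off the kernel and yields the squared sum. What remains
   vanishes when an argument is [q], so all its terms are nonnegative and only the one at [(r, r)]
   is kept. *)
have -> : bilin kmat z z = 2 * (q - L)%:R * (\sum_s z s) ^+ 2 +
    \sum_s \sum_t (kmat s t - 2 * (q - L)%:R) * z s * z t.
  have -> : (\sum_s z s) ^+ 2 = \sum_s \sum_t z s * z t.
    by rewrite expr2 mulr_suml; apply: eq_bigr => s _; rewrite mulr_sumr.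
  rewrite mulr_sumr -big_split; apply: eq_bigr => s _ /=.
  rewrite mulr_sumr -big_split; apply: eq_bigr => t _ /=; ring.
rewrite lerD2l.
have zr : z r = y r.
  have -> : z r = if r == q then y q - y (rev_ord q) else if (q < r)%N then y r else 0 by [].
  by rewrite qr; case: eqP => // rq; rewrite rq ltnn in qr.
have pos s t : 0 <= (kmat s t - 2 * (q - L)%:R) * z s * z t.
  have [/zlt ->|qs] := ltnP s q; first by rewrite mulr0 mul0r.
  have [/zlt ->|qt] := ltnP t q; first by rewrite mulr0.
  rewrite kmatE; [|exact: leq_trans qs|exact: leq_trans qt].
  rewrite -mulrBr -natrB; last by rewrite leq_sub2r// leq_min qs.
  have [->|sq] := eqVneq s q.
    by rewrite (minn_idPl qt) subnn mulr0 !mul0r.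
  have [->|tq] := eqVneq t q.
    by rewrite (minn_idPr qs) subnn mulr0 !mul0r.
  by rewrite mulr_ge0 ?mulr_ge0 ?z0.
rewrite (bigD1 r)//= (bigD1 r)//=.
rewrite kmatE ?minnn; [|exact: leq_trans Lq (ltnW qr)..].
have -> : (2 * (r - L)%:R - 2 * (q - L)%:R) * z r * z r = 2 * (r - q)%:R * y r ^+ 2.
  have -> : (r - L = (r - q) + (q - L))%N by move: Lq qr; clear; lia.
  by rewrite zr natrD; ring.
by rewrite -addrA lerDl addr_ge0//; apply: sumr_ge0 => s _; [|apply: sumr_ge0 => t _].
Qed.

End KernelBound.

(** * Optimal position sets: convexity and symmetrisation *)

Section Optimal.
Variables (R : realType) (L : nat).
Local Notation pos := 'I_(2 * L).+1.
Local Notation amat := (@amat R L).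
Local Notation kmat := (@kmat R L).
Local Notation delta := (@delta R pos).
Variables (P : {set pos}) (M : R) (x : pos -> R).
Implicit Types (q r s t : pos) (y : pos -> R).
Hypothesis M_gt0 : 0 < M.
Hypothesis evenP : contains_evens P.
Hypothesis x_gt0 : forall s, s \in P -> 0 < x s.
Hypothesis x_supp : supported P x.
Hypothesis eigx : forall s, s \in P -> \sum_t amat s t * x t = (M + (odd s)%:R) * x s.
Hypothesis opt : forall (P' : {set pos}) y, contains_evens P' -> #|P'| = #|P| ->
  supported P' y -> bilin amat y y <= nrm M y.

Let V s := \sum_t amat s t * x t.

Lemma x_ge0 s : 0 <= x s.
Proof. by have [/x_gt0/ltW|/x_supp ->] := boolP (s \in P). Qed.

Lemma bilin_x : bilin amat x x = nrm M x.
Proof.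
rewrite /bilin /nrm; apply: eq_bigr => s _.
rewrite (eq_bigr (fun t => x s * (amat s t * x t))); last by move=> t _; ring.
rewrite -mulr_sumr; have [/eigx ->|/x_supp ->] := boolP (s \in P); ring.
Qed.

Lemma notin_odd s : s \notin P -> odd s.
Proof. by move=> sP; apply: contraNT sP => /evenP. Qed.

(** Test the vector with the entry at [j] moved to the free place [i]. The norm is unchanged, since
    both places are odd, and the form changes by [2 * x j * (V i - V j) - x j ^+ 2 * ndist i j];
    optimality makes this nonpositive. *)
Lemma move_le (i j : pos) : odd j -> j \in P -> i \notin P ->
  V i - V j <= x j * (ndist i j)%:R / 2.
Proof.
move=> oj jP iP; have oi := notin_odd iP.
have ij : (i == j) = false by apply/negP => /eqP ij; rewrite ij jP in iP.
have ji : (j == i) = false by rewrite eq_sym.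
pose d s := delta i s - delta j s.
pose y s := x s + x j * d s.
have d0 s : d s != 0 -> s = i \/ s = j.
  rewrite /d /delta; have [->|_] := eqVneq s i; first by left.
  by have [->|_] := eqVneq s j; [right|rewrite subrr eqxx].
have := @opt (i |: (P :\ j)) y.
have E1 : contains_evens (i |: (P :\ j)).
  move=> s os; rewrite !inE (evenP os) andbT; apply/orP; right.
  by apply: contraNneq os => ->.
have E2 : #|i |: (P :\ j)| = #|P|.
  by rewrite cardsU1 !inE (negPf iP) andbF /= (cardsD1 j P) jP.
have E3 : supported (i |: (P :\ j)) y.
  move=> s; rewrite !inE !negb_or negb_and negbK => /andP[si].
  rewrite /y /d /delta (negPf si) sub0r => /orP[/eqP ->|sP].
    by rewrite eqxx /=; ring.
  have -> : (s == j) = false by apply/negP => /eqP sj; rewrite sj jP in sP.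
  by rewrite x_supp//=; ring.
move=> /(_ E1 E2 E3).
have -> : bilin amat y y = bilin amat x x + 2 * x j * (V i - V j) - x j ^+ 2 * (ndist i j)%:R.
  rewrite /y bilin_sqrD; last exact: amatC.
  rewrite bilinZr bilinZl bilinZr (bilinC _ _ (@amatC R L)).
  have -> : bilin amat d x = V i - V j.
    have -> : bilin amat d x = bilin amat (fun s => delta i s + (-1) * delta j s) x.
      by apply: eq_bilin => // s; rewrite /d; ring.
    by rewrite bilinDl bilinZl !bilin_deltal -/(V i) -/(V j); ring.
  have -> : bilin amat d d = - (ndist i j)%:R.
    have -> : bilin amat d d = bilin amat (fun s => delta i s + (-1) * delta j s)
        (fun s => delta i s + (-1) * delta j s).
      by apply: eq_bilin => s; rewrite /d; ring.
    rewrite bilin_sqrD; last exact: amatC.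
    rewrite !bilinZr bilinZl !bilin_delta /amat oi oj /ndist !subnn.
    by rewrite /=; field.
  by ring.
have -> : nrm M y = nrm M x.
  rewrite /nrm (bigD1 i)//= [RHS](bigD1 i)//= (bigD1 j) ?ji//= [X in _ = _ + X](bigD1 j) ?ji//=.
  rewrite (eq_bigr (fun s : pos => (M + (odd s)%:R) * x s ^+ 2)); last first.
    move=> s /andP[/negPf si /negPf sj].
    by rewrite /y /d /delta si sj /=; congr (_ * _); ring.
  by rewrite /y /d /delta !eqxx ij ji oi oj (x_supp iP) /=; ring.
rewrite bilin_x => le.
have xj := x_gt0 jP.
have : x j * (2 * (V i - V j) - x j * (ndist i j)%:R) <= 0 by lra.
by rewrite pmulr_rle0//; lra.
Qed.

(** Among three odd positions the parities cancel, leaving a weighted second difference of the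
    distance to each [t], which is nonnegative by convexity. [F] keeps whatever lower bound for it
    is needed. *)
Lemma potential_convex (i j k : pos) (F : pos -> R) : (i < j < k)%N ->
  odd i -> odd j -> odd k ->
  (forall t, F t <= (k - j)%:R * (ndist i t)%:R + (j - i)%:R * (ndist k t)%:R
     - (k - i)%:R * (ndist j t)%:R) ->
  \sum_t F t * x t <= 2 * ((k - j)%:R * V i + (j - i)%:R * V k - (k - i)%:R * V j).
Proof.
move=> /andP[ij jk] oi oj ok HF.
rewrite /V !mulr_sumr -big_split -sumrB mulr_sumr; apply: ler_sum => t _ /=.
have -> : 2 * ((k - j)%:R * (amat i t * x t) + (j - i)%:R * (amat k t * x t)
    - (k - i)%:R * (amat j t * x t)) =
  ((k - j)%:R * (ndist i t)%:R + (j - i)%:R * (ndist k t)%:R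
     - (k - i)%:R * (ndist j t)%:R) * x t.
  have -> : (k - i = (k - j) + (j - i))%N by move: ij jk; clear; lia.
  by rewrite /amat oi oj ok natrD; field.
by apply: ler_wpM2r => //; exact: x_ge0.
Qed.

Lemma ndist_convex (i j k t : nat) : (i < j < k)%N ->
  0 <= (k - j)%:R * (ndist i t)%:R + (j - i)%:R * (ndist k t)%:R
     - (k - i)%:R * (ndist j t)%:R :> R.
Proof.
move=> ijk; rewrite subr_ge0 -!natrM -natrD ler_nat.
move: ijk; rewrite /ndist => /andP[ij jk].
have [e eE] : exists e, (j - i)%N = e by eexists.
have [d dE] : exists d, (k - j)%N = d by eexists.
have -> : (k - i = e + d)%N by move: ij jk eE dE; clear; lia.
rewrite eE dE.
have [le|/ltnW le] := leqP t j.
  have : (j - t + (t - j) <= i - t + (t - i) + e)%N by move: eE le ij; clear; lia.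
  have : (k - t + (t - k) = j - t + (t - j) + d)%N by move: dE le jk; clear; lia.
  by move=> ->; clear; nia.
have : (j - t + (t - j) <= k - t + (t - k) + d)%N by move: dE le jk; clear; lia.
have : (i - t + (t - i) = j - t + (t - j) + e)%N by move: eE le ij; clear; lia.
by move=> ->; clear; nia.
Qed.

Lemma sum_two_delta (i j : pos) (a b : R) :
  \sum_t (a * delta i t + b * delta j t) * x t = a * x i + b * x j.
Proof.
rewrite (eq_bigr (fun t => a * (delta i t * x t) + b * (delta j t * x t))).
  by rewrite big_split /= -!mulr_sumr !sum_delta.
by move=> t _; ring.
Qed.

(** Moving [j] to [i] and to [k] bounds the second difference of [V] from above by exactly the
    contribution of [j] to its lower bound. The even position right of [j] contributes too, which is
    a contradiction. *)
Lemma gap_convex (i j k : pos) : (i < j < k)%N -> i \notin P -> k \notin P -> odd j ->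
  j \notin P.
Proof.
move=> /[dup] ijk /andP[ij jk] iP kP oj; apply/negP => jP.
have oi := notin_odd iP; have ok := notin_odd kP.
have jk2 : (j.+1 < k)%N by move: jk oj ok; clear; lia.
have j1N : (j.+1 < (2 * L).+1)%N := ltn_trans jk2 (ltn_ord k).
pose j1 : pos := Ordinal j1N.
have j1P : j1 \in P by apply: evenP => /=; rewrite oj.
have jj1 : (j == j1) = false by apply/negP => /eqP/(congr1 val) /=; clear; lia.
have C := potential_convex (F := fun t => (2 * (k - j)%:R * (j - i)%:R) * delta j t
  + (2 * (j - i)%:R * (k - j.+1)%:R) * delta j1 t) ijk oi oj ok.
have : forall t, (2 * (k - j)%:R * (j - i)%:R) * delta j t
  + (2 * (j - i)%:R * (k - j.+1)%:R) * delta j1 t <=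
    (k - j)%:R * (ndist i t)%:R + (j - i)%:R * (ndist k t)%:R
     - (k - i)%:R * (ndist j t)%:R.
  have -> : (k - i = (k - j) + (j - i))%N by move: ij jk; clear; lia.
  move=> t; rewrite /delta; have [->|tj] := eqVneq t j.
    rewrite jj1 /ndist subnn.
    have -> : (i - j = 0)%N by move: ij; clear; lia.
    have -> : (j - k = 0)%N by move: jk; clear; lia.
    by rewrite !addn0 !add0n natrD /=; lra.
  have [->|tj1] := eqVneq t j1.
    rewrite /ndist /=.
    have -> : (i - j.+1 = 0)%N by move: ij; clear; lia.
    have -> : (j.+1 - i = (j - i).+1)%N by move: ij; clear; lia.
    have -> : (j.+1 - k = 0)%N by move: jk2; clear; lia.
    have -> : (j - j.+1 = 0)%N by clear; lia.
    have -> : (j.+1 - j = 1)%N by clear; lia.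
    have -> : (k - j = (k - j.+1).+1)%N by move: jk2; clear; lia.
    by rewrite !addn0 !add0n !natrD -!natr1 /=; lra.
  rewrite !mulr0 addr0.
  have -> : ((k - j) + (j - i) = k - i)%N by move: ij jk; clear; lia.
  exact: ndist_convex.
move=> /C; rewrite sum_two_delta => {}C.
have m1 := move_le oj jP iP; have m2 := move_le oj jP kP.
have e1 : (ndist i j)%:R = (j - i)%:R :> R.
  by congr (_ %:R); rewrite /ndist; move: ij; clear; lia.
have e2 : (ndist k j)%:R = (k - j)%:R :> R.
  by congr (_ %:R); rewrite /ndist; move: jk; clear; lia.
rewrite e1 in m1; rewrite e2 in m2.
have e3 : (k - i)%:R = (k - j)%:R + (j - i)%:R :> R.
  by rewrite -natrD; congr (_ %:R); move: ij jk; clear; lia.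
rewrite e3 in C.
have p1 : 0 < (j - i)%:R :> R by rewrite ltr0n subn_gt0.
have p2 : 0 < (k - j)%:R :> R by rewrite ltr0n subn_gt0.
have p3 : 0 < (k - j.+1)%:R :> R by rewrite ltr0n subn_gt0.
have x1 := x_gt0 j1P.
have q1 : (k - j)%:R * (V i - V j) <= (k - j)%:R * (x j * (j - i)%:R / 2).
  by rewrite ler_pM2l.
have q2 : (j - i)%:R * (V k - V j) <= (j - i)%:R * (x j * (k - j)%:R / 2).
  by rewrite ler_pM2l.
have q3 : 0 < (j - i)%:R * (k - j.+1)%:R * x j1 by rewrite !mulr_gt0.
by lra.
Qed.

(* Otherwise moving the third vertex from [r] to the free position [i] would
   increase the form. *)
Lemma outer_larger (i q r : pos) : (i < q < r)%N -> (r - q < q - i)%N -> i \notin P ->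
  odd q -> q \in P -> odd r -> r \in P -> x q < x r.
Proof.
move=> /[dup] iqr /andP[iq qr] far iP oq qP odr rP; rewrite ltNge; apply/negP => le.
have oi := notin_odd iP.
have C := potential_convex (F := fun t => (2 * (r - q)%:R * (q - i)%:R) * delta q t
  + 0 * delta r t) iqr oi oq odr.
have : forall t, (2 * (r - q)%:R * (q - i)%:R) * delta q t + 0 * delta r t <=
    (r - q)%:R * (ndist i t)%:R + (q - i)%:R * (ndist r t)%:R
     - (r - i)%:R * (ndist q t)%:R.
  move=> t; rewrite /delta; have [->|tj] := eqVneq t q.
    rewrite /ndist subnn.
    have -> : (i - q = 0)%N by move: iq; clear; lia.
    have -> : (q - r = 0)%N by move: qr; clear; lia.
    by rewrite !addn0 !add0n /=; lra.
  by rewrite mulr0 mul0r addr0; exact: ndist_convex.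
move=> /C; rewrite sum_two_delta => {}C.
have m := move_le odr rP iP.
have e1 : (ndist i r)%:R = (r - q)%:R + (q - i)%:R :> R.
  by rewrite -natrD; congr (_ %:R); rewrite /ndist; move: iq qr; clear; lia.
have e3 : (r - i)%:R = (r - q)%:R + (q - i)%:R :> R.
  by rewrite -natrD; congr (_ %:R); move: iq qr; clear; lia.
rewrite e1 in m; rewrite e3 in C.
have p1 : 0 < (q - i)%:R :> R by rewrite ltr0n subn_gt0.
have p2 : 0 < (r - q)%:R :> R by rewrite ltr0n subn_gt0.
have p3 : (r - q)%:R < (q - i)%:R :> R by rewrite ltr_nat.
have xr := x_gt0 rP.
(* At odd places of [P] the eigenvalue equation orders the potentials like the entries. *)
have Vqr : V r <= V q.
  by rewrite /V (eigx rP) (eigx qP) odr oq ler_pM2l// addr_gt0.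
have q1 : (q - i)%:R * x r <= (q - i)%:R * x q by rewrite ler_pM2l.
have q2 : (r - q)%:R * ((q - i)%:R * x r) <= (r - q)%:R * ((q - i)%:R * x q).
  by rewrite ler_pM2l.
have q3 : (r - q)%:R * (V i - V r) <= (r - q)%:R * (x r * ((r - q)%:R + (q - i)%:R) / 2).
  by rewrite ler_pM2l.
have q4 : 0 <= ((r - q)%:R + (q - i)%:R) * (V q - V r).
  by apply: mulr_ge0; [lra|rewrite subr_ge0].
have q5 : 0 < ((r - q)%:R * x r) * ((q - i)%:R - (r - q)%:R).
  by rewrite !mulr_gt0// subr_gt0.
by lra.
Qed.

Definition restrict (l : seq pos) s : R := if s \in l then x s else 0.

(* [x = g + h + f] is compared with the vector in which [g] and [h] are
   replaced by their even parts [(x_s + x_{-s})/2] under the reflection of the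
   chain, and the masses of each pair [(a, b)] are then gathered at the outer
   place [b] and its mirror image; [f] stays in place. *)
Lemma symmetrization (prs : seq (pos * pos)) (fS : seq pos) :
  let ent := unzip1 prs ++ unzip2 prs in
  uniq (fS ++ ent) -> {subset fS ++ ent <= P} ->
  (forall p, p \in prs -> [/\ odd p.1, odd p.2, rev_ord p.2 \notin P &
     (ndist p.1 L <= ndist p.2 L)%N]) ->
  (forall s, s \in P -> s \notin fS ++ ent ->
     rev_ord s \in P /\ rev_ord s \notin fS ++ ent) ->
  bilin kmat (restrict (ent ++ fS)) (restrict (ent ++ fS)) <=
  2 * bilin kmat (restrict fS) (restrict fS).
Proof.
move=> ent uall subP prsP Gsym.
pose f := restrict fS; pose h := restrict ent.
pose g s : R := if s \in fS ++ ent then 0 else x s.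
have [uf dfe ue] : [/\ uniq fS, ~~ has (mem fS) ent & uniq ent].
  by move: uall; rewrite cat_uniq => /and3P.
have [u1 d12 u2] : [/\ uniq (unzip1 prs), ~~ has (mem (unzip1 prs)) (unzip2 prs)
    & uniq (unzip2 prs)] by move: ue; rewrite cat_uniq => /and3P.
have fent s : s \in fS -> s \notin ent.
  by move=> sf; apply: contra dfe => se; apply/hasP; exists s.
have x0 s : 0 <= x s by have [/x_gt0/ltW|/x_supp ->] := boolP (s \in P).
have f0 s : 0 <= f s by rewrite /f /restrict; case: ifP.
have h0 s : 0 <= h s by rewrite /h /restrict; case: ifP.
have g0 s : 0 <= g s by rewrite /g; case: ifP.
have gP s : g s != 0 -> s \in P /\ s \notin fS ++ ent.
  rewrite /g; case: ifP => [_|]; first by rewrite eqxx.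
  move=> /negbT sn xs; split => //.
  by apply: contraNT xs => /x_supp ->.
have g_rev s : g s != 0 -> g (rev_ord s) != 0.
  move=> /gP[sP sn]; have [rP rn] := Gsym s sP sn.
  by rewrite /g (negPf rn) gt_eqF// x_gt0.
have xE s : x s = g s + (h s + f s).
  rewrite /g /h /f /restrict mem_cat; have := @fent s.
  case: (s \in fS) => /= [/(_ isT)/negPf ->|_]; first by rewrite !add0r.
  by case: (s \in ent); rewrite ?add0r addr0 ?addr0.
have gf s : g s * f s = 0.
  by rewrite /g /f /restrict mem_cat; case: (s \in fS); rewrite ?mul0r ?mulr0.
have hf s : h s * f s = 0.
  rewrite /h /f /restrict; have := @fent s.
  by case: (s \in fS) => [/(_ isT)/negPf ->|_]; rewrite ?mul0r ?mulr0.
have ghf s : g s * (h s + f s) = 0.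
  rewrite mulrDr gf addr0 /g /h /restrict mem_cat.
  by case: (s \in ent); rewrite ?orbT ?mul0r ?mulr0.
pose v (p : pos * pos) : R := (x p.1 + x p.2) / 2.
have v0 p : 0 <= v p by rewrite /v divr_ge0 ?addr_ge0.
pose yb s := \sum_(p <- prs) v p * delta p.2 s.
pose yr s := \sum_(p <- prs) v p * delta (rev_ord p.2) s.
pose u s := \sum_(p <- prs) (x p.1 / 2) * delta p.1 s +
  \sum_(p <- prs) (x p.1 / 2) * delta (rev_ord p.1) s +
  (\sum_(p <- prs) (x p.2 / 2) * delta p.2 s +
  \sum_(p <- prs) (x p.2 / 2) * delta (rev_ord p.2) s).
pose u' s := yb s + yr s.
have hE s : h s = \sum_(p <- prs) x p.1 * delta p.1 s + \sum_(p <- prs) x p.2 * delta p.2 s.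
  rewrite /h /restrict -(sum_delta_seq x s ue) big_cat /=.
  by rewrite !big_map.
have uE s : ev h s = u s.
  rewrite /ev !hE /u mulrDl !mulrDl !mulr_suml.
  rewrite (eq_bigr (fun p => x p.1 / 2 * delta p.1 s)); last by move=> p _; ring.
  rewrite [X in _ + X + _](eq_bigr (fun p => x p.2 / 2 * delta p.2 s)); last by move=> p _; ring.
  rewrite [X in _ + (X + _)](eq_bigr (fun p => x p.1 / 2 * delta (rev_ord p.1) s)); last first.
    by move=> p _; rewrite delta_rev; ring.
  rewrite [X in _ + (_ + X)](eq_bigr (fun p => x p.2 / 2 * delta (rev_ord p.2) s)); last first.
    by move=> p _; rewrite delta_rev; ring.
  by ring.
have deltaP s t : s != t -> delta s t = 0 by rewrite /delta eq_sym => /negPf ->.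
have ybB s : s \notin unzip2 prs -> yb s = 0.
  move=> sB; rewrite /yb big_seq big1// => p pp; rewrite deltaP ?mulr0//.
  by apply: contraNneq sB => <-; exact: map_f.
have yrE s : yr s = yb (rev_ord s) by apply: eq_bigr => p _; rewrite delta_rev.
have BP s : s \in unzip2 prs -> s \in P /\ rev_ord s \notin P.
  move=> sB; split; first by apply: subP; rewrite !mem_cat sB !orbT.
  by case/mapP: sB => p /prsP[_ _ rp _] ->.
have yrB s : rev_ord s \notin unzip2 prs -> yr s = 0 by rewrite yrE; exact: ybB.
have nyb : nrm M yb = \sum_(p <- prs) (M + 1) * v p ^+ 2.
  rewrite /yb nrm_sum_delta//; apply: eq_big_seq => p /prsP[_ -> _ _].
  by [].
have nyr : nrm M yr = nrm M yb.
  rewrite /nrm [RHS](reindex_inj rev_ord_inj); apply: eq_bigr => s _.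
  by rewrite yrE odd_rev.
have ybr s : yb s * yr s = 0.
  have [/BP[_ rs]|/ybB ->] := boolP (s \in unzip2 prs); last by rewrite mul0r.
  by rewrite yrB ?mulr0//; apply: contra rs => /BP[].
have nh : nrm M h = \sum_(p <- prs) (M + 1) * (x p.1 ^+ 2 + x p.2 ^+ 2).
  have -> : nrm M h = nrm M (fun s => \sum_(t <- ent) x t * delta (id t) s).
    by apply: eq_bigr => s _; rewrite sum_delta_seq.
  rewrite (@nrm_sum_delta R L pos ent id x M) ?map_id// big_cat /= !big_map -big_split /=.
  by by apply: eq_big_seq => p /prsP[-> -> _ _] /=; ring.
(* Each pair leaves two copies of the mean of its entries, and twice the square of a mean is at most
   the sum of the squares. *)
have nu' : nrm M u' <= nrm M h.
  rewrite /u' nrmD// nyr nyb nh -big_split /=; apply: ler_sum => p _.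
  rewrite -mulrDr ler_pM2l; last by rewrite addr_gt0.
  by have := sqr_ge0 (x p.1 - x p.2); rewrite /v; lra.
have u'0 s : 0 <= u' s.
  by rewrite addr_ge0// sumr_ge0// => p _; rewrite mulr_ge0// ler0n.
have evg0 s : 0 <= ev g s by rewrite divr_ge0 ?addr_ge0.
have z0 s : 0 <= ev g s + f s by rewrite addr_ge0.
(* Only the mass from [p.1] and its mirror image travels, and it travels outwards, so the potential
   rises everywhere. *)
have mono : bilin amat (fun s => ev g s + f s + ev h s) (fun s => ev g s + f s + ev h s) <=
    bilin amat (fun s => ev g s + f s + u' s) (fun s => ev g s + f s + u' s).
  apply: bilin_amat_mono => // [s|t]; first by rewrite divr_ge0 ?addr_ge0.
  rewrite (eq_bigr (fun s => amat t s * u s)); last by move=> s _; rewrite uE.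
  rewrite (eq_bigr (fun s =>
     amat t s * (\sum_(p <- prs) (x p.1 / 2) * delta p.1 s) +
     amat t s * (\sum_(p <- prs) (x p.1 / 2) * delta (rev_ord p.1) s) +
     (amat t s * (\sum_(p <- prs) (x p.2 / 2) * delta p.2 s) +
     amat t s * (\sum_(p <- prs) (x p.2 / 2) * delta (rev_ord p.2) s)))); last first.
    by move=> s _; rewrite /u; ring.
  rewrite [X in _ <= X](eq_bigr (fun s => amat t s * yb s + amat t s * yr s)); last first.
    by move=> s _; rewrite /u'; ring.
  rewrite !big_split /=.
  rewrite !(@amat_sum_delta R L _ prs (fun p : pos * pos => p.1)) !(@amat_sum_delta R L _ prs (fun p : pos * pos => p.2)).
  rewrite !(@amat_sum_delta R L _ prs (fun p : pos * pos => rev_ord p.1)) !(@amat_sum_delta R L _ prs (fun p : pos * pos => rev_ord p.2)).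
  rewrite -!big_split /= big_seq [X in _ <= X]big_seq; apply: ler_sum => p /prsP[o1 o2 _ d12'].
  have am := amat_outward R t o1 o2 d12'.
  have : 0 <= x p.1 / 2 * (amat t p.2 + amat t (rev_ord p.2) - (amat t p.1 + amat t (rev_ord p.1))).
    apply: mulr_ge0; first by rewrite divr_ge0.
    by rewrite subr_ge0; exact: am.
  by rewrite /v; lra.
pose y s := ev g s + f s + u' s.
(* The third vertex at each [p.1] goes to the free mirror image of [p.2]; this keeps the
   cardinality. *)
pose P' := [set s in P | s \notin unzip1 prs] :|: [set rev_ord s | s in unzip2 prs].
have evP' : contains_evens P'.
  move=> s os; rewrite !inE (evenP os) /=; apply/orP; left.
  by apply/negP => /mapP[p /prsP[o1 _ _ _] sp]; rewrite sp o1 in os.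
have cardP' : #|P'| = #|P|.
  rewrite cardsU (_ : _ :&: _ = set0) ?cards0 ?subn0; last first.
    apply/setP => s; rewrite !inE; apply/negP => /andP[/andP[sP _] /imsetP[r rB sr]].
    by have [_] := BP r rB; rewrite -sr sP.
  rewrite card_imset; last exact: rev_ord_inj.
  have -> : #|[in unzip2 prs]| = size (unzip1 prs).
    by rewrite (card_uniqP u2) !size_map.
  have <- : #|[set s in unzip1 prs]| = size (unzip1 prs).
    by rewrite cardsE (card_uniqP u1).
  rewrite -(cardsID [set s in unzip1 prs] P) addnC; congr (_ + _)%N.
    apply: eq_card => s; rewrite !inE.
    have [s1|] := boolP (s \in unzip1 prs); last by rewrite andbF.
    by rewrite subP// !mem_cat s1 !orbT.
  by apply: eq_card => s; rewrite !inE andbC.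
have gA s : g s != 0 -> s \in P'.
  move=> /gP[sP sn]; rewrite !inE sP /=; apply/orP; left.
  by apply: contra sn => s1; rewrite !mem_cat s1 orbT.
have suppy : supported P' y.
  move=> s sP'; have gs : g s = 0 by apply/eqP; apply: contraNT sP' => /gA.
  have gr : g (rev_ord s) = 0.
    by apply/eqP; apply: contraNT sP' => /g_rev; rewrite rev_ordK => /gA.
  have fs : f s = 0.
    rewrite /f /restrict; case: ifP => // sf; case/negP: sP'.
    rewrite !inE subP ?mem_cat ?sf//=; apply/orP; left.
    by have := fent s sf; rewrite mem_cat negb_or => /andP[].
  have ys : yb s = 0.
    apply: ybB; apply: contra sP' => sB; have [sP _] := BP s sB.
    rewrite !inE sP; apply/orP; left; apply: contra d12 => s1.
    by apply/hasP; exists s.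
  have yrs : yr s = 0.
    apply: yrB; apply: contra sP' => sB; rewrite inE; apply/orP; right.
    by rewrite -[s]rev_ordK imset_f.
  by rewrite /y /ev /u' gs gr fs ys yrs; ring.
have nz : nrm M (fun s => ev g s + f s) = nrm M (ev g) + nrm M f.
  apply: nrmD => s; have [sf|sf] := boolP (s \in fS); last first.
    by rewrite /f /restrict (negPf sf) mulr0.
  have gs : g s = 0 by rewrite /g mem_cat sf.
  have gr : g (rev_ord s) = 0.
    by apply/eqP/negPn/negP => /g_rev; rewrite rev_ordK gs eqxx.
  by rewrite /ev gs gr addr0 mul0r mul0r.
have zu' s : (ev g s + f s) * u' s = 0.
  have [sB|/ybB ys] := boolP (s \in unzip2 prs).
    have [sP rP] := BP s sB.
    have gs : g s = 0 by rewrite /g !mem_cat sB !orbT.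
    have gr : g (rev_ord s) = 0 by apply/eqP/negPn/negP => /gP[]; rewrite (negPf rP).
    have fs : f s = 0.
      rewrite /f /restrict; case: ifP => // sf.
      by have := fent s sf; rewrite mem_cat sB orbT.
    by rewrite /ev gs gr fs; ring.
  have [sB|/yrB yrs] := boolP (rev_ord s \in unzip2 prs); last by rewrite /u' ys yrs addr0 mulr0.
  have [sP rP] := BP _ sB; rewrite rev_ordK in rP.
  have gs : g s = 0 by apply/eqP/negPn/negP => /gP[]; rewrite (negPf rP).
  have gr : g (rev_ord s) = 0 by rewrite /g !mem_cat sB !orbT.
  have fs : f s = 0.
    rewrite /f /restrict; case: ifP => // sf.
    by case/negP: rP; apply: subP; rewrite mem_cat sf.
  by rewrite /ev gs gr fs; ring.
have opty := opt evP' cardP' suppy.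
have ny : nrm M y = nrm M (ev g) + nrm M f + nrm M u' by rewrite /y nrmD// nz.
have nx : nrm M x = nrm M g + (nrm M h + nrm M f).
  have -> : nrm M x = nrm M (fun s => g s + (h s + f s)).
    by apply: eq_bigr => s _; rewrite xE.
  by rewrite nrmD// nrmD.
have Bx : bilin amat x x = nrm M x := bilin_x.
pose xo := od x; pose ho := od (fun s => h s + f s).
have odD (a b : pos -> R) s : od (fun s => a s + b s) s = od a s + od b s.
  by rewrite /od; ring.
have xoE s : xo s = od g s + ho s by rewrite /xo /ho -odD /od !xE.
(* Removing the odd parts of [g] and [h] costs the form on the odd part [xo] of the whole vector,
   except for the odd part of [f], which stays in place. Even and odd parts are orthogonal for the
   form. *)
have gain : bilin amat (fun s => ev g s + f s + ev h s) (fun s => ev g s + f s + ev h s) =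
    bilin amat x x - bilin amat xo xo + bilin amat (od f) (od f).
  pose re s := ev g s + ev h s; pose ro s := od g s + od h s.
  have xr s : x s = re s + f s + ro s.
    rewrite xE (evod g) (evod h) /re /ro; ring.
  have E1 s : ev g s + f s + ev h s = re s + f s by rewrite /re; ring.
  rewrite (eq_bilin _ E1 E1) (eq_bilin _ xr xr) (bilin_sqrD (fun s => re s + f s) ro (@amatC R L)).
  have xo2 s : xo s = ro s + od f s by rewrite xoE /ho /ro odD addrA.
  rewrite (eq_bilin _ xo2 xo2) (bilin_sqrD ro (od f) (@amatC R L)).
  rewrite [bilin amat (fun s => re s + f s) ro]bilinDl.
  have roE s : ro s = od (fun s => g s + h s) s by rewrite odD.
  have reE s : re s = ev (fun s => g s + h s) s by rewrite /re /ev; ring.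
  have -> : bilin amat re ro = 0 by rewrite (eq_bilin _ reE roE) bilin_ev_od.
  have -> : bilin amat f ro = bilin amat ro (od f).
    rewrite [LHS](eq_bilin _ (fun s => erefl (f s)) roE) -bilin_od.
    by rewrite (bilinC _ _ (@amatC R L)); apply: eq_bilin => // s; rewrite roE.
  by ring.
have ng : nrm M g = nrm M (ev g) + nrm M (od g) := nrm_evod M g.
(* The absolute value of [od g] is supported in [P] itself, since the support of [g] is symmetric,
   so optimality bounds its form. *)
have optg : - bilin amat (od g) (od g) <= nrm M (od g).
  rewrite -nrm_norm; apply: le_trans (opt (P' := P) _ _ _) => //; last first.
    move=> s sP; rewrite /od.
    have gs : g s = 0 by apply/eqP/negPn/negP => /gP[]; rewrite (negPf sP).
    have gr : g (rev_ord s) = 0.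
      by apply/eqP/negPn/negP => /g_rev; rewrite rev_ordK gs eqxx.
    by rewrite gs gr subr0 mul0r normr0.
  by apply: le_trans (bilin_norm _ (@amat_ge0 R L)); rewrite -normrN ler_norm.
(* This is the parallelogram identity, with difference [ho] and sum [od g + xo]. The form on the sum
   is nonpositive by negative type, and the factor one half becomes the 2 of the conclusion. *)
have par : bilin amat xo xo + bilin amat (od g) (od g) =
    2^-1 * (bilin amat ho ho + bilin amat (fun s => od g s + xo s) (fun s => od g s + xo s)).
  have hoE s : ho s = xo s + (-1) * od g s by rewrite xoE; ring.
  rewrite (eq_bilin _ hoE hoE) !(bilin_sqrD _ _ (@amatC R L)) bilinZr bilinZl bilinZr.
  by rewrite (bilinC (od g) xo (@amatC R L)); field.
have neg : bilin amat (fun s => od g s + xo s) (fun s => od g s + xo s) <= 0.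
  by apply: bilin_amat_le0; rewrite big_split /= !sum_od addr0.
have hfE s : restrict (ent ++ fS) s = h s + f s.
  rewrite /restrict mem_cat /h /f /restrict; have := @fent s.
  case: (s \in fS) => [/(_ isT)/negPf ->|_]; first by rewrite add0r.
  by rewrite orbF addr0.
rewrite (eq_bilin _ hfE hfE) !bilin_kmat -/ho -/f.
have := mono; rewrite gain => mono'.
by lra.
Qed.

Definition op (i : nat) : pos := inord (2 * i).+1.

Lemma val_op (i : nat) : (i < L)%N -> op i = (2 * i).+1 :> nat.
Proof. by move=> iL; rewrite /op inordK// ltnS ltn_mul2l. Qed.

Lemma op_inj (i j : nat) : (i < L)%N -> (j < L)%N -> op i = op j -> i = j.
Proof.
move=> iL jL /(congr1 val) /=; rewrite !val_op//; clear; lia.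
Qed.

Lemma rev_op (i : nat) : (i < L)%N -> rev_ord (op i) = op (L - i.+1).
Proof.
move=> iL; apply/val_inj; rewrite /= !val_op//; [|by move: iL; clear; lia].
by move: iL; clear; lia.
Qed.

Lemma odd_op (i : nat) : (i < L)%N -> odd (op i).
Proof. by move=> iL; rewrite val_op//=; clear; lia. Qed.

Lemma opP s : odd s -> exists2 i, (i < L)%N & s = op i.
Proof.
move=> os; have sL := ltn_ord s; have iL : (s./2 < L)%N by move: os sL; clear; lia.
by exists s./2 => //; apply/val_inj; rewrite /= val_op//; move: os; clear; lia.
Qed.

Variables (a m b : nat).
Hypotheses (LE : L = (a + m + b)%N) (m_gt0 : (0 < m)%N) (ab : (a.+2 <= b)%N).
(** [p i] says that edge [i] carries a third vertex: [m] free edges lie between end segments of [a]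
    and [b] triangles. *)
Let p (i : nat) := (i < a)%N || (a + m <= i)%N.
Hypothesis shapeP : forall i : nat, (i < L)%N -> (op i \in P) = p i.

(** Neighbouring blocks are paired: the inner third vertex is to go to the mirror image of the outer
    one. *)
Let consec (i0 g : nat) := [seq ((i0 + 2 * d)%N, (i0 + 2 * d).+1) | d <- iota 0 g].

Lemma consec_perm i0 g :
  perm_eq (unzip1 (consec i0 g) ++ unzip2 (consec i0 g)) (iota i0 (2 * g)).
Proof.
elim: g => [|g IH]; first by [].
have -> : iota i0 (2 * g.+1) = iota i0 (2 * g) ++ [:: i0 + 2 * g; (i0 + 2 * g).+1]%N.
  by rewrite (_ : 2 * g.+1 = 2 * g + 2)%N ?iotaD//; clear; lia.
have E : iota 0 g.+1 = iota 0 g ++ [:: g] by rewrite -addn1 iotaD.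
rewrite /consec E map_cat /unzip1 /unzip2 !map_cat /=.
apply: (perm_trans _ (perm_cat IH (perm_refl _))); apply/permP => f.
by rewrite /unzip1 /unzip2 /consec !count_cat /=; clear; lia.
Qed.

(* [qb] is the block nearest to the centre that is used; in the third
   alternative for [F] it is the right one of the two central blocks. *)
Lemma unbalanced_core (F : seq nat) (sp : seq (nat * nat)) (i0 g qb : nat) :
  let T i := [|| i \in F, i \in unzip1 sp, i \in unzip2 sp | (i0 <= i < b + m)%N] in
  (i0 + 2 * g = b + m)%N -> (a + m <= i0)%N -> (b <= i0)%N ->
  uniq (F ++ unzip1 sp ++ unzip2 sp) ->
  (forall i, i \in F ++ unzip1 sp ++ unzip2 sp -> [/\ (i < L)%N, p i & ~~ (i0 <= i < b + m)%N]) ->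
  (forall i j, (i, j) \in sp -> ~~ p (L - j.+1)%N /\
     (ndist (2 * i).+1 L <= ndist (2 * j).+1 L)%N) ->
  (forall i, (i < L)%N -> p i -> ~~ T i -> p (L - i.+1)%N && ~~ T (L - i.+1)%N) ->
  (L <= (2 * qb).+1)%N -> (qb.+1 < b + m)%N -> p qb -> T (b + m)%N.-1 ->
  (forall i, T i -> (qb <= i)%N \/ i = (L - qb.+1)%N) ->
  F = [::] \/ F = [:: qb] /\ (((2 * qb).+1 = L)%N \/ ~~ T (L - qb.+1)%N \/ (2 * qb = L)%N) ->
  False.
Proof.
move=> T i0g ai0 bi0 uF HF Hsp Hsym Lq qbm pq Tr Hq HFq.
pose prsn := sp ++ consec i0 g.
pose prs := [seq (op ij.1, op ij.2) | ij <- prsn].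
pose entn := unzip1 prsn ++ unzip2 prsn.
have entE : unzip1 prs ++ unzip2 prs = map op entn.
  by rewrite /entn /unzip1 /unzip2 map_cat -!map_comp.
have pent : perm_eq entn ((unzip1 sp ++ unzip2 sp) ++ iota i0 (2 * g)).
  rewrite /entn /prsn /unzip1 /unzip2 !map_cat.
  apply: (perm_trans _ (perm_cat (perm_refl _) (consec_perm i0 g))).
  by apply/permP => f; rewrite /unzip1 /unzip2 !count_cat; clear; lia.
have TE i : (i \in F ++ entn) = T i.
  rewrite mem_cat (perm_mem pent) !mem_cat mem_iota i0g /T.
  by rewrite -!orbA.
have TL i : T i -> (i < L)%N /\ p i.
  move=> Ti; case: (boolP (i \in F ++ unzip1 sp ++ unzip2 sp)) => [/HF[]//|].
  move=> nin; have /andP[h1 h2] : (i0 <= i < b + m)%N.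
    by case/or4P: Ti nin => // h; rewrite !mem_cat h ?orbT.
  by rewrite /p; move: h1 h2 ai0 m_gt0 ab; rewrite LE; clear; lia.
have uall : uniq (F ++ entn).
  have -> : uniq (F ++ entn) = uniq ((F ++ unzip1 sp ++ unzip2 sp) ++ iota i0 (2 * g)).
    by apply: perm_uniq; rewrite -!catA perm_cat2l catA.
  rewrite cat_uniq uF iota_uniq andbT /=; apply/hasPn => i; rewrite mem_iota i0g => ii.
  by apply/negP => /HF[_ _]; rewrite ii.
pose fS := map op F.
have mapE : fS ++ (unzip1 prs ++ unzip2 prs) = map op (F ++ entn) by rewrite entE map_cat.
have inT s : reflect (exists2 i, T i & s = op i) (s \in fS ++ (unzip1 prs ++ unzip2 prs)).
  rewrite mapE; apply: (iffP mapP) => -[i]; first by rewrite TE; exists i.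
  by rewrite -TE; exists i.
have opT i : (i < L)%N -> (op i \in fS ++ (unzip1 prs ++ unzip2 prs)) = T i.
  move=> iL; apply/inT/idP => [[j Tj e]|Ti]; last by exists i.
  by rewrite (op_inj iL _ e)//; case: (TL j Tj).
have LgtR : ((b + m).-1 < L)%N by rewrite LE; move: m_gt0 ab; clear; lia.
have E1 : uniq (fS ++ (unzip1 prs ++ unzip2 prs)).
  rewrite mapE map_inj_in_uniq// => i j; rewrite !TE => /TL[iL _] /TL[jL _].
  exact: op_inj.
have E2 : {subset fS ++ (unzip1 prs ++ unzip2 prs) <= P}.
  by move=> s /inT[i /TL[iL pi] ->]; rewrite shapeP.
have E3 : forall ij, ij \in prs -> [/\ odd ij.1, odd ij.2, rev_ord ij.2 \notin P &
     (ndist ij.1 L <= ndist ij.2 L)%N].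
  move=> _ /mapP[[i j] ijp ->] /=.
  have [Ti Tj] : T i /\ T j.
    rewrite -!TE !mem_cat; split.
      by rewrite (_ : i \in unzip1 prsn) ?orbT//; apply/mapP; exists (i, j).
    by rewrite (_ : j \in unzip2 prsn) ?orbT//; apply/mapP; exists (i, j).
  have [iL _] := TL i Ti; have [jL _] := TL j Tj.
  have rjL : (L - j.+1 < L)%N by move: jL; clear; lia.
  rewrite !odd_op// rev_op// shapeP// !val_op//.
  move: ijp; rewrite /prsn mem_cat => /orP[/Hsp[h1 h2]|]; first by split.
  move=> /mapP[t]; rewrite mem_iota add0n => /andP[_ tg] [ie je].
  rewrite /p /ndist ie je; split => //; move: i0g tg ai0 bi0; rewrite LE; clear; lia.
have E4 : forall s, s \in P -> s \notin fS ++ (unzip1 prs ++ unzip2 prs) ->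
     rev_ord s \in P /\ rev_ord s \notin fS ++ (unzip1 prs ++ unzip2 prs).
  move=> s sP sn; have [os|es] := boolP (odd s); last first.
    have er : ~~ odd (rev_ord s) by rewrite odd_rev.
    split; first exact: evenP.
    by apply/negP => /inT[i /TL[iL _] e]; rewrite e odd_op in er.
  have [i iL e] := opP os; move: sP sn; rewrite e shapeP// opT// => pi nTi.
  have /andP[h1 h2] := Hsym i iL pi nTi.
  have rjL : (L - i.+1 < L)%N by move: iL; clear; lia.
  by rewrite rev_op// shapeP// opT.
have K := symmetrization E1 E2 E3 E4.
pose q := op qb; pose r := op (b + m)%N.-1.
have qL : (qb < L)%N by rewrite LE; move: qbm; clear; lia.
have vq : q = (2 * qb).+1 :> nat by exact: val_op.
have vr : r = (2 * (b + m)%N.-1).+1 :> nat by exact: val_op.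
have qr : (q < r)%N by rewrite vq vr; move: qbm; clear; lia.
pose y := restrict ((unzip1 prs ++ unzip2 prs) ++ fS).
have yE s : y s = if s \in fS ++ (unzip1 prs ++ unzip2 prs) then x s else 0.
  by rewrite /y /restrict mem_cat orbC -mem_cat.
have y0 s : 0 <= y s by rewrite yE; case: ifP => // _; exact: x_ge0.
have suppy s : y s != 0 -> (q <= s)%N \/ s = rev_ord q.
  rewrite yE; case: ifP; last by rewrite eqxx.
  move=> /inT[i Ti ->] _; have [iL _] := TL i Ti.
  case: (Hq i Ti) => [qi|->]; last by right; rewrite /q rev_op.
  by left; rewrite vq val_op// ltnS leq_mul2l.
have low := kmat_lower y0 _ qr suppy.
have {}low := low (_ : (L <= q)%N); rewrite vq in low; have {}low := low Lq.
have rT : T (b + m)%N.-1 := Tr.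
have [rL pr] := TL _ rT.
have xr : 0 < x r by rewrite x_gt0// /r shapeP.
have yr : y r = x r by rewrite yE /r opT// rT.
(* Distinct odd positions are at least two apart, which gives the constant 4 in [low2]. *)
have rq1 : (2 <= r - (2 * qb).+1)%N by rewrite vr; move: qbm; clear; lia.
have rq2 : 2 <= (r - (2 * qb).+1)%:R :> R by rewrite ler_nat.
have xr2 : 0 < x r ^+ 2 by rewrite exprn_gt0.
rewrite yr in low.
have low2 : 4 * x r ^+ 2 <= 2 * (r - (2 * qb).+1)%:R * x r ^+ 2.
  by rewrite ler_pM2r//; lra.
set S := \sum_(s | _) _ + _ in low.
have c0 : 0 <= ((2 * qb).+1 - L)%:R :> R by rewrite ler0n.
have S2 : 0 <= S ^+ 2 := sqr_ge0 S.
have fin Xq h1 := @fold_absurd R _ _ _ _ Xq _ h1 low low2 xr2 c0 S2.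
case: HFq => [F0|[F1 cases]].
  move: K; rewrite -/y /fS F0 /= => K.
  have K0 : bilin kmat (restrict [::]) (restrict [::]) = 0.
    by apply: big1 => s _; apply: big1 => t _; rewrite /restrict !in_nil mulr0.
  rewrite K0 mulr0 in K; apply: (fin 0) => //; first by rewrite !mulr0.
  by apply: Or32; rewrite mulr0.
have fq s : restrict fS s = x q * delta q s.
  rewrite /restrict /fS F1 /= inE /delta -/q.
  by case: eqP => [->|_]; rewrite ?mulr1 ?mulr0.
have Kf : bilin kmat (restrict fS) (restrict fS) = 2 * ((2 * qb).+1 - L)%:R * x q ^+ 2.
  rewrite (eq_bilin _ fq fq) bilinZl bilinZr bilin_delta kmatE ?vq// minnn; ring.
rewrite -/y Kf in K.
apply: (fin _ K (sqr_ge0 _)).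
have qP : q \in P by rewrite shapeP.
have xq : 0 < x q by rewrite x_gt0.
have [qc|qc] := eqVneq (2 * qb)%N.+1 L.
  by apply: Or31; rewrite -qc subnn.
(* The outermost block used is mirrored to the first free edge. As [q] lies right of the centre,
   that place is farther from [q] than [r] is, so [outer_larger] applies. *)
have raP : rev_ord r \notin P.
  rewrite rev_op// shapeP; last by move: LgtR; clear; lia.
  by rewrite /p LE; move: m_gt0 ab; clear; lia.
have xqr : x q < x r.
  apply: (outer_larger (i := rev_ord r)) => //.
  - by rewrite /= vq vr; move: qbm qc Lq; rewrite LE; clear; lia.
  - by rewrite /= vq vr; move: qbm qc Lq; rewrite LE; clear; lia.
  - exact: odd_op.
  - exact: odd_op.
  - by rewrite /r shapeP.
case: cases => [/eqP|[nT|qc2]]; first by rewrite (negPf qc).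
  apply: Or32.
  (* Nothing is subtracted at [q] when folding, so the folded mass is at least [x r + x q], hence at
     least [2 * x q]. *)
  have revq : y (rev_ord q) = 0.
    rewrite yE /q rev_op// opT; last by move: qL; clear; lia.
    by rewrite (negPf nT).
  have yq : y q = x q.
    by rewrite yE mem_cat /fS F1 /= inE eqxx.
  have Sge : x r + x q <= S.
    rewrite /S revq yq subr0 lerD2r (bigD1 r)//=; last by rewrite -vq.
    by rewrite yr lerDl; apply: sumr_ge0.
  have -> : 4 * x q ^+ 2 = (2 * x q) ^+ 2 by ring.
  have le2 : 2 * x q <= S by apply: le_trans Sge; rewrite mulr_natl mulr2n lerD2r ltW.
  have q20 : 0 <= 2 * x q by rewrite mulr_ge0// ltW.
  by rewrite ler_pXn2r// nnegrE// (le_trans q20).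
apply: Or33; split; first by rewrite -qc2 subSnn.
by rewrite ltr_pXn2r// ?nnegrE ltW.
Qed.

Ltac block_lia :=
  clear; intros;
  repeat match goal with H : is_true _ |- _ => rewrite !inE ?xpair_eqE /= in H end;
  rewrite ?inE /ndist /=; try split; intros; lia.

(** The triangles on the right with a free mirror image are [[a + m, b + m)] if [b - a <= m], and
    [[b, b + m)] otherwise. They are paired consecutively. If their number is odd, then in the first
    case the innermost stays in place as [F]; in the second, [b] is paired with a central block, and
    of two central blocks the right one stays as [F]. For [b - a] odd and [m] even and smaller, the
    single central block is put in [F], where it contributes nothing, being its own mirror image. *)
Lemma unbalanced_absurd : False.
Proof.
have [cm|mc] := leqP (b - a)%N m.
  have [oc|ec] := boolP (odd (b - a)%N).
    apply: (@unbalanced_core [:: (a + m)%N] [::] (a + m).+1 (b - a)./2 (a + m)) => //=.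
    all: rewrite /p; try (by move: LE m_gt0 ab cm oc; block_lia).
    right; split => //; right; left; rewrite inE.
    by move: LE m_gt0 ab cm oc; clear; lia.
  apply: (@unbalanced_core [::] [::] (a + m)%N (b - a)./2 (a + m)) => //=.
  all: rewrite /p; try (by move: LE m_gt0 ab cm ec; block_lia).
  by left.
have [oc|ec] := boolP (odd (b - a)%N); have [om|em] := boolP (odd m).
- apply: (@unbalanced_core [:: L./2] [:: (L./2.-1, b)] b.+1 m./2 L./2) => //=.
  all: rewrite /p; try (by move: LE m_gt0 ab mc oc om; block_lia).
  right; split => //; right; right.
  by move: LE m_gt0 ab mc oc om; clear; lia.
- apply: (@unbalanced_core [:: L./2] [::] b m./2 L./2) => //=.
  all: rewrite /p; try (by move: LE m_gt0 ab mc oc em; block_lia).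
  right; split => //; left.
  by move: LE m_gt0 ab mc oc em; clear; lia.
- apply: (@unbalanced_core [::] [:: (L./2, b)] b.+1 m./2 L./2) => //=.
  all: rewrite /p; try (by move: LE m_gt0 ab mc ec om; block_lia).
  by left.
- apply: (@unbalanced_core [::] [::] b m./2 b) => //=.
  all: rewrite /p; try (by move: LE m_gt0 ab mc ec em; block_lia).
  by left.
Qed.

End Optimal.

(** * Optimal position sets are balanced *)

Section Patterns.
Variables (R : realType) (L : nat).
Local Notation pos := 'I_(2 * L).+1.
Local Notation amat := (@amat R L).
Implicit Types (P : {set pos}) (s t : pos) (y x : pos -> R).

Definition pmat s t : R := (pdist s t)%:R.

(** Restricting the vectors instead of the matrix keeps all sets [P] on one index type. *)
Definition rayleigh_bound P (r : R) : Prop :=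
  forall y, supported P y -> bilin pmat y y <= r * sqnorm y.

Definition perron_pair P (r : R) x : Prop := [/\ 0 < r, rayleigh_bound P r,
  forall s, s \in P -> \sum_t pmat s t * x t = r * x s,
  forall s, s \in P -> 0 < x s & supported P x].

Lemma pdist_gt0 s t : s != t -> (0 < pdist s t)%N.
Proof.
move=> st; have st' : (s == t :> nat) = false by apply: negbTE st.
by rewrite /pdist st'; move: st'; clear; lia.
Qed.

Lemma pattern_perron P : (1 < #|P|)%N -> exists r x, perron_pair P r x.
Proof.
move=> P1; pose B s t : R := if (s \in P) && (t \in P) then pmat s t else 0.
have [||s t sP tP st||//|r [x [r0 maxB eigx x0 xP]]] := @perron R _ B P.
- by move=> s t; rewrite /B andbC /pmat pdistC.
- by move=> s t; rewrite /B; case: ifP => // _; rewrite ler0n.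
- by rewrite /B sP tP ltr0n pdist_gt0.
- by move=> s t sP; rewrite /B (negPf sP).
exists r, x; split => // [y yP|s sP].
  apply: le_trans (maxB y); rewrite le_eqVlt; apply/orP; left; apply/eqP.
  apply: eq_bigr => s _; apply: eq_bigr => t _; rewrite /B.
  have [sP|/yP ->] := boolP (s \in P); last by rewrite !mulr0 !mul0r.
  by have [tP|/yP ->] := boolP (t \in P); rewrite ?mulr0.
rewrite -eigx; apply: eq_bigr => t _; rewrite /B sP /=.
by have [tP|/xP ->] := boolP (t \in P); rewrite ?mulr0.
Qed.

Lemma sum_positional n (ps : 'I_n -> pos) (F : pos -> R) : injective ps ->
  supported [set ps u | u : 'I_n] F -> \sum_u F (ps u) = \sum_s F s.
Proof.
move=> inj FP; rewrite (bigID (mem [set ps u | u : 'I_n]))/= [X in _ = _ + X]big1 => [|s /FP//].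
by rewrite addr0 big_imset//= => u v _ _; exact: inj.
Qed.

Lemma positional_rayleigh n (ps : 'I_n -> pos) (E : {set {set 'I_n}}) r (y : 'I_n -> R) :
  positional ps E -> rayleigh_bound [set ps u | u : 'I_n] r ->
  bilin (fun u v => (dist E u v)%:R) y y <= r * sqnorm y.
Proof.
move=> posE maxP; have [inj _ _] := posE.
pose z s := \sum_(u | ps u == s) y u.
have zps u : z (ps u) = y u.
  rewrite /z (bigD1 u)//= big1 ?addr0// => v /andP[/eqP/inj -> ].
  by rewrite eqxx.
have zP : supported [set ps u | u : 'I_n] z.
  move=> s sP; rewrite /z big1// => u /eqP us; case/negP: sP.
  by rewrite -us imset_f.
have := maxP z zP; rewrite /sqnorm -(sum_positional inj); last first.
  by move=> s /zP ->; rewrite expr0n.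
rewrite (eq_bigr (fun u => y u ^+ 2)); last by move=> u _; rewrite zps.
apply: le_trans; rewrite /bilin -(sum_positional inj); last first.
  by move=> s /zP ->; rewrite big1// => t _; rewrite mulr0 mul0r.
rewrite le_eqVlt; apply/orP; left; apply/eqP; apply: eq_bigr => u _.
rewrite -(sum_positional inj); last by move=> s /zP ->; rewrite mulr0.
by apply: eq_bigr => v _; rewrite (dist_positional _ _ posE) !zps.
Qed.

Lemma positional_eigenvalue n (ps : 'I_n -> pos) (E : {set {set 'I_n}}) r x :
  (0 < n)%N -> positional ps E -> perron_pair [set ps u | u : 'I_n] r x ->
  largest_eigenvalue (dist_matrix R E) r.
Proof.
move=> n0 posE [r0 maxP eigx x0 xP]; have [inj _ _] := posE.
have DE u v : dist_matrix R E u v = (dist E u v)%:R by rewrite mxE.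
apply: (@largest_eigenvalueP R n _ r (fun u => x (ps u))).
- by move=> u v; rewrite !DE !(dist_positional _ _ posE) pdistC.
- move=> y; apply: le_trans (positional_rayleigh y posE maxP).
  rewrite le_eqVlt; apply/orP; left; apply/eqP.
  by apply: eq_bigr => u _; apply: eq_bigr => v _; rewrite DE.
- move=> u; rewrite -eigx ?imset_f// -(sum_positional inj); last first.
    by move=> s /xP ->; rewrite mulr0.
  by apply: eq_bigr => v _; rewrite DE (dist_positional _ _ posE).
- by exists (Ordinal n0); rewrite gt_eqF// x0// imset_f.
Qed.

Definition optimal P (r : R) x : Prop := [/\ contains_evens P, perron_pair P r x &
  forall P', contains_evens P' -> #|P'| = #|P| -> rayleigh_bound P' r].

Lemma optimal_amat P r x : optimal P r x ->
  (forall s, s \in P -> \sum_t amat s t * x t = (r + (odd s)%:R) * x s) /\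
  (forall (P' : {set pos}) y, contains_evens P' -> #|P'| = #|P| ->
     supported P' y -> bilin amat y y <= nrm r y).
Proof.
move=> [evP [r0 _ eigx x0 xP] optP]; split=> [s sP|P' y evP' cP' yP'].
  rewrite mulrDl -eigx//.
  rewrite [X in _ = X + _](eq_bigr (fun t => amat s t * x t - delta R s t * ((odd s)%:R * x t))).
    by rewrite sumrB sum_delta subrK.
  by move=> t _; rewrite /pmat pdist_amat /delta eq_sym; ring.
have := optP P' evP' cP' y yP'; rewrite bilin_pdist nrmE; lra.
Qed.

Lemma optimal_rev P r x : optimal P r x ->
  optimal [set s | rev_ord s \in P] r (fun s => x (rev_ord s)).
Proof.
move=> [evP [r0 ray eigx x0 xP] optP].
have card_rev (Q : {set pos}) : #|[set s | rev_ord s \in Q]| = #|Q|.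
  rewrite -(card_imset Q rev_ord_inj); apply: eq_card => s; rewrite inE.
  apply/idP/imsetP => [sQ|[t tQ ->]]; last by rewrite rev_ordK.
  by exists (rev_ord s); rewrite ?rev_ordK.
have ev' : contains_evens [set s | rev_ord s \in P].
  by move=> s es; rewrite inE evP// odd_rev.
split => //; last by move=> P' evP' cP'; apply: optP; rewrite // cP' card_rev.
split => //.
- by apply: optP => //; rewrite card_rev.
- move=> s; rewrite inE => sP; rewrite -eigx//.
  rewrite [RHS](reindex_inj rev_ord_inj); apply: eq_bigr => t _ /=.
  by rewrite /pmat !pdist_amat amat_rev odd_rev (inj_eq rev_ord_inj).
- by move=> s; rewrite inE => sP; exact: x0.
- by move=> s; rewrite inE => sP; exact: xP.
Qed.

Lemma interval_shape N (q : nat -> bool) :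
  (forall i j l, (i < j < l)%N -> (l < N)%N -> q i -> q l -> q j) ->
  exists a m b, N = (a + m + b)%N /\ forall i, (i < N)%N -> q i = (a <= i < a + m)%N.
Proof.
elim: N => [|N IH] H; first by exists 0%N, 0%N, 0%N.
have [i j l ijl lN|a [m [b [NE E]]]] := IH; first by apply: H => //; exact: ltnW.
have [qN|qN] := boolP (q N); last first.
  exists a, m, b.+1; split; first by rewrite addnS NE.
  move=> i; rewrite ltnS leq_eqVlt => /orP[/eqP ->|]; last exact: E.
  by rewrite (negPf qN); move: NE; clear; lia.
have [m0|m0] := posnP m.
  exists N, 1%N, 0%N; split; first by rewrite addn1 addn0.
  move=> i; rewrite ltnS leq_eqVlt => /orP[/eqP ->|iN]; first by rewrite qN; clear; lia.
  by rewrite E//; move: m0 iN; clear; lia.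
have qa : q a by rewrite E; move: m0 NE; clear; lia.
have aN : (a < N)%N by move: m0 NE; clear; lia.
exists a, (N.+1 - a)%N, 0%N; split; first by move: aN; clear; lia.
move=> i iN; have [ai|ia] /= := leqP a i; last first.
  by rewrite E; move: ia aN; clear; lia.
have -> : (i < a + (N.+1 - a))%N by move: ai iN; clear; lia.
have [->//|ne1] := eqVneq i a; have [->//|ne2] := eqVneq i N.
apply: (H a i N) => //; move: ai iN ne1 ne2; clear; lia.
Qed.

Lemma card_op_gap P a m b : contains_evens P -> L = (a + m + b)%N ->
  (forall i, (i < L)%N -> (op L i \in P) = (i < a)%N || (a + m <= i)%N) ->
  (#|P| + m = (2 * L).+1)%N.
Proof.
move=> evP LE shape.
have lt (i : 'I_m) : (a + i < L)%N by have := ltn_ord i; move: LE; clear; lia.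
have inj : injective (fun i : 'I_m => op L (a + i)).
  by move=> i j /op_inj e; apply/val_inj/eqP; rewrite -(eqn_add2l a); apply/eqP/e.
rewrite -[RHS]card_ord -(cardsC P); congr (_ + _)%N.
rewrite -[LHS]card_ord -(card_imset _ inj); apply: eq_card => s; rewrite inE.
apply/imsetP/idP => [[i _ ->]|sP].
  by rewrite shape//; have := ltn_ord i; clear; lia.
have [|i iL sE] := @opP L s; first by apply: contraNT sP; exact: evP.
move: sP; rewrite sE shape// negb_or -leqNgt -ltnNge => /andP[ai im].
have im' : (i - a < m)%N by move: ai im; clear; lia.
by exists (Ordinal im') => //=; rewrite subnKC.
Qed.

Lemma gap_pattern P a m b : contains_evens P -> L = (a + m + b)%N ->
  (forall i, (i < L)%N -> (op L i \in P) = (i < a)%N || (a + m <= i)%N) ->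
  P = pattern L a b.
Proof.
move=> evP LE shape; apply/setP => s; rewrite inE.
have [os|/evP -> //] := boolP (odd s).
have [i iL ->] := opP os; rewrite shape// val_op//=.
by move: iL LE; clear; lia.
Qed.

Lemma pattern_rev a b : (a + b <= L)%N ->
  [set s | rev_ord s \in pattern L a b] = pattern L b a.
Proof.
move=> abL; apply/setP => s; rewrite !inE odd_rev.
have [os|//] := boolP (odd s); have [i iL ->] := opP os.
rewrite rev_op// !val_op//=; last by move: iL; clear; lia.
by move: iL abL; clear; lia.
Qed.

Lemma optimal_gap P r x a m b : optimal P r x -> L = (a + m + b)%N -> (0 < m)%N ->
  (forall i, (i < L)%N -> (op L i \in P) = (i < a)%N || (a + m <= i)%N) -> (b <= a.+1)%N.
Proof.
move=> optP LE m0 shape; have [evP [r0 _ _ x0 xP] _] := optP.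
have [eigx optA] := optimal_amat optP.
rewrite leqNgt; apply/negP => ab.
exact: (unbalanced_absurd r0 evP x0 xP eigx optA LE m0 ab shape).
Qed.

(** The free edges form an interval, and [optimal_gap], applied to [P] and to its mirror image,
    bounds the difference of the two end segments by one. The mirror image appears because either
    segment may be the longer one. *)
Lemma optimal_pattern P r x k : optimal P r x -> #|P| = (L.+1 + k)%N ->
  P = pattern L k./2 (k - k./2) \/ P = [set s | rev_ord s \in pattern L k./2 (k - k./2)].
Proof.
move=> optP cP; have [evP [r0 _ _ x0 xP] _] := optP.
have [eigx optA] := optimal_amat optP.
have [|a [m [b [LE shape]]]] := @interval_shape L (fun i => op L i \notin P).
  move=> i j l ijl lL qi ql; have [ij jl] := andP ijl; have jL := ltn_trans jl lL.
  apply: (gap_convex evP x0 xP eigx optA (i := op L i) (k := op L l)) => //.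
    by rewrite !val_op//; move: ijl lL; clear; lia.
  exact: odd_op.
have {}shape i : (i < L)%N -> (op L i \in P) = (i < a)%N || (a + m <= i)%N.
  by move=> iL; rewrite -[LHS]negbK shape// negb_and -ltnNge -leqNgt.
have cab : (a + b = k)%N.
  by have := card_op_gap evP LE shape; rewrite cP LE; clear; lia.
have [m0|m0] := posnP m.
  (* Without free edges [k = L] and every position is occupied, so the interval may be placed
     anywhere. *)
  left; apply: (gap_pattern (m := 0) evP); first by move: LE cab; rewrite m0; clear; lia.
  by move=> i iL; rewrite shape// m0; clear; lia.
have ba := optimal_gap optP LE m0 shape.
have ab : (a <= b.+1)%N.
  apply: (optimal_gap (optimal_rev optP) (m := m)) => //.
    by rewrite LE; clear; lia.
  move=> i iL; rewrite inE rev_op// shape; last by move: iL; clear; lia.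
  by move: LE iL; clear; lia.
have PE := gap_pattern evP LE shape.
have [lab|lba] := leqP a b; [left|right]; rewrite ?pattern_rev ?PE.
- by congr (pattern _ _ _); move: cab lab ba; clear; lia.
- by congr (pattern _ _ _); move: cab lba ab; clear; lia.
- by move: LE cab; clear; lia.
Qed.

End Patterns.

(** * Comparison of spectral radii *)

Section Comparison.
Variable R : realType.

Lemma optimal_exists L (P1 : {set 'I_(2 * L).+1}) : contains_evens P1 -> (1 < #|P1|)%N ->
  exists (P : {set 'I_(2 * L).+1}) (r : R) x, optimal P r x /\ #|P| = #|P1|.
Proof.
move=> ev1 gt1.
have evE (P : {set 'I_(2 * L).+1}) :
    reflect (contains_evens P) ([set s : 'I_(2 * L).+1 | ~~ odd s] \subset P).
  by apply: (iffP subsetP) => H s es; apply: H; rewrite ?inE// in es *.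
have [rho rhoP] : exists rho : {set 'I_(2 * L).+1} -> R,
    forall P : {set 'I_(2 * L).+1}, (1 < #|P|)%N ->
    exists x, perron_pair P (rho P) x.
  suff : forall P : {set 'I_(2 * L).+1}, exists r : R,
      (1 < #|P|)%N -> exists x, perron_pair P r x by exact: fin_all_exists.
  move=> P; have [P2|P2] := boolP (1 < #|P|)%N; last by exists 0.
  by have [r [x rx]] := pattern_perron R P2; exists r => _; exists x.
pose adm (P : {set 'I_(2 * L).+1}) := ([set s : 'I_(2 * L).+1 | ~~ odd s] \subset P) && (#|P| == #|P1|).
have adm1 : adm P1 by rewrite /adm eqxx andbT; apply/evE.
case: (Order.TotalTheory.arg_maxP rho adm1) => P /andP[/evE evP /eqP cP] maxP.
have [|x [r0 ray eigx x0 xP]] := rhoP P; first by rewrite cP.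
exists P, (rho P), x; split => //; split => // P' evP' cP'.
have [|x' [_ ray' _ _ _]] := rhoP P'; first by rewrite cP' cP.
move=> y yP; apply: le_trans (ray' y yP) _; apply: (ler_wpM2r (sqnorm_ge0 _)).
by apply: maxP; rewrite /adm cP' cP eqxx andbT; apply/evE.
Qed.

Lemma positional_evens n L (pos : 'I_n -> 'I_(2 * L).+1) E : positional pos E ->
  contains_evens [set pos u | u : 'I_n] /\ #|[set pos u | u : 'I_n]| = n.
Proof.
move=> [inj even _]; split; last by rewrite card_imset// card_ord.
move=> s es; have sL := ltn_ord s; have [|u uE] := even s./2.
  by move: sL; clear; lia.
apply/imsetP; exists u => //; apply/val_inj; rewrite /= uE.
by move: es; clear; lia.
Qed.

(** This holds for every positive [x]; the Perron vector of [E] turns the strict alternative into a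
    strict inequality of spectral radii. *)
Lemma chain_comparison n L (E : {set {set 'I_n}}) (x : 'I_n -> R) :
  hypertree E -> rank_le3 E -> n = (L.+1 + num_3edges E)%N -> (forall u, 0 < x u) ->
  exists (pos : 'I_n -> 'I_(2 * L).+1) F, positional pos F /\
    (bilin (fun u v => (dist E u v)%:R) x x < bilin (fun u v => (dist F u v)%:R) x x
     \/ F = E).
Proof.
move=> hypE rankE nE x0.
have n0 : (0 < n)%N by rewrite nE.
have [r _ minr] := Order.TotalTheory.arg_minP (fun u => \sum_v (dist E u v)%:R * x v)
  (isT : xpredT (Ordinal n0)).
have [f [uf allf EE]] := hypertree_forest r hypE rankE.
have dE := dist_forest uf allf EE.
set S := \sum_v x v.
have fS : weight x f < S.
  rewrite weight_labels.
  have -> : S = \sum_(v <- r :: labels f) x v.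
    by rewrite big_uniq//; apply: eq_bigl => v; rewrite allf.
  by rewrite big_cons ltrDr.
have bal : balanced x S f.
  have sumE y : \sum_v (fdist f y v)%:R * x v = \sum_v (dist E y v)%:R * x v.
    by apply: eq_bigr => v _; rewrite dE.
  by apply: median_balanced uf _ => y _; rewrite !sumE; exact: minr.
have [c1 [c2 [pl tri en]]] := straighten_root x0 bal fS.
have [v0 [c [plc tric edc]]] := chain_reroot r c1 c2.
set g := fcat _ _ in pl tri en plc tric edc.
have plg : perm_eq (r :: labels g) (r :: labels f) by rewrite perm_cons.
have ug : uniq (r :: labels g) by rewrite (perm_uniq plg).
have allg v : v \in r :: labels g by rewrite (perm_mem plg).
have uc : uniq (v0 :: labels (chain c)) by rewrite (perm_uniq plc).
have allc v : v \in v0 :: labels (chain c) by rewrite (perm_mem plc).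
have cL : size c = L.
  have sz : size (v0 :: labels (chain c)) = n.
    rewrite -(card_uniqP uc) -[RHS]card_ord; apply: eq_card => u.
    by rewrite [LHS]allc.
  move: sz; rewrite /= size_labels_chain tric tri -(num_3edges_triangles uf EE) => szc.
  by apply/eqP; rewrite -(eqn_add2r (num_3edges E)) -eqSS szc {1}nE addSn.
have [] := chain_positional uc allc; rewrite cL => pos posF.
exists pos, [set e in edges v0 (chain c)]; split => //.
have FE : [set e in edges v0 (chain c)] = [set e in edges r g].
  by apply/setP => e; rewrite !inE edc.
have dF := dist_forest ug allg FE.
have bE : bilin (fun u v => (dist E u v)%:R) x x = 2 * energy x S f.
  rewrite -bilin_fdist; last by case/andP: uf.
  by apply: eq_bigr => u _; apply: eq_bigr => v _; rewrite dE.
have bF : bilin (fun u v => (dist [set e in edges v0 (chain c)] u v)%:R) x x = 2 * energy x S g.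
  rewrite -bilin_fdist; last by case/andP: ug.
  by apply: eq_bigr => u _; apply: eq_bigr => v _; rewrite dF.
case: en => [lt|[_ edg]]; [left|right]; first by rewrite bE bF; lra.
by rewrite FE EE; apply/setP => e; rewrite !inE edg.
Qed.

Lemma hypertree_perron n (E : {set {set 'I_n}}) :
  (1 < n)%N -> hypertree E -> rank_le3 E ->
  exists r (x : 'I_n -> R), [/\ largest_eigenvalue (dist_matrix R E) r,
    forall u, 0 < x u & bilin (fun u v => (dist E u v)%:R) x x = r * sqnorm x].
Proof.
move=> n1 hypE rankE; pose u0 : 'I_n := Ordinal (ltnW n1).
have [f [uf allf EE]] := hypertree_forest u0 hypE rankE.
have distC u v : dist E u v = dist E v u by rewrite !(dist_forest uf allf EE) fdistC.
have [r [x [_ maxE eigx x_gt0 _]]] : exists r (x : 'I_n -> R), [/\ 0 < r,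
    forall y, bilin (fun u v => (dist E u v)%:R) y y <= r * sqnorm y,
    forall u, \sum_v (dist E u v)%:R * x v = r * x u,
    forall u, u \in setT -> 0 < x u & forall u, u \notin setT -> x u = 0].
  apply: perron => [u v|u v|u v _ _ uv|u v|]; rewrite ?inE ?cardsT ?card_ord //.
  - by rewrite distC.
  - by rewrite ltr0n dist_gt0//; case: hypE => _ [].
have {}x_gt0 u : 0 < x u by rewrite x_gt0 ?inE.
exists r, x; split => //.
  apply: (largest_eigenvalueP (x := x)).
  - by move=> u v; rewrite !mxE distC.
  - move=> y; apply: le_trans (maxE y); rewrite le_eqVlt; apply/orP; left; apply/eqP.
    by apply: eq_bigr => u _; apply: eq_bigr => v _; rewrite mxE.
  - by move=> u; rewrite -eigx; apply: eq_bigr => v _; rewrite mxE.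
  - by exists u0; rewrite gt_eqF.
rewrite /bilin /sqnorm mulr_sumr; apply: eq_bigr => u _.
rewrite (eq_bigr (fun v => x u * ((dist E u v)%:R * x v))) => [|v _]; last by ring.
by rewrite -mulr_sumr eigx; ring.
Qed.

Lemma optimal_Tnab n L k (P : {set 'I_(2 * L).+1}) (r : R) x :
  (k <= L)%N -> n = (L.+1 + k)%N -> optimal P r x -> #|P| = n ->
  exists2 pos : 'I_n -> 'I_(2 * L).+1, positional pos (Tnab n k./2 (k - k./2)) &
    [set pos u | u : 'I_n] = P.
Proof.
move=> kL nE optP cP.
have [||pos [TP im]] := @Tnab_positional n L k./2 (k - k./2).
- by move: kL; clear; lia.
- by rewrite nE; clear; lia.
have [|PE|PE] := optimal_pattern (k := k) optP; first by rewrite cP.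
  by exists pos; rewrite ?im.
exists (fun u => rev_ord (pos u)); first exact: positional_rev.
rewrite PE -im; apply/setP => s; rewrite inE; apply/imsetP/imsetP => -[u _ e]; exists u => //.
  by rewrite e rev_ordK.
by rewrite -e rev_ordK.
Qed.

End Comparison.

Local Close Scope ring_scope.

Theorem theorem1p2 (R : realType) (n k : nat) (E : {set {set 'I_n}}) (r1 r2 : R) :
  1 <= k <= (n - 1)./2 ->
  hypertree E -> rank_le3 E -> num_3edges E = k ->
  largest_eigenvalue (dist_matrix R E) r1 ->
  largest_eigenvalue (dist_matrix R (Tnab n k./2 (k - k./2))) r2 ->
  (r1 <= r2)%R /\ (r1 = r2 <-> isomorphic E (Tnab n k./2 (k - k./2))).
Proof.
move=> /andP[k1 kn] hypE rankE Ek eig1 eig2.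
(* The number of edges: one of size two adds one vertex, one of size three adds two, so
   [n - 1 = L + k]. *)
pose L := n - k.+1.
have kL : k <= L by move: k1 kn; rewrite /L; clear; lia.
have nE : n = L.+1 + k by move: k1 kn; rewrite /L; clear; lia.
have n1 : 1 < n by move: k1 kn; clear; lia.
have [r [x [eigr x_gt0 bilE]]] := hypertree_perron R n1 hypE rankE.
have r1r := largest_eigenvalue_inj eig1 eigr; subst r.
have [|pos1 [F [FP cmp]]] := chain_comparison (L := L) hypE rankE _ x_gt0.
  by rewrite Ek.
have [ev1 c1] := positional_evens FP.
set P1 := [set pos1 u | u : 'I_n] in ev1 c1.
have P1_gt1 : 1 < #|P1| by rewrite c1.
have [P0 [M [x0 [opt0 cP0]]]] := optimal_exists R ev1 P1_gt1.
have [pos0 TP im0] := optimal_Tnab kL nE opt0 (etrans cP0 c1).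
have [_ pp0 bound0] := opt0.
(* [T(n, ...)] occupies the optimal set [P0], so [r2] is the maximum over all position sets of this
   size. *)
have r2M : r2 = M.
  apply: (largest_eigenvalue_inj eig2); apply: (positional_eigenvalue (ltnW n1) TP (x := x0)).
  by rewrite im0.
have rayF := positional_rayleigh x FP (bound0 P1 ev1 (esym cP0)).
have sq0 : (0 < sqnorm x)%R.
  rewrite /sqnorm (bigD1 (Ordinal (ltnW n1)))//= ltr_pwDl ?exprn_gt0// sumr_ge0// => u _.
  by rewrite sqr_ge0.
split.
  by rewrite r2M -(ler_pM2r sq0) -bilE; apply: le_trans rayF; case: cmp => [/ltW|->].
split=> [r12|iso].
  case: cmp => [lt|FE].
    by move: (lt_le_trans lt rayF); rewrite bilE -r2M r12 ltxx.
  have [rho [x1 pp1]] := pattern_perron R P1_gt1.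
  have eigF := positional_eigenvalue (ltnW n1) FP pp1.
  have rhoM : rho = M by rewrite -r2M -r12; apply: largest_eigenvalue_inj eigF _; rewrite FE.
  (* Equality makes [E] itself positional on a set with the maximal spectral radius, so the
     description of optimal sets applies to its own positions. *)
  have opt1 : optimal P1 M x1.
    split=> //; first by rewrite -rhoM.
    by move=> P' evP' cP'; apply: bound0; rewrite // cP'.
  have [pos TP1 im1] := optimal_Tnab kL nE opt1 c1.
  by rewrite -FE; apply: positional_iso FP TP1 _; rewrite im1.
have [pos [EP im]] := isomorphic_positional iso TP.
rewrite r2M; apply: (largest_eigenvalue_inj eig1).
apply: (positional_eigenvalue (ltnW n1) EP (x := x0)).
by rewrite im im0.
Qed.
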